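(* Assume the following. (a) (Weak $B$-condition) There are a strictly positive self-adjoint $B\in L(H)$ with $A^*B\in L(H)$ and $c_0\ge0$ such that $-A^*B+c_0B\ge0$. (b) $b$ and $\sigma$ are continuous on $H\times\Lambda_0$ and there is $C>0$ such that $\|b(x,a)-b(x',a)\|_H\le C\|x-x'\|_{-1}$, $\|\sigma(x,a)-\sigma(x',a)\|_{L_2(\Xi,H)}\le C\|x-x'\|_{-1}$, $\|b(x,a)\|_H\le C(1+\|x\|_H+\|a\|_\Lambda)$ and $\|\sigma(x,a)\|_{L_2(\Xi,H)}\le C(1+\|x\|_H+\|a\|_\Lambda)$ for all $x,x'\in H$, $a\in\Lambda_0$. (c) $l$ is continuous on $H\times\Lambda_0$ and there is $C>0$ such that $|l(x,a)-l(x',a)|\le C\|x-x'\|_{-1}$, $|l(x,a)|\le C(1+\|x\|_H+\|a\|_\Lambda^2)$ and $|g(x)-g(x')|\le C\|x-x'\|_{-1}$ for all $x,x'\in H$, $a\in\Lambda_0$; moreover, if $\Lambda_0$ is unbounded, $l$ and $g$ are bounded from below. Then there are constants $C_1,C_2$ independent of $T$ such that $$|V(t,x)-V(t,y)|\le C_1\mathrm e^{C_2(T-t)}\|x-y\|_{-1}$$ for all $t\in[0,T]$ and $x,y\in H$.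
   Context: $H$ and $\Xi$ are real separable Hilbert spaces, $\Lambda$ is a real separable Banach space, $\Lambda_0\subset\Lambda$ is convex, $p>2$ and $0<T<\infty$ are fixed. $L(H)$ denotes bounded linear operators on $H$, $L_2(\Xi,H)$ Hilbert--Schmidt operators. For $C\in L(H)$, $C\ge0$ means $\langle Cx,x\rangle_H\ge0$ for all $x$; a self-adjoint $B$ is strictly positive if $\langle Bx,x\rangle_H>0$ for $x\neq0$; $\|x\|_{-1}^2:=\langle Bx,x\rangle_H$. $A:\mathcal D(A)\subset H\to H$ is linear, densely defined and maximal dissipative; it generates a $C_0$-semigroup of contractions $(\mathrm e^{sA})_{s\ge 0}$. The coefficients are $b:H\times\Lambda\to H$, $\sigma:H\times\Lambda\to L_2(\Xi,H)$, $l:H\times\Lambda\to\mathbb R$, $g:H\to\mathbb R$. For $t\in[0,T]$, a reference probability space $(\Omega,\mathscr F,(\mathscr F^t_s)_{s\in[t,T]},\mathbb P,(W(s))_{s\in[t,T]})$ is fixed: $(\Omega,\mathscr F,\mathbb P)$ is complete, $W$ is a cylindrical Wiener process in $\Xi$ with $W(t)=0$ $\mathbb P$-a.s., and $\mathscr F^t_s$ is generated by $\{W(\tau):t\le\tau\le s\}$ and the $\mathbb P$-null sets. $\mathcal U_t$ is the set of all $\mathscr F^t_s$-progressively measurable $a(\cdot):[t,T]\times\Omega\to\Lambda_0$ with $\mathbb E\int_t^T\|a(s)\|_\Lambda^p\,\mathrm ds<\infty$. $X(\cdot;t,x,a(\cdot))$ is the mild solution with continuous trajectories of $\mathrm dX(s)=[AX(s)+b(X(s),a(s))]\mathrm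 ds+\sigma(X(s),a(s))\mathrm dW(s)$, $X(t)=x$, i.e. $X(s)=\mathrm e^{(s-t)A}x+\int_t^s\mathrm e^{(s-r)A}b(X(r),a(r))\mathrm dr+\int_t^s\mathrm e^{(s-r)A}\sigma(X(r),a(r))\mathrm dW(r)$. Further $J(t,x;a(\cdot))=\mathbb E\big[\int_t^T l(X(s),a(s))\mathrm ds+g(X(T))\big]$ with $X(s)=X(s;t,x,a(\cdot))$, and the value function is $V(t,x)=\inf_{a(\cdot)\in\mathcal U_t}J(t,x;a(\cdot))$. *)

(* Defs.v *)
From HB Require Import structures.
From mathcomp Require Import all_boot all_order all_algebra.
From mathcomp Require Import all_classical all_reals all_analysis.

Set Implicit Arguments.
Unset Strict Implicit.
Unset Printing Implicit Defensive.

Import Order.TTheory GRing.Theory Num.Theory.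
Import numFieldNormedType.Exports.

Local Open Scope classical_set_scope.
Local Open Scope ring_scope.

HB.mixin Record CompleteNormedModule_isHilbert (R : realType) H
    of CompleteNormedModule R H := {
  inner : H -> H -> R ;
  innerC : forall x y, inner x y = inner y x ;
  inner_linearl : forall (k : R) x y z,
    inner (k *: x + y) z = k * inner x z + inner y z ;
  inner_norm : forall x, inner x x = `|x| ^+ 2
}.

#[short(type="hilbertType")]
HB.structure Definition Hilbert (R : realType) :=
  {H of CompleteNormedModule R H & CompleteNormedModule_isHilbert R H}.

Definition separable_space (T : topologicalType) : Prop :=
  exists2 D : set T, countable D & dense D.

Section operators.
Context {R : realType} {H Xi : hilbertType R}.

Definition orthonormal_basis (E : set Xi) : Prop :=
  [/\ forall e, E e -> `|e| = 1,
      forall e e', E e -> E e' -> e <> e' -> inner e e' = 0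
    & forall x, (forall e, E e -> inner x e = 0) -> x = 0].

Definition hs_sqnorm (E : set Xi) (Q : Xi -> H) : \bar R :=
  (\esum_(e in E) (`|Q e| ^+ 2)%:E)%E.

Definition hs_norm (E : set Xi) (Q : Xi -> H) : R :=
  Num.sqrt (fine (hs_sqnorm E Q)).

(* Continuity is not redundant: a linear map that is square summable along an
   orthonormal basis need not be bounded. *)
Definition hilbert_schmidt (E : set Xi) (Q : {linear Xi -> H}) : Prop :=
  continuous Q /\ (hs_sqnorm E Q < +oo)%E.

(* An unbounded operator is a domain D together with a total function A; only
   the values of A on D matter. *)
Definition linear_on (D : set H) (A : H -> H) : Prop :=
  D 0 /\ forall (k : R) x y, D x -> D y ->
    D (k *: x + y) /\ A (k *: x + y) = k *: A x + A y.

Definition dissipative (D : set H) (A : H -> H) : Prop :=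
  forall x, D x -> inner (A x) x <= 0.

Definition maximal_dissipative (D : set H) (A : H -> H) : Prop :=
  dissipative D A /\
  forall D' A', linear_on D' A' -> dissipative D' A' ->
    D `<=` D' -> (forall x, D x -> A' x = A x) -> D' `<=` D.

Definition contraction_semigroup (S : R -> {linear H -> H}) : Prop :=
  [/\ forall x, S 0 x = x,
      forall s r x, 0 <= s -> 0 <= r -> S (s + r) x = S s (S r x),
      forall s x, 0 <= s -> `|S s x| <= `|x|
    & forall x, S s x @[s --> 0^'+] --> x].

Definition is_generator (D : set H) (A : H -> H) (S : R -> {linear H -> H}) :
    Prop :=
  forall x y, (D x /\ A x = y) <->
    (s^-1 *: (S s x - x) @[s --> 0^'+] --> y).

(* (y, z) lies in the graph of the adjoint A^*: y is in its domain and
   A^* y = z. *)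
Definition adjoint_graph (D : set H) (A : H -> H) (y z : H) : Prop :=
  forall x, D x -> inner (A x) y = inner x z.

(* K is A^* B. *)
Definition weak_B_condition (D : set H) (A : H -> H) (B : {linear H -> H}) :
    Prop :=
  [/\ continuous B,
      forall x y, inner (B x) y = inner x (B y),
      forall x, x != 0 -> 0 < inner (B x) x
    & exists K : {linear H -> H}, exists c0 : R,
        [/\ continuous K,
            forall z, adjoint_graph D A (B z) (K z),
            0 <= c0
          & forall x, 0 <= inner (- K x + c0 *: B x) x]].

Definition norm_m1 (B : H -> H) (x : H) : R := Num.sqrt (inner (B x) x).

End operators.

Section coefficients.
Context {R : realType} {H Xi : hilbertType R} {Lam : completeNormedModType R}.
Variables (E : set Xi) (B : H -> H) (L0 : set Lam).

Definition state_coefficients_condition (b : H -> Lam -> H)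
    (sigma : H -> Lam -> {linear Xi -> H}) : Prop :=
  [/\ {within [set: H] `*` L0, continuous (fun z : H * Lam => b z.1 z.2)},
      forall x a, L0 a ->
        hs_norm E (sigma z.1 z.2 \- sigma x a)
          @[z --> within ([set: H] `*` L0) (nbhs (x, a))] --> (0 : R)
    & exists2 C : R, 0 < C & forall x x' a, L0 a ->
        [/\ `|b x a - b x' a| <= C * norm_m1 B (x - x'),
            hs_norm E (sigma x a \- sigma x' a) <= C * norm_m1 B (x - x'),
            `|b x a| <= C * (1 + `|x| + `|a|)
          & hs_norm E (sigma x a) <= C * (1 + `|x| + `|a|)]].

Definition cost_coefficients_condition (l : H -> Lam -> R) (g : H -> R) :
    Prop :=
  [/\ {within [set: H] `*` L0, continuous (fun z : H * Lam => l z.1 z.2)},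
      exists2 C : R, 0 < C & forall x x' a, L0 a ->
        [/\ `|l x a - l x' a| <= C * norm_m1 B (x - x'),
            `|l x a| <= C * (1 + `|x| + `|a| ^+ 2)
          & `|g x - g x'| <= C * norm_m1 B (x - x')]
    & ~ bounded_set L0 ->
        exists m : R, forall x a, L0 a -> m <= l x a /\ m <= g x].

End coefficients.

Section bochner.
Context {R : realType} {H : hilbertType R}.

Record step := Step {
  step_set : set R ;
  step_meas : measurable step_set ;
  step_val : H }.

Definition step_fun (f : seq step) (r : R) : H :=
  \sum_(c <- f) (\1_(step_set c) r : R) *: step_val c.

Definition step_integral (D : set R) (f : seq step) : H :=
  \sum_(c <- f) fine (lebesgue_measure (step_set c `&` D)) *: step_val c.

(* y is the Bochner integral of f over D, a set of finite Lebesgue measure.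
   H being separable, strong measurability is Borel measurability. *)
Definition is_bochner_integral (D : set R) (f : R -> H) (y : H) : Prop :=
  (forall U, open U -> measurable (D `&` f @^-1` U)) /\
  exists phi : nat -> seq step,
    ((\int[lebesgue_measure]_(r in D) (`|step_fun (phi n) r - f r|)%:E)%E
       @[n --> \oo] --> 0%E) /\
    (step_integral D (phi n) @[n --> \oo] --> y).

End bochner.

Section stochastic.
Context {R : realType} {H Xi : hilbertType R}.
Context {d : measure_display} {Omega : measurableType d}.
Variables (P : probability Omega R) (W : R -> Xi -> Omega -> R).

Definition wiener_filtration (t s : R) : set (set Omega) :=
  <<s [set G | P.-negligible G \/
        exists tau xi U, [/\ t <= tau <= s, measurable U
                           & G = W tau xi @^-1` U]] >>.

(* W s xi stands for the isonormal pairing <W(s), xi>. For xi = 0 the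
   increments vanish almost surely by linearity; [normal_prob 0 0] is not the
   Dirac mass, hence the restriction xi != 0 in the fifth clause. *)
Record cylindrical_wiener (t T : R) : Prop := {
  wiener_meas : forall s xi, t <= s <= T -> measurable_fun setT (W s xi) ;
  wiener_linear : forall s (k : R) xi eta, t <= s <= T ->
    {ae P, forall w, W s (k *: xi + eta) w = k * W s xi w + W s eta w} ;
  wiener_start : forall xi, {ae P, forall w, W t xi w = 0} ;
  wiener_continuous : forall xi,
    {ae P, forall w, {within `[t, T], continuous (fun s => W s xi w)}} ;
  wiener_normal : forall s r (xi : Xi) U, t <= s -> s < r -> r <= T -> xi != 0 ->
    measurable U ->
    P ((W r xi \- W s xi) @^-1` U) =
      normal_prob 0 (Num.sqrt (r - s) * `|xi|) U ;
  wiener_indep : forall s r (xi : Xi) G U, t <= s -> s < r -> r <= T ->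
    wiener_filtration t s G -> measurable U ->
    P (G `&` (W r xi \- W s xi) @^-1` U) =
      (P G * P ((W r xi \- W s xi)%R @^-1` U))%E }.

(* On [t, s] the process is measurable for the product of the Borel sets and
   the sigma-algebra of time s. *)
Definition progressive (t T : R) (V : topologicalType) (f : R -> Omega -> V) :
    Prop :=
  forall s, t <= s <= T -> forall U, open U ->
    <<s [set I `*` G | I in measurable & G in wiener_filtration t s] >>
      [set z : R * Omega | t <= z.1 <= s /\ U (f z.1 z.2)].

Definition cvg_to0_in_prob (f : nat -> Omega -> \bar R) : Prop :=
  forall eps : R, 0 < eps ->
    P [set w | (eps%:E <= f n w)%E] @[n --> \oo] --> 0%E.

(* The elementary integrand 1_{(lo, hi]} 1_G <dir, .> val with G in the
   sigma-algebra of time lo. *)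
Record elementary (t s : R) := Elementary {
  el_lo : R ;
  el_hi : R ;
  el_time : t <= el_lo <= el_hi /\ el_hi <= s ;
  el_event : set Omega ;
  el_adapted : wiener_filtration t el_lo el_event ;
  el_dir : Xi ;
  el_val : H }.

Definition elementary_process (t s : R) (phi : seq (elementary t s))
    (r : R) (w : Omega) (xi : Xi) : H :=
  \sum_(c <- phi)
    ((\1_(`]el_lo c, el_hi c]) r : R) * (\1_(el_event c) w : R)
      * inner (el_dir c) xi) *: el_val c.

Definition elementary_integral (t s : R) (phi : seq (elementary t s))
    (w : Omega) : H :=
  \sum_(c <- phi)
    ((\1_(el_event c) w : R)
      * (W (el_hi c) (el_dir c) w - W (el_lo c) (el_dir c) w)) *: el_val c.

(* J is the Ito integral over [t, s] of Phi with respect to W, for Phi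
   progressively measurable with almost surely square integrable
   Hilbert-Schmidt norm: the limit in probability of elementary integrals. *)
Definition is_stochastic_integral (E : set Xi) (t s : R)
    (Phi : R -> Omega -> Xi -> H) (J : Omega -> H) : Prop :=
  [/\ forall xi, progressive t s (fun r w => Phi r w xi),
      {ae P, forall w,
        (\int[lebesgue_measure]_(r in `[t, s]) hs_sqnorm E (Phi r w) < +oo)%E},
      forall U, open U -> measurable (J @^-1` U)
    & exists phi : nat -> seq (elementary t s),
        cvg_to0_in_prob (fun n w =>
          (\int[lebesgue_measure]_(r in `[t, s])
             hs_sqnorm E (elementary_process (phi n) r w \- Phi r w)%R)%E) /\
        cvg_to0_in_prob (fun n w =>
          (`|elementary_integral (phi n) w - J w|)%:E)].

End stochastic.

Section control.
Context {R : realType} {H Xi : hilbertType R} {Lam : completeNormedModType R}.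
Context {d : measure_display} {Omega : measurableType d}.
Variables (P : probability Omega R) (W : R -> Xi -> Omega -> R).

Definition admissible_controls (L0 : set Lam) (p t T : R) :
    set (R -> Omega -> Lam) :=
  [set a | [/\ forall s w, t <= s <= T -> L0 (a s w),
               progressive P W t T a
             & (\int[P]_w \int[lebesgue_measure]_(s in `[t, T])
                  (`|a s w| `^ p)%:E < +oo)%E]].

Definition is_mild_solution (E : set Xi) (S : R -> {linear H -> H})
    (b : H -> Lam -> H) (sigma : H -> Lam -> {linear Xi -> H}) (t T : R)
    (x : H) (a : R -> Omega -> Lam) (X : R -> Omega -> H) : Prop :=
  [/\ progressive P W t T X,
      {ae P, forall w, {within `[t, T], continuous (fun s => X s w)}}
    & forall s, t <= s <= T ->
        exists J : Omega -> H,
          is_stochastic_integral P W E t s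
            (fun r w xi => S (s - r) (sigma (X r w) (a r w) xi)) J /\
          {ae P, forall w, exists y : H,
            is_bochner_integral `[t, s]
              (fun r => S (s - r) (b (X r w) (a r w))) y /\
            X s w = S (s - t) x + y + J w}].

Definition cost (l : H -> Lam -> R) (g : H -> R) (t T : R)
    (a : R -> Omega -> Lam) (X : R -> Omega -> H) : \bar R :=
  (\int[P]_w (\int[lebesgue_measure]_(s in `[t, T]) (l (X s w) (a s w))%:E
              + (g (X T w))%:E))%E.

(* X x a is the state started from x under the control a. An estimate
   `|V x - V y| <= r%:E in \bar R entails that V x and V y are finite, because
   +oo - +oo = -oo there. *)
Definition value_function (l : H -> Lam -> R) (g : H -> R) (L0 : set Lam)
    (p t T : R) (X : H -> (R -> Omega -> Lam) -> R -> Omega -> H) (x : H) :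
    \bar R :=
  ereal_inf [set cost l g t T a (X x a) | a in admissible_controls L0 p t T].

End control.

(* Main.v *)
(* Let [Z] be the difference of two solutions under the same control, started
   from [x] and [y], and [z = x - y].  By the mild formulation
   [Z s = S (s - t) z + Y s + J s], where [Y] is a Bochner and [J] a stochastic
   integral whose integrands are dominated by [k = C |Z|_{-1}].  An Euler scheme
   turns the weak B-condition into [|S s z|_{-1} <= exp (c0 s) |z|_{-1}], and
   since [|.|_{-1}] is dominated by the norm of [H], it remains to bound [Y] and
   [J] in [H], which needs no Ito formula.  With [K s] the integral of [k ^ 2]
   over [[t, s]], weighted by a decreasing exponential, [Y] is handled by
   Cauchy-Schwarz and [J] by the bound of [E |J s| ^ 2] on the event [K s < c] by
   a multiple of [E (min (K s) c)].  This truncation makes every expectation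
   finite without any a priori integrability, so Gronwall applies to
   [E (min (K s) c)] uniformly in [c].  Comparing a solution with the zero
   process in the same way yields its second moments, hence finite costs.

   The truncated bound of [J] is first proved for elementary integrands, by
   stopping the sum over the cells of the grid and comparing with the
   Hilbert-Schmidt norm through Parseval, and passes to limits in probability. *)

Require Import Defs.
From HB Require Import structures.
From mathcomp Require Import all_boot all_order all_algebra.
From mathcomp Require Import all_classical all_reals all_analysis.
From mathcomp Require Import measurable_realfun ring lra.

Set Implicit Arguments.
Unset Strict Implicit.
Unset Printing Implicit Defensive.

Import Order.TTheory GRing.Theory Num.Theory.
Import numFieldNormedType.Exports.

Local Open Scope classical_set_scope.
Local Open Scope ring_scope.

(** * Weak norm and semigroup *)

(** An Ito formula for [<B Z, Z>] is not directly available, since a mild solution need not take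
    values in the domain of [A]. It can be avoided because the coefficients map the weak norm into
    the norm of [H]: the deviation of [Z s] from [S (s - t) z] is measured in the stronger norm,
    where [S] is a contraction, and only the initial datum has to be propagated in the weak norm.
    The exponential weight keeps the constants free of [T]. Plain Cauchy-Schwarz bounds the drift by
    [s - t] times the energy, and Gronwall would then give an exponential of order [(T - t)^2].
    Against the weight [expR (lam * (t - r))] with [lam >= 1] the loss is [expR (lam * (s - t))],
    which the weight cancels at the next use, so the Gronwall rate is a constant. The remaining
    factors linear in [T - t] are absorbed by [expR (T - t)]. Finiteness is a separate matter:
    [V x - V y] says something only for finite values. Second moments, [p > 2] and the lower bounds
    of [l] and [g] serve this purpose, and the bounds they give may depend on [T]. *)

Section inner_product.
Context {R : realType} {H : hilbertType R}.
Implicit Types x y z : H.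

Lemma innerDl x y z : inner (x + y) z = inner x z + inner y z.
Proof. by rewrite -{1}(scale1r x) inner_linearl mul1r. Qed.

Lemma inner0l z : inner (0 : H) z = 0.
Proof. by have := innerDl 0 0 z; rewrite addr0; lra. Qed.

Lemma innerZl (k : R) x z : inner (k *: x) z = k * inner x z.
Proof. by rewrite -[k *: x]addr0 inner_linearl inner0l addr0. Qed.

Lemma innerNl x z : inner (- x) z = - inner x z.
Proof. by rewrite -scaleN1r innerZl mulN1r. Qed.

Lemma innerBl x y z : inner (x - y) z = inner x z - inner y z.
Proof. by rewrite innerDl innerNl. Qed.

Lemma innerDr x y z : inner x (y + z) = inner x y + inner x z.
Proof. by rewrite innerC innerDl !(innerC x). Qed.

Lemma inner0r z : inner z (0 : H) = 0.
Proof. by rewrite innerC inner0l. Qed.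

Lemma innerZr (k : R) x z : inner x (k *: z) = k * inner x z.
Proof. by rewrite innerC innerZl (innerC x). Qed.

Lemma innerNr x z : inner x (- z) = - inner x z.
Proof. by rewrite innerC innerNl (innerC x). Qed.

Lemma innerBr x y z : inner x (y - z) = inner x y - inner x z.
Proof. by rewrite innerDr innerNr. Qed.

Lemma inner_suml (I : Type) (r : seq I) (P : pred I) (F : I -> H) z :
  inner (\sum_(i <- r | P i) F i) z = \sum_(i <- r | P i) inner (F i) z.
Proof.
apply: (big_ind2 (fun u v => inner u z = v)) => [|u a v b <- <-|//].
- exact: inner0l.
- exact: innerDl.
Qed.

Lemma inner_sumr (I : Type) (r : seq I) (P : pred I) (F : I -> H) z :
  inner z (\sum_(i <- r | P i) F i) = \sum_(i <- r | P i) inner z (F i).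
Proof. by rewrite innerC inner_suml; apply: eq_bigr => i _; rewrite innerC. Qed.

Lemma sqnormD x y : `|x + y| ^+ 2 = `|x| ^+ 2 + 2 * inner x y + `|y| ^+ 2.
Proof. by rewrite -!inner_norm !innerDl !innerDr (innerC y x); ring. Qed.

Lemma sqnormB x y : `|x - y| ^+ 2 = `|x| ^+ 2 - 2 * inner x y + `|y| ^+ 2.
Proof. by rewrite sqnormD innerNr normrN; ring. Qed.

Lemma cauchy_schwarz x y : `|inner x y| <= `|x| * `|y|.
Proof.
have [->|y0] := eqVneq y 0; first by rewrite inner0r !normr0 mulr0.
rewrite -ler_sqr ?nnegrE ?mulr_ge0// real_normK ?num_real// exprMn.
have y2 : 0 < `|y| ^+ 2 by rewrite exprn_gt0// normr_gt0.
have := sqr_ge0 `|x - (inner x y / `|y| ^+ 2) *: y|.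
rewrite sqnormB innerZr normrZ exprMn real_normK ?num_real//.
have -> : `|x| ^+ 2 - 2 * (inner x y / `|y| ^+ 2 * inner x y) +
   (inner x y / `|y| ^+ 2) ^+ 2 * `|y| ^+ 2 =
   (`|x| ^+ 2 * `|y| ^+ 2 - inner x y ^+ 2) / `|y| ^+ 2.
  by field; rewrite normr_eq0.
by rewrite pmulr_lge0 ?invr_gt0// subr_ge0.
Qed.

Lemma sqnormD_le x y : `|x + y| ^+ 2 <= 2 * `|x| ^+ 2 + 2 * `|y| ^+ 2.
Proof.
have := sqr_ge0 `|x - y|; rewrite sqnormB => h.
by rewrite sqnormD; lra.
Qed.

Lemma continuous_innerr (y : H) : continuous (inner y).
Proof.
move=> x; apply/cvgrPdist_le => e e0.
near=> z; rewrite -innerBr (le_trans (cauchy_schwarz _ _))//.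
rewrite (@le_trans _ _ ((`|y| + 1) * `|x - z|))//.
  by rewrite ler_wpM2r// lerDl.
rewrite -ler_pdivlMl ?ltr_pwDr//.
near: z; apply: cvgr_dist_le => //.
by rewrite mulr_gt0// invr_gt0 ltr_pwDr.
Unshelve. all: by end_near. Qed.

Lemma continuous_innerl (y : H) : continuous (fun x => inner x y).
Proof.
rewrite [X in continuous X](_ : _ = inner y); first exact: continuous_innerr.
by apply/funext => x; rewrite innerC.
Qed.

End inner_product.

Section weak_norm.
Context {R : realType} {H : hilbertType R} (B : {linear H -> H}).
Hypothesis B_cont : continuous B.
Hypothesis B_sym : forall x y, inner (B x) y = inner x (B y).
Hypothesis B_gt0 : forall x, x != 0 -> 0 < inner (B x) x.

Local Notation N x := (inner (B x) x).

Lemma continuous_linear_bounded (K : normedModType R) (F : {linear H -> K}) :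
  continuous F -> exists2 M : R, 0 < M & forall x, `|F x| <= M * `|x|.
Proof.
move=> Fc.
have /linear_bounded_continuous/linear_boundedP[M [_ HM]] := Fc.
exists (`|M| + 1); first by rewrite ltr_pwDr.
by move=> x; apply: HM; rewrite (le_lt_trans (ler_norm _))// ltrDl.
Qed.

Lemma weak_sqnorm_ge0 x : 0 <= N x.
Proof.
by have [->|/B_gt0/ltW//] := eqVneq x 0; rewrite inner0r.
Qed.

Lemma weak_sqnorm_le : exists2 M : R, 0 < M & forall x, N x <= M * `|x| ^+ 2.
Proof.
have [M M0 HM] := continuous_linear_bounded B_cont.
exists M => // x; rewrite (le_trans (ler_norm _))// (le_trans (cauchy_schwarz _ _))//.
by rewrite expr2 mulrA ler_wpM2r.
Qed.

Lemma norm_m1_ge0 x : 0 <= norm_m1 B x.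
Proof. exact: sqrtr_ge0. Qed.

Lemma sqr_norm_m1 x : norm_m1 B x ^+ 2 = N x.
Proof. by rewrite sqr_sqrtr// weak_sqnorm_ge0. Qed.

Lemma weak_sqnormD x y : N (x + y) = N x + 2 * inner (B x) y + N y.
Proof.
by rewrite linearD !innerDl !innerDr (B_sym y x) (innerC y (B x)); ring.
Qed.

Lemma weak_sqnormD_le x y : N (x + y) <= 2 * N x + 2 * N y.
Proof.
have := weak_sqnorm_ge0 (x - y).
rewrite weak_sqnormD innerNr linearN innerNl innerNr opprK => h.
by rewrite weak_sqnormD; lra.
Qed.

Lemma continuous_weak_sqnorm : continuous (fun x => N x).
Proof.
have [M M0 HM] := continuous_linear_bounded B_cont.
move=> x.
have -> : (fun z => N z) = (fun z => N x + 2 * inner (B x) (z - x) + N (z - x)).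
  by apply/funext => z; rewrite -weak_sqnormD addrC subrK.
have zx : (fun z => z - x) @ x --> x - x.
  by apply: cvgB; [exact: cvg_id|exact: cvg_cst].
apply: cvgD.
  apply: cvgD; first exact: cvg_cst.
  apply: cvgM; first exact: cvg_cst.
  by apply: cvg_comp zx _; exact: continuous_innerr.
rewrite /= subrr inner0r.
rewrite subrr in zx.
apply: (squeeze_cvgr (f := fun=> 0) (h := fun z => M * `|z - x| ^+ 2)).
- near=> z; rewrite weak_sqnorm_ge0/= (le_trans (ler_norm _))//.
  rewrite (le_trans (cauchy_schwarz _ _))//.
  by rewrite expr2 mulrA ler_wpM2r.
- exact: cvg_cst.
- rewrite -(mulr0 M); apply: cvgM; first exact: cvg_cst.
  have -> : (0 : R) = `|0 : H| ^+ 2 by rewrite normr0 expr0n.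
  apply: (cvg_comp (fun z => `|z - x|) (fun u : R => u ^+ 2)).
    exact: cvg_norm zx.
  exact: exprn_continuous.
Unshelve. all: by end_near. Qed.

Lemma continuous_norm_m1 : continuous (norm_m1 B).
Proof.
move=> x; apply: (@continuous_comp _ _ _ (fun x => N x) Num.sqrt).
  exact: continuous_weak_sqnorm.
exact: sqrt_continuous.
Qed.

End weak_norm.

(** * Orthonormal bases and finite-rank operators *)

Section parseval.
Context {R : realType} {Xi : hilbertType R} (E : set Xi).
Hypothesis hE : orthonormal_basis E.
Implicit Types (F G : seq Xi) (d : Xi).

Definition fourier_sum F d : Xi := \sum_(e <- F) inner d e *: e.

Let sq F d : R := \sum_(e <- F) inner d e ^+ 2.

Lemma inner_fourier_sum F d e : uniq F -> {in F, forall f, E f} -> E e ->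
  inner (fourier_sum F d) e = if e \in F then inner d e else 0.
Proof.
case: hE => E1 E0 _ uF FE Ee; rewrite inner_suml.
case: ifPn => eF.
  rewrite (bigD1_seq e)//= innerZl inner_norm E1// expr1n mulr1.
  rewrite big_seq_cond big1 ?addr0// => f /andP[fF fe].
  by rewrite innerZl (E0 f e) ?mulr0//; [exact: FE|exact/eqP].
rewrite big_seq big1// => f fF; rewrite innerZl (E0 f e) ?mulr0//; first exact: FE.
by move=> fe; move: eF; rewrite -fe fF.
Qed.

Lemma inner_residual F d d' : uniq F -> {in F, forall f, E f} ->
  inner (d - fourier_sum F d) (d' - fourier_sum F d') =
  inner d d' - \sum_(e <- F) inner d e * inner d' e.
Proof.
move=> uF FE; rewrite innerBr [X in _ - X](_ : _ = 0) ?subr0; last first.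
  rewrite {2}/fourier_sum inner_sumr big_seq big1// => e eF.
  by rewrite innerZr innerBl inner_fourier_sum// ?eF ?subrr ?mulr0//; exact: FE.
rewrite innerBl inner_suml; congr (_ - _); apply: eq_bigr => e _.
by rewrite innerZl (innerC e).
Qed.

Lemma sqnorm_residual F d : uniq F -> {in F, forall f, E f} ->
  `|d - fourier_sum F d| ^+ 2 = `|d| ^+ 2 - sq F d.
Proof.
move=> uF FE; rewrite -inner_norm inner_residual// inner_norm.
by congr (_ - _); apply: eq_bigr => e _; rewrite expr2.
Qed.

Lemma le_residual F G d : uniq F -> uniq G -> {in G, forall f, E f} ->
  {subset F <= G} ->
  `|d - fourier_sum G d| ^+ 2 <= `|d - fourier_sum F d| ^+ 2.
Proof.
move=> uF uG GE FG; rewrite !sqnorm_residual//; last by move=> e /FG /GE.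
rewrite lerD2l lerN2 /sq [leRHS](bigID (mem F)) /= -[X in _ <= X + _]big_filter.
rewrite (_ : \sum_(i <- [seq i <- G | i \in F]) _ = sq F d); last first.
  apply: perm_big; apply: uniq_perm => //; first exact: filter_uniq.
  by move=> x; rewrite mem_filter; case: (boolP (x \in F)) => // /FG.
by rewrite lerDl sumr_ge0// => e _; exact: sqr_ge0.
Qed.

Lemma sqnorm_fourier_sumB F G d : uniq F -> uniq G -> {in G, forall f, E f} ->
  {subset F <= G} ->
  `|fourier_sum G d - fourier_sum F d| ^+ 2 = sq G d - sq F d.
Proof.
move=> uF uG GE FG; have FE : {in F, forall f, E f} by move=> e /FG /GE.
have -> : fourier_sum G d - fourier_sum F d =
    (d - fourier_sum F d) - (d - fourier_sum G d).
  by rewrite opprB [RHS]addrC addrA subrK.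
rewrite sqnormB !sqnorm_residual//.
have -> : inner (d - fourier_sum F d) (d - fourier_sum G d) =
    `|d| ^+ 2 - sq G d.
  rewrite -sqnorm_residual// -inner_norm.
  have -> : d - fourier_sum F d =
    (d - fourier_sum G d) + (fourier_sum G d - fourier_sum F d).
    by rewrite addrA subrK.
  rewrite innerDl -[RHS]addr0; congr (_ + _).
  have z e : e \in G -> inner e (d - fourier_sum G d) = 0.
    move=> eG; rewrite innerBr (innerC e (fourier_sum _ _)) inner_fourier_sum//; last exact: GE.
    by rewrite eG (innerC e) subrr.
  rewrite innerBl !inner_suml !big_seq !big1 ?subrr// => e eG; rewrite innerZl z ?mulr0//.
  exact: FG.
ring.
Qed.

(** A basis is defined as a maximal orthonormal set, so the expansion has to be produced. Finite
    families whose square sums approach their supremum give a Cauchy sequence of partial expansions;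
    its limit is [d], since the residual is orthogonal to all of [E]. *)
Lemma fourier_sum_approx d (eps : R) : 0 < eps ->
  exists F, [/\ uniq F, {in F, forall f, E f} & `|d - fourier_sum F d| <= eps].
Proof.
move=> eps0.
pose A : set R := [set sq F d | F in [set F | uniq F /\ {in F, forall f, E f}]].
have A0 : A !=set0 by exists (sq [::] d); exists [::].
have Aub : ubound A (`|d| ^+ 2).
  move=> _ [F [uF FE] <-].
  by rewrite -subr_ge0 -sqnorm_residual// sqr_ge0.
have supA : has_sup A by split => //; exists (`|d| ^+ 2).
pose s := sup A.
have sub F : uniq F -> {in F, forall f, E f} -> sq F d <= s.
  by move=> uF FE; apply: sup_upper_bound => //; exists F.
have /choice[F HF] : forall n : nat, exists F, [/\ uniq F, {in F, forall f, E f} &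
    s - n.+1%:R^-1 < sq F d].
  move=> n; have [|_ [F [uF FE] <-] lt] := sup_adherent (eps := n.+1%:R^-1) _ supA.
    by rewrite invr_gt0.
  by exists F.
pose p n := fourier_sum (F n) d.
have close G n : uniq G -> {in G, forall f, E f} -> {subset F n <= G} ->
    `|fourier_sum G d - p n| ^+ 2 <= n.+1%:R^-1.
  move=> uG GE FG; have [uF FE lt] := HF n.
  rewrite sqnorm_fourier_sumB// lerBlDl -lerBlDr.
  by rewrite (le_trans _ (ltW lt))// lerD2r sub.
have cauchyp : cauchy (p @ \oo).
  apply/cauchy_exP => e e0.
  have e2 : 0 < e / 4 by rewrite divr_gt0.
  have : n.+1%:R^-1 @[n --> \oo] --> (0 : R) by exact: cvg_harmonic.
  move=> /cvgrPdist_lt /(_ ((e / 4) ^+ 2)) /(_ (exprn_gt0 _ e2))[N _ HN].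
  exists (p N), N => // n /= Nn; rewrite -ball_normE /=.
  have sm k : (N <= k)%N -> k.+1%:R^-1 < (e / 4) ^+ 2.
    by move=> /HN /=; rewrite sub0r normrN ger0_norm.
  have [uN NE _] := HF N; have [un nE _] := HF n.
  (* Two nearly maximal families need not be nested; both are compared with their union, whose
     square sum is still at most [s]. *)
  pose G := undup (F N ++ F n).
  have uG : uniq G by exact: undup_uniq.
  have GE : {in G, forall f, E f}.
    by move=> f; rewrite mem_undup mem_cat => /orP[/NE|/nE].
  have cl k : (N <= k)%N -> {subset F k <= G} -> `|fourier_sum G d - p k| <= e / 4.
    move=> Nk FG; rewrite -ler_sqr ?nnegrE//; last exact: ltW.
    exact: le_trans (close _ _ uG GE FG) (ltW (sm _ Nk)).
  have -> : p N - p n = (fourier_sum G d - p n) - (fourier_sum G d - p N).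
    by rewrite opprB [RHS]addrC addrA subrK.
  rewrite (le_lt_trans (ler_normB _ _))// (@le_lt_trans _ _ (e / 4 + e / 4))//.
    by rewrite lerD// cl// => f fF; rewrite mem_undup mem_cat fF// orbT.
  lra.
have cp : cvg (p @ \oo) by apply/cauchy_cvgP.
have /eqP : d - lim (p @ \oo) = 0.
  have [_ _ E3] := hE; apply: E3 => e Ee.
  have c1 : inner (d - p n) e @[n --> \oo] --> inner (d - lim (p @ \oo)) e.
    apply: (cvg_comp (fun n => d - p n) (fun x => inner x e)); last exact: continuous_innerl.
    by apply: cvgB => //; exact: cvg_cst.
  apply: (cvg_unique _ c1) => //.
  have c2 : (Num.sqrt (n.+1%:R^-1 : R)) @[n --> \oo] --> (0 : R).
    rewrite -(sqrtr0 R); apply: (cvg_comp _ Num.sqrt); last exact: sqrt_continuous.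
    exact: cvg_harmonic.
  apply: norm_cvg0; apply: (squeeze_cvgr (f := fun=> 0) (h := fun n => Num.sqrt n.+1%:R^-1)) => //.
    near=> n; rewrite normr_ge0/=; have [un nE lt] := HF n.
    rewrite innerBl inner_fourier_sum//; case: ifPn => [_|eF].
      by rewrite subrr normr0 sqrtr_ge0.
    rewrite subr0 -sqrtr_sqr ler_wsqrtr//.
    (* Adding [e] cannot push the square sum beyond the supremum, so [inner d e ^+ 2] stays below
       the gap [1 / (n + 1)]. *)
    have : sq (e :: F n) d <= s.
      apply: sub; first by rewrite /= eF.
      by move=> f; rewrite inE => /orP[/eqP->|/nE].
    move: lt; rewrite /sq big_cons.
    by move: (\sum_(_ <- _) _) (n.+1%:R^-1) (s) => q r s' ? ?; lra.
  exact: cvg_cst.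
rewrite subr_eq0 => /eqP dE.
move: cp; rewrite -dE => /cvgrPdist_le /(_ _ eps0)[N _ /(_ N (leqnn _)) /= h].
by exists (F N); have [? ? _] := HF N.
Unshelve. all: by end_near. Qed.

(** Enlarging a family shrinks every residual, so the union of the families of all [d i] serves them
    simultaneously. *)
Lemma fourier_sum_approx_fin (I : finType) (d : I -> Xi) (eps : R) : 0 < eps ->
  exists F, [/\ uniq F, {in F, forall f, E f} &
    forall i, `|d i - fourier_sum F (d i)| <= eps].
Proof.
move=> e0; have /choice[F HF] := fun i => fourier_sum_approx (d i) e0.
exists (undup (flatten [seq F i | i <- enum I])).
have uF : uniq (undup (flatten [seq F i | i <- enum I])) by exact: undup_uniq.
have FE : {in undup (flatten [seq F i | i <- enum I]), forall f, E f}.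
  by move=> f; rewrite mem_undup => /flatten_mapP[i _]; have [_ + _] := HF i; exact.
split=> // i; have [ui iE] := HF i; apply: le_trans.
rewrite -ler_sqr ?nnegrE//; apply: le_residual => // f fF.
by rewrite mem_undup; apply/flatten_mapP; exists i => //; rewrite mem_enum.
Qed.

End parseval.

Section finite_rank.
Context {R : realType} {H Xi : hilbertType R} (E : set Xi).
Hypothesis hE : orthonormal_basis E.

(** The squared Hilbert-Schmidt norm of [xi |-> \sum_i inner (d i) xi *: w i], in a form that does
    not mention the basis. *)
Let gram (I : finType) (d : I -> Xi) (w : I -> H) : R :=
  \sum_i \sum_j inner (d i) (d j) * inner (w i) (w j).

(** By [inner_residual] the error of a partial Parseval sum for [inner (d i) (d j)] is an inner
    product of two residuals, hence quadratic in their size. *)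
Let gram_approx (I : finType) (d : I -> Xi) (w : I -> H) (e : R) : 0 < e ->
  exists F, [/\ uniq F, {in F, forall f, E f} &
    `|gram d w - \sum_(f <- F) `|\sum_i inner (d i) f *: w i| ^+ 2| <= e].
Proof.
move=> e0.
pose M : R := \sum_i \sum_j `|inner (w i) (w j)|.
have M0 : 0 <= M by apply: sumr_ge0 => i _; apply: sumr_ge0.
(* The total error is at most [dl ^+ 2 * M]; the [+ 1] keeps the denominator positive when
   [M = 0]. *)
pose dl := Num.sqrt (e / (M + 1)).
have M1 : 0 < M + 1 by rewrite ltr_pwDr.
have dl0 : 0 < dl by rewrite sqrtr_gt0 divr_gt0.
have [F [uF FE HF]] := fourier_sum_approx_fin hE d dl0.
exists F; split=> //.
pose Q xi := \sum_i inner (d i) xi *: w i.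
have QE xi : `|Q xi| ^+ 2 =
    \sum_i \sum_j inner (d i) xi * inner (d j) xi * inner (w i) (w j).
  rewrite -inner_norm inner_suml; apply: eq_bigr => i _.
  by rewrite inner_sumr; apply: eq_bigr => j _; rewrite innerZl innerZr mulrA.
have -> : \sum_(f <- F) `|Q f| ^+ 2 = \sum_i \sum_j
    (\sum_(f <- F) inner (d i) f * inner (d j) f) * inner (w i) (w j).
  under eq_bigr do rewrite QE.
  rewrite exchange_big; apply: eq_bigr => i _; rewrite exchange_big.
  by apply: eq_bigr => j _; rewrite mulr_suml.
rewrite /gram -sumrB.
apply: (@le_trans _ _ (dl ^+ 2 * M)); last first.
  rewrite /dl sqr_sqrtr ?divr_ge0 ?(ltW e0) ?(ltW M1)// mulrAC ler_pdivrMr// ler_pM2l//.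
  by rewrite lerDl.
rewrite mulr_sumr (le_trans (ler_norm_sum _ _ _))//; apply: ler_sum => i _.
rewrite -sumrB mulr_sumr (le_trans (ler_norm_sum _ _ _))//; apply: ler_sum => j _.
rewrite -mulrBl -(inner_residual hE)// normrM.
rewrite ler_wpM2r// (le_trans (cauchy_schwarz _ _))// expr2.
by rewrite ler_pM.
Qed.

(** Up to an arbitrarily small error the double sum is a sum of squares; this is an instance of the
    Schur product theorem for two Gram matrices. *)
Lemma gram_ge0 (I : finType) (d : I -> Xi) (w : I -> H) :
  0 <= \sum_i \sum_j inner (d i) (d j) * inner (w i) (w j).
Proof.
apply/ler_addgt0Pr => e e0; have [F [_ _]] := gram_approx d w e0.
rewrite ler_distl => /andP[+ _]; rewrite lerBlDr; apply: le_trans.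
by apply: sumr_ge0 => f _; exact: sqr_ge0.
Qed.

(** A finite partial sum over the basis already comes within [e] of the Gram sum. This later bounds
    the quadratic variation of an elementary integrand by its Hilbert-Schmidt energy. *)
Lemma finite_rank_hs_sqnorm_ge (I : finType) (d : I -> Xi) (w : I -> H) :
  ((\sum_i \sum_j inner (d i) (d j) * inner (w i) (w j))%R%:E <=
   hs_sqnorm E (fun xi => (\sum_i inner (d i) xi *: w i)%R))%E.
Proof.
apply/lee_addgt0Pr => e e0; have [F [uF FE]] := gram_approx d w e0.
rewrite ler_distl => /andP[_]; rewrite -lee_fin EFinD => /le_trans; apply.
rewrite leeD2r//; apply: esum_ge; exists [set` F].
  by split; [exact: finite_seq|move=> f /FE].
by rewrite -fsbig_seq// sumEFin.
Qed.

End finite_rank.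

Section semigroup.
Context {R : realType} {H : hilbertType R}.
Variables (D : set H) (A : H -> H) (S : R -> {linear H -> H}).
Hypothesis A_dense : dense D.
Hypothesis S_semigroup : contraction_semigroup S.
Hypothesis A_generates : is_generator D A S.
Variables (B K : {linear H -> H}) (c0 : R).
Hypothesis B_cont : continuous B.
Hypothesis B_sym : forall x y, inner (B x) y = inner x (B y).
Hypothesis B_gt0 : forall x, x != 0 -> 0 < inner (B x) x.
Hypothesis K_adj : forall z, adjoint_graph D A (B z) (K z).
Hypothesis c0_ge0 : 0 <= c0.
Hypothesis K_le : forall x, 0 <= inner (- K x + c0 *: B x) x.

Local Notation N x := (inner (B x) x).

Lemma continuous_contraction s : 0 <= s -> continuous (S s).
Proof.
case: S_semigroup => _ _ Sc _ s0 x; apply/cvgrPdist_le => e e0.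
have := nbhsx_ballx x e e0; apply: filterS => z; rewrite -ball_normE /= => xz.
by rewrite -linearB (le_trans (Sc _ _ s0))// ltW.
Qed.

Lemma generator_semigroup s x : 0 <= s -> D x ->
  D (S s x) /\ A (S s x) = S s (A x).
Proof.
case: S_semigroup => _ Sa _ _ s0 Dx; apply/A_generates.
have /A_generates Ax : D x /\ A x = A x by [].
apply: (cvg_trans (near_eq_cvg (f := fun h => S s (h^-1 *: (S h x - x))) _)).
  near=> h; have h0 : 0 <= h by near: h; exact: nbhs_right_ge.
  by rewrite linearZ linearB /= -(Sa h s)// -(Sa s h)// (addrC h).
by apply: cvg_comp Ax _; exact: continuous_contraction.
Unshelve. all: by end_near. Qed.

(* One explicit Euler step: in [N (u + h *: (A u + rho))] the first-order term
   is [2 h <A u, B u> <= 2 c0 h N u]. *)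
Let weak_sqnorm_step (M h u0 a0 delta : R) (u rho : H) :
  (forall x, `|B x| <= M * `|x|) -> 0 <= M -> 0 <= h -> D u ->
  `|u| <= u0 -> `|A u| <= a0 -> `|rho| <= delta ->
  N (u + h *: (A u + rho)) <=
    (1 + 2 * c0 * h) * N u +
    h * (2 * (M * u0) * delta + h * (M * (a0 + delta) ^+ 2)).
Proof.
move=> BM M0 h0 Du uu0 ua0 rd.
have Mu0 : 0 <= M * u0 by rewrite mulr_ge0// (le_trans _ uu0).
have h1 : inner (B u) (A u) <= c0 * N u.
  rewrite innerC (K_adj u Du) innerC -subr_ge0.
  by have := K_le u; rewrite innerDl innerNl innerZl addrC.
have h2 : inner (B u) rho <= M * u0 * delta.
  rewrite (le_trans (ler_norm _))// (le_trans (cauchy_schwarz _ _))//.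
  by rewrite ler_pM// (le_trans (BM _))// ler_wpM2l.
have h3 : N (A u + rho) <= M * (a0 + delta) ^+ 2.
  rewrite (le_trans (ler_norm _))// (le_trans (cauchy_schwarz _ _))//.
  have : `|A u + rho| <= a0 + delta by rewrite (le_trans (ler_normD _ _))// lerD.
  move=> h4; rewrite (@le_trans _ _ (M * `|A u + rho| * `|A u + rho|))//.
    by rewrite ler_wpM2r.
  rewrite -mulrA ler_wpM2l// -expr2 lerXn2r// nnegrE//.
  exact: le_trans h4.
rewrite (weak_sqnormD B_sym) innerZr linearZ /= innerZl innerZr innerDr.
have := ler_wpM2l h0 h1; have := ler_wpM2l h0 h2.
have := ler_wpM2l (mulr_ge0 h0 h0) h3.
rewrite mulrA; move: (N u) (inner (B u) (A u)) (inner _ rho) (N (A u + rho)).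
rewrite -(mulrA 2 (M * u0)).
move: (M * u0 * delta) (M * (a0 + delta) ^+ 2) => p q n i j k.
by lra.
Qed.

(** Each Euler step is exact: [rho] is the error of the difference quotient at [x], and at time
    [j h] it becomes [S (j h) rho], still below [eps] by contraction. The errors of the [n] steps
    therefore add up to a multiple of [s * eps]. *)
Lemma weak_sqnorm_semigroup_domain s x : 0 <= s -> D x ->
  N (S s x) <= expR (2 * c0 * s) * N x.
Proof.
move=> s0 Dx; have [S0 Sa Sc _] := S_semigroup.
have [->|sn0] := eqVneq s 0; first by rewrite S0 mulr0 expR0 mul1r.
have {sn0}s0' : 0 < s by rewrite lt_neqAle eq_sym sn0.
have [M M0 BM] := continuous_linear_bounded B_cont.
(* [Q * eps] dominates the bracket in [weak_sqnorm_step] as soon as [h <= eps <= 1]. *)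
pose Q := 2 * (M * `|x|) + M * (`|A x| + 1) ^+ 2.
have Q0 : 0 <= Q.
  by rewrite addr_ge0// !mulr_ge0// ?ltW// sqr_ge0.
have E0 : 0 < expR (2 * c0 * s) by exact: expR_gt0.
suff main eps : 0 < eps -> eps <= 1 ->
    N (S s x) <= expR (2 * c0 * s) * (N x + s * (Q * eps)).
  apply/ler_addgt0Pr => e e0.
  pose d := expR (2 * c0 * s) * (s * Q) + 1.
  have sQ : 0 <= expR (2 * c0 * s) * (s * Q) by rewrite !mulr_ge0// ltW.
  have d0 : 0 < d by rewrite /d; lra.
  have := main (Num.min 1 (e / d)).
  rewrite lt_min ltr01 divr_gt0// ge_min lexx => /(_ isT isT) /le_trans; apply.
  rewrite mulrDr lerD2l mulrA mulrA.
  apply: (@le_trans _ _ (d * (e / d))); last by rewrite mulrC divfK// gt_eqF.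
  rewrite ler_pM//; last by rewrite ge_min lexx orbT.
  - by rewrite !mulr_ge0// ltW.
  - by rewrite le_min ler01/= divr_ge0// ltW.
  - by rewrite /d -mulrA lerDl.
move=> eps0 eps1.
have /A_generates/cvgrPdist_le/(_ _ eps0) : D x /\ A x = A x by [].
move=> [h0 /= h0p Hh0].
pose h1 := Num.min h0 eps.
have h1p : 0 < h1 by rewrite lt_min h0p eps0.
(* Enough steps that [h = s / n] lies below both [eps] and the radius [h0] within which the
   difference quotient is [eps]-close to [A x]. *)
pose n := (Num.truncn (s / h1)).+1.
pose h := s / n%:R.
have hp : 0 < h by rewrite divr_gt0.
have hh1 : h < h1.
  rewrite /h ltr_pdivrMr// mulrC -ltr_pdivrMr//.
  exact: truncnS_gt.
have hh0 : h < h0 by rewrite (lt_le_trans hh1)// ge_min lexx.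
have heps : h <= eps by rewrite (le_trans (ltW hh1))// ge_min lexx orbT.
pose rho := h^-1 *: (S h x - x) - A x.
have rhoe : `|rho| <= eps.
  rewrite distrC; apply: Hh0 => //=.
  by rewrite sub0r normrN gtr0_norm.
have Shx : S h x = x + h *: (A x + rho).
  by rewrite /rho (addrC (A x)) subrK scalerA divff ?gt_eqF// scale1r addrC subrK.
have key j : N (S (j%:R * h) x) <=
    expR (2 * c0 * (j%:R * h)) * (N x + j%:R * h * (Q * eps)).
  elim: j => [|j IH]; first by rewrite !mul0r S0 mulr0 expR0 mul1r addr0.
  have jh0 : 0 <= j%:R * h by rewrite mulr_ge0// ltW.
  have [Du Au] := generator_semigroup jh0 Dx.
  have -> : S (j.+1%:R * h) x =
      S (j%:R * h) x + h *: (A (S (j%:R * h) x) + S (j%:R * h) rho).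
    rewrite -addn1 natrD mulrDl mul1r Sa// ?ltW// Shx.
    by rewrite linearD linearZ linearD /= Au.
  have := @weak_sqnorm_step M h `|x| `|A x| eps _ (S (j%:R * h) rho) BM
    (ltW M0) (ltW hp) Du (Sc _ _ jh0).
  rewrite Au => /(_ (Sc _ _ jh0) (le_trans (Sc _ _ jh0) rhoe)) /le_trans; apply.
  have Qe : 2 * (M * `|x|) * eps + h * (M * (`|A x| + eps) ^+ 2) <= Q * eps.
    have -> : Q * eps = 2 * (M * `|x|) * eps + eps * (M * (`|A x| + 1) ^+ 2).
      by rewrite /Q; ring.
    rewrite lerD2l; apply: ler_pM => //; [exact: ltW|by rewrite mulr_ge0 ?sqr_ge0// ltW|].
    rewrite ler_pM2l// lerXn2r ?nnegrE ?addr_ge0 ?(ltW eps0)//.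
    by rewrite lerD2l.
  have e1 : 1 + 2 * c0 * h <= expR (2 * c0 * h) by exact: expR_ge1Dx.
  have c0h : 0 <= 2 * c0 * h by rewrite !mulr_ge0// ltW.
  have -> : j.+1%:R * h = j%:R * h + h by rewrite -addn1 natrD mulrDl mul1r.
  rewrite (mulrDr (2 * c0)) expRD.
  set f := expR (2 * c0 * (j%:R * h)) in IH *.
  have f1 : 1 <= f by rewrite -expR0 ler_expR !mulr_ge0// ltW.
  set u := inner _ _ in IH *; set g := expR (2 * c0 * h) in e1 *.
  have u0 : 0 <= u by exact: weak_sqnorm_ge0.
  apply: (@le_trans _ _ (g * (f * (N x + j%:R * h * (Q * eps))) + h * (Q * eps))).
    apply: lerD; last by rewrite ler_wpM2l// ltW.
    by apply: ler_pM => //; exact: addr_ge0.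
  rewrite -subr_ge0 (_ : _ - _ = (f * g - 1) * (h * (Q * eps))); last by ring.
  apply: mulr_ge0; last by rewrite !mulr_ge0// ltW.
  by rewrite subr_ge0 mulr_ege1// (le_trans _ e1)// lerDl.
have := key n.
by have -> : n%:R * h = s by rewrite /h mulrC divfK// gt_eqF.
Qed.

(** A violation is an open condition, so it would also occur at a point of the dense domain. *)
Lemma weak_sqnorm_semigroup s x : 0 <= s ->
  N (S s x) <= expR (2 * c0 * s) * N x.
Proof.
move=> s0; rewrite -subr_ge0 leNgt; apply/negP => fx.
pose f z := expR (2 * c0 * s) * N z - N (S s z).
have fc : continuous f.
  move=> z; apply: cvgB.
    by apply: cvgM; [exact: cvg_cst|exact: continuous_weak_sqnorm].
  apply: (cvg_comp (S s) (fun z => N z)); first exact: continuous_contraction.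
  exact: continuous_weak_sqnorm.
have [z [/= fz Dz]] : f @^-1` [set r | r < 0] `&` D !=set0.
  apply: A_dense; first by exists x.
  by apply: open_comp => [? _|]; [exact: fc|exact: open_lt].
have := weak_sqnorm_semigroup_domain s0 Dz.
by rewrite -subr_ge0 leNgt fz.
Qed.

End semigroup.

(** * Measurability and Gaussian increments *)

Section separable_measurability.
Context {R : realType}.

Lemma separable_dense_seq (V : pseudoMetricNormedZmodType R) :
  separable_space V ->
  exists v : nat -> V, forall x (e : R), 0 < e -> exists n, ball (v n) e x.
Proof.
move=> [D cD dD].
have D0 : D !=set0.
  by have [z [_ Dz]] := dD setT (ex_intro _ (0 : V) I) openT; exists z.
have [v Hv] : exists v : nat -> V, D `<=` range v.
  have /countable_injP[f finj] := cD.
  exists (fun n => xget 0 [set x | D x /\ f x = n]) => x Dx; exists (f x) => //.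
  case: xgetP => [y _ [Dy fyx]|/(_ x)]; last by case.
  by apply: finj; rewrite ?inE.
exists v => x e e0.
have [z [xz Dz]] := dD (ball x e) (ex_intro _ x (ballxx x e0)) (ball_open x e).
have [n _ nz] := Hv _ Dz; exists n; rewrite nz.
exact: ball_sym.
Qed.

(** Only [f] and [g] separately are known to be measurable. By separability [{F > c}] is a countable
    union of preimages of products of balls, with dense centres and radii [1 / (n + 1)]: those on
    which [F > c] wherever the second coordinate lies in [L]. *)
Lemma measurable_fun_pair_within d (T : measurableType d)
    (V1 V2 : pseudoMetricNormedZmodType R) (L : set V2) (D : set T)
    (f : T -> V1) (g : T -> V2) (F : V1 * V2 -> R) :
  separable_space V1 -> separable_space V2 ->
  (forall U, open U -> measurable (D `&` f @^-1` U)) ->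
  (forall U, open U -> measurable (D `&` g @^-1` U)) ->
  (forall z, D z -> L (g z)) ->
  {within [set: V1] `*` L, continuous F} ->
  measurable_fun D (fun z => F (f z, g z)).
Proof.
move=> /separable_dense_seq[v1 Hv1] /separable_dense_seq[v2 Hv2] mf mg gL.
move=> /subspace_continuousP Fc.
apply: (measurability _ (RGenOInfty.measurableE R)).
move=> _ [_ [c ->] <-].
pose good (k : nat * nat * nat) := forall x y,
  ball (v1 k.1.1) k.2.+1%:R^-1 x -> ball (v2 k.1.2) k.2.+1%:R^-1 y -> L y ->
  c < F (x, y).
have -> : D `&` (fun z => F (f z, g z)) @^-1` `]c, +oo[%classic =
    \bigcup_k (if `[< good k >] then
      (D `&` f @^-1` ball (v1 k.1.1) k.2.+1%:R^-1) `&`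
      (D `&` g @^-1` ball (v2 k.1.2) k.2.+1%:R^-1) else set0).
  apply/seteqP; split => [z [Dz /=]|z [k _]]; last first.
    case: ifPn => // /asboolP gk [[Dz fz] [_ gz]]; split => //=.
    by rewrite in_itv/= andbT; apply: gk => //; exact: gL.
  rewrite in_itv/= andbT => cF.
  have /Fc /(_ _ (open_nbhs_nbhs (conj (@open_gt _ c) cF))) :
    ([set: V1] `*` L) (f z, g z) by split => //; exact: gL.
  move=> [[A1 A2] /= [/nbhs_ballP[e1 /= e10 HA1] /nbhs_ballP[e2 /= e20 HA2]] HA].
  pose e := Num.min e1 e2 / 2.
  have e0 : 0 < e by rewrite divr_gt0// lt_min e10.
  pose n := Num.truncn e^-1.
  have n0 : 0 < n.+1%:R^-1 :> R by rewrite invr_gt0.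
  have ne : n.+1%:R^-1 < e.
    by rewrite -[ltRHS]invrK ltf_pV2 ?posrE ?invr_gt0// truncnS_gt.
  have [n1 b1] := Hv1 (f z) _ n0; have [n2 b2] := Hv2 (g z) _ n0.
  exists (n1, n2, n) => //=; rewrite ifT//=.
  apply/asboolP => x y /= bx bY Ly.
  have := HA (x, y); apply => //=; split.
  - apply: HA1; apply: (@le_ball _ _ _ (n.+1%:R^-1 + n.+1%:R^-1)).
      have : e + e = Num.min e1 e2 by rewrite /e -splitr.
      have : Num.min e1 e2 <= e1 by rewrite ge_min lexx.
      by move: ne; move: (n.+1%:R^-1) => ? ? ? ?; lra.
    by apply: ball_triangle bx; exact: ball_sym.
  - apply: HA2; apply: (@le_ball _ _ _ (n.+1%:R^-1 + n.+1%:R^-1)).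
      have : e + e = Num.min e1 e2 by rewrite /e -splitr.
      have : Num.min e1 e2 <= e2 by rewrite ge_min lexx orbT.
      by move: ne; move: (n.+1%:R^-1) => ? ? ? ?; lra.
    by apply: ball_triangle bY; exact: ball_sym.
apply: countable_bigcupT_measurable => // k.
case: ifPn => // _; apply: measurableI.
  by apply: mf; exact: ball_open.
by apply: mg; exact: ball_open.
Qed.

Lemma measurable_fun_comp_continuous d (T : measurableType d)
    (V : topologicalType) (D : set T) (f : T -> V) (F : V -> R) :
  (forall U, open U -> measurable (D `&` f @^-1` U)) -> continuous F ->
  measurable_fun D (F \o f).
Proof.
move=> mf Fc; apply: (measurability _ (RGenOInfty.measurableE R)).
move=> _ [_ [c ->] <-]; rewrite comp_preimage; apply: mf.
apply: open_comp => [? _|]; first exact: Fc.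
exact: interval_open.
Qed.

End separable_measurability.

Section normal_second_moment.
Context {R : realType}.

(** On the shell [k <= |x| < k + 1] the integrand is at most a constant, so only the mass of the
    shell matters. The polynomial factor is then absorbed by passing to the normal density of
    standard deviation 2, whose total mass is 1. *)
Lemma normal_second_moment :
  (\int[normal_prob (0 : R) 1]_x (x ^+ 2)%:E < +oo)%E.
Proof.
pose A (k : nat) : set R := [set x | k%:R <= `|x| < k.+1%:R].
have mA k : measurable (A k).
  rewrite (_ : A k = setT `&` (fun x : R => `|x|) @^-1` `[k%:R, k.+1%:R[%classic).
    exact: normr_measurable.
  by apply/seteqP; split => x /=; rewrite in_itv//= => -[].
have UA : \bigcup_k A k = setT.
  apply/seteqP; split => // x _; exists (Num.truncn `|x|) => //=.
  exact: truncn_itv.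
have tA : trivIset setT A.
  apply/trivIsetP => i j _ _ ij; apply/seteqP; split=> // x /= [].
  by move=> xi xj; move: ij; rewrite -(truncn_def xi) -(truncn_def xj) eqxx.
(* On the shell, [(k + 1)^2 <= 2 x^2 + 2 <= 6 (1 + 3 x^2 / 8) <= 6 expR (3 x^2 / 8)], and the last
   exponential is the ratio of the two Gaussian factors. *)
pose M : R := 6 * (normal_peak 1 / normal_peak 2).
have M0 : 0 <= M by rewrite mulr_ge0// divr_ge0// normal_peak_ge0.
have key (k : nat) x : A k x ->
    k.+1%:R ^+ 2 * normal_pdf 0 1 x <= M * normal_pdf 0 2 x.
  move=> /andP[kx _]; rewrite !normal_pdfE//.
  have p2 : 0 < normal_peak 2 :> R by exact: normal_peak_gt0.
  rewrite /M mulrCA.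
  have -> : 6 * (normal_peak 1 / normal_peak 2) * (normal_peak 2 * normal_fun 0 2 x)
     = normal_peak 1 * (6 * normal_fun 0 2 x).
    by field; rewrite gt_eqF.
  rewrite ler_wpM2l ?normal_peak_ge0// /normal_fun subr0.
  have -> : - x ^+ 2 / (1 ^+ 2 *+ 2) = 3 * x ^+ 2 / 8 * (-1) + - x ^+ 2 / (2 ^+ 2 *+ 2).
    by field.
  rewrite expRD mulrA ler_wpM2r ?expR_ge0// mulrN1 expRN ler_pdivrMr ?expR_gt0//.
  have h1 := expR_ge1Dx (3 * x ^+ 2 / 8).
  have h2 : k.+1%:R ^+ 2 <= 2 * x ^+ 2 + 2 :> R.
    have : (k.+1%:R : R) ^+ 2 <= (`|x| + 1) ^+ 2.
      by rewrite ler_sqr ?nnegrE// -natr1 lerD2r.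
    have := sqr_ge0 (`|x| - 1); have := real_normK (num_real x).
    by move: (k.+1%:R ^+ 2) (`|x|) (x ^+ 2) => a b c; nra.
  move: h1 h2; have := sqr_ge0 x.
  by move: (expR (3 * x ^+ 2 / 8)) (k.+1%:R ^+ 2) (x ^+ 2) => e a b; lra.
have mpdf s k : measurable_fun (A k) (fun x => (normal_pdf 0 s x)%:E).
  apply/measurable_EFinP; apply: (@measurable_funS _ _ _ _ setT) => //.
  exact: measurable_normal_pdf.
rewrite -UA ge0_integral_bigcup//; last 2 first.
  rewrite UA; apply/measurable_EFinP; exact: measurable_funX.
  by move=> x _; rewrite lee_fin sqr_ge0.
apply: (@le_lt_trans _ _ (M%:E * \sum_(k <oo) \int[lebesgue_measure]_(x in A k) (normal_pdf 0 2 x)%:E)%E).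
  rewrite -nneseriesZl; last first.
    by move=> k _; apply: integral_ge0 => x _; rewrite lee_fin normal_pdf_ge0.
  apply: lee_nneseries => [k _ _|k _].
    by apply: integral_ge0 => x _; rewrite lee_fin sqr_ge0.
  apply: (@le_trans _ _ (\int[normal_prob 0 1]_(x in A k) (cst (k.+1%:R ^+ 2)%:E) x)%E).
    apply: ge0_le_integral; [exact: mA|..|].
    - by move=> x _; rewrite lee_fin sqr_ge0.
    - by apply/measurable_EFinP; apply: measurable_funX.
    - exact: measurable_cst.
    - move=> x /andP[_ /ltW xk]; rewrite lee_fin -(real_normK (num_real x)).
      by rewrite ler_sqr ?nnegrE.
  have Zl (c s : R) : 0 <= c -> (c%:E * \int[lebesgue_measure]_(x in A k) (normal_pdf 0 s x)%:E =
      \int[lebesgue_measure]_(x in A k) (c%:E * (normal_pdf 0 s x)%:E))%E.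
    move=> c0; rewrite ge0_integralZl//; [exact: mA|exact: mpdf|].
    by move=> x _; rewrite lee_fin normal_pdf_ge0.
  have e1 := Zl _ 2 M0; have e2 := Zl _ 1 (sqr_ge0 k.+1%:R).
  apply: (@le_trans _ _ ((k.+1%:R ^+ 2)%:E * \int[lebesgue_measure]_(x in A k) (normal_pdf 0 1 x)%:E)%E).
    by rewrite integral_cst//; exact: mA.
  apply: (@le_trans _ _ (\int[lebesgue_measure]_(x in A k) (M%:E * (normal_pdf 0 2 x)%:E))%E); last by rewrite -e1.
  rewrite e2.
  apply: ge0_le_integral; [exact: mA|..|].
  - by move=> x _; rewrite mule_ge0// lee_fin ?sqr_ge0// normal_pdf_ge0.
  - by apply: measurable_funeM; exact: mpdf.
  - by apply: measurable_funeM; exact: mpdf.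
  - by move=> x xA; rewrite -!EFinM lee_fin key.
rewrite -ge0_integral_bigcup//; last 2 first.
  rewrite UA; apply/measurable_EFinP; exact: measurable_normal_pdf.
  by move=> x _; rewrite lee_fin normal_pdf_ge0.
by rewrite UA integral_normal_pdf mule1 ltry.
Qed.

End normal_second_moment.

Section independence.
Context {R : realType} d (Omega : measurableType d) (P : probability Omega R).
Local Open Scope ereal_scope.

(** Agreement on rectangles identifies the law of the pair with the product law; Fubini then factors
    the integral. *)
Lemma integralM_indep (X Y : Omega -> R) :
  measurable_fun setT X -> measurable_fun setT Y ->
  (forall U V, measurable U -> measurable V ->
    P (X @^-1` U `&` Y @^-1` V) = P (X @^-1` U) * P (Y @^-1` V)) ->
  P.-integrable setT (EFin \o X) -> P.-integrable setT (EFin \o Y) ->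
  P.-integrable setT (fun w => (X w * Y w)%:E) /\
  \int[P]_w (X w * Y w)%:E = \int[P]_w (X w)%:E * \int[P]_w (Y w)%:E.
Proof.
move=> mX mY ind iX iY.
have mZ : measurable_fun setT (fun w => (X w, Y w)) by exact: measurable_fun_pair.
pose X' : {RV P >-> R} := mfun_Sub (mem_set mX).
pose Y' : {RV P >-> R} := mfun_Sub (mem_set mY).
pose Z' : {RV P >-> (R * R)%type} := mfun_Sub (mem_set mZ).
have EZ U : measurable U -> (distribution P X' \x distribution P Y') U =
    distribution P Z' U.
  apply: product_measure_unique => A B mA mB.
  exact: ind.
pose f (z : R * R) := (z.1 * z.2)%:E.
have mf : measurable_fun setT f.
  by apply/measurable_EFinP; apply: measurable_funM.
have mid : measurable_fun setT (EFin : R -> \bar R) by exact/measurable_EFinP.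
have iXd : (distribution P X').-integrable setT EFin.
  exact: integrable_pushforward.
have iYd : (distribution P Y').-integrable setT EFin.
  exact: integrable_pushforward.
have if_ : (distribution P X' \x distribution P Y').-integrable setT f.
  apply/integrable12ltyP => //.
  have /integrableP[_ hY] := iYd; have /integrableP[_ hX] := iXd.
  have mabs : measurable_fun setT (fun x : R => `|x|%:E) by exact/measurable_EFinP.
  rewrite (eq_integral (fun x : R => `|x|%:E * \int[distribution P Y']_y `|y|%:E)).
    rewrite ge0_integralZr//; last exact: integral_ge0.
    by rewrite lte_mul_pinfty// ?ge0_fin_numE// integral_ge0.
  move=> x _; rewrite -ge0_integralZl ?lee_fin//.
  by apply: eq_integral => y _; rewrite /f /= normrM EFinM.
have iZ : P.-integrable setT (f \o Z').
  apply/integrableP; split; first exact: measurableT_comp.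
  have /integrableP[_] := if_; rewrite (eq_measure_integral (distribution P Z')).
    by rewrite ge0_integral_distribution//; exact: measurableT_comp.
  by move=> A mA _; exact: EZ.
split; first exact: iZ.
rewrite -[LHS](integral_distribution (X := Z') mf iZ).
rewrite (eq_measure_integral (distribution P X' \x distribution P Y')); last first.
  by move=> A mA _; exact/esym/EZ.
rewrite -integral12_prod_meas1// /fubini_F.
have cYf : \int[distribution P Y']_y y%:E \is a fin_num.
  exact: integrable_fin_num iYd.
rewrite (eq_integral (fun x : R => x%:E * (fine (\int[distribution P Y']_y y%:E))%:E)).
  rewrite integralZr// fineK// (integral_distribution (X := X'))//.
  by rewrite (integral_distribution (X := Y')).
move=> x _; rewrite fineK// -integralZl//.
Qed.

End independence.

Section square_integrable.
Context {R : realType} d (Omega : measurableType d) (P : probability Omega R).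
Local Notation Int f := (P.-integrable setT (EFin \o f)).
Local Notation Ex f := (Rintegral P setT f).

Lemma ae_eq_Rintegral (f g : Omega -> R) :
  measurable_fun setT f -> measurable_fun setT g ->
  {ae P, forall w, f w = g w} -> Ex f = Ex g.
Proof.
move=> mf mg fg; congr fine; apply: ae_eq_integral => //; try exact/measurable_EFinP.
by move: fg; apply: filterS => w /= ->.
Qed.

Lemma ge0_integral_law d' (Y : measurableType d') (X : Omega -> Y)
    (m : {measure set Y -> \bar R}) (f : Y -> \bar R) :
  measurable_fun setT X -> (forall U, measurable U -> P (X @^-1` U) = m U) ->
  measurable_fun setT f -> (forall y, 0 <= f y)%E ->
  (\int[P]_w f (X w) = \int[m]_y f y)%E.
Proof.
move=> mX XE mf f0; pose X' : {RV P >-> Y} := mfun_Sub (mem_set mX).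
rewrite -[LHS](ge0_integral_distribution X' mf f0).
by apply: eq_measure_integral => U mU _; exact: XE.
Qed.

Lemma integral_law d' (Y : measurableType d') (X : Omega -> Y)
    (m : {measure set Y -> \bar R}) (f : Y -> \bar R) :
  measurable_fun setT X -> (forall U, measurable U -> P (X @^-1` U) = m U) ->
  measurable_fun setT f -> P.-integrable setT (f \o X) ->
  (\int[P]_w f (X w) = \int[m]_y f y)%E.
Proof.
move=> mX XE mf fX; pose X' : {RV P >-> Y} := mfun_Sub (mem_set mX).
rewrite -[LHS](integral_distribution (X := X') mf fX).
by apply: eq_measure_integral => U mU _; exact: XE.
Qed.

Lemma RintegralM_indep (X Y : Omega -> R) :
  measurable_fun setT X -> measurable_fun setT Y ->
  (forall U V, measurable U -> measurable V ->
    (P (X @^-1` U `&` Y @^-1` V) = P (X @^-1` U) * P (Y @^-1` V))%E) ->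
  Int X -> Int Y ->
  Int (fun w => X w * Y w) /\ Ex (fun w => X w * Y w) = Ex X * Ex Y.
Proof.
move=> mX mY ind iX iY; have [iXY E] := integralM_indep mX mY ind iX iY.
split; first exact: iXY.
by rewrite /Rintegral E fineM//; exact: integrable_fin_num.
Qed.

Lemma normrM_le_sqr (a b : R) : `|a * b| <= a ^+ 2 + b ^+ 2.
Proof.
have := sqr_ge0 (`|a| - `|b|); rewrite normrM.
rewrite -(real_normK (num_real a)) -(real_normK (num_real b)).
by have := normr_ge0 a; have := normr_ge0 b; move: (`|a|) (`|b|) => x y; nra.
Qed.

Lemma integrableM_sq (f g : Omega -> R) :
  measurable_fun setT f -> measurable_fun setT g ->
  Int (fun w => f w ^+ 2) -> Int (fun w => g w ^+ 2) -> Int (fun w => f w * g w).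
Proof.
move=> mf mg i1 i2; apply: (le_integrable _ _ _ (integrableD _ i1 i2)) => //.
  by apply/measurable_EFinP; exact: measurable_funM.
move=> w _; rewrite /= lee_fin (le_trans (normrM_le_sqr _ _))//.
exact: ler_norm.
Qed.

Lemma integrable_cst_prob (c : R) : Int (fun=> c).
Proof.
exact: finite_measure_integrable_cst.
Qed.

Lemma integrable_of_sq (f : Omega -> R) :
  measurable_fun setT f -> Int (fun w => f w ^+ 2) -> Int f.
Proof.
move=> mf i2; apply: (eq_integrable _ (EFin \o (fun w => f w * cst 1 w))) => //.
  by move=> w _; rewrite /= mulr1.
apply: integrableM_sq => //.
by under eq_fun do rewrite /= expr1n; exact: integrable_cst_prob.
Qed.

End square_integrable.

(** * Increments of the cylindrical Wiener process *)

Section wiener.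
Context {R : realType} {Xi : hilbertType R}.
Context {d : measure_display} {Omega : measurableType d}.
Variables (P : probability Omega R) (W : R -> Xi -> Omega -> R) (t T : R).
Hypothesis P_complete : measure_is_complete P.
Hypothesis hW : cylindrical_wiener P W t T.

Local Notation F := (wiener_filtration P W t).
Local Notation Int f := (P.-integrable setT (EFin \o f)).
Local Notation Ex f := (Rintegral P setT f).

Lemma measurable_wiener_filtration s : s <= T -> F s `<=` measurable.
Proof.
move=> sT; apply: smallest_sub; first exact: sigma_algebra_measurable.
move=> G [|[tau [xi [U [/andP[t1 t2] mU ->]]]]]; first exact: P_complete.
rewrite -[X in measurable X]setTI; apply: (wiener_meas hW) => //.
by rewrite t1 (le_trans t2).
Qed.

Lemma wiener_filtration_le s r : s <= r -> F s `<=` F r.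
Proof.
move=> sr; apply: sub_sigma_algebra2 => G [|[tau [xi [U [/andP[t1 t2] mU ->]]]]].
  by left.
by right; exists tau, xi, U; rewrite t1 (le_trans t2).
Qed.

Lemma wiener_filtration_set0 s : F s set0.
Proof. exact: (@measurable0 _ (g_sigma_algebraType _)). Qed.

(** The sigma-algebra of time [s] as a measurable type, so that the closure properties of measurable
    functions apply to adapted random variables. *)
Let space s := g_sigma_algebraType [set G | P.-negligible G \/
  exists tau xi U, [/\ t <= tau <= s, measurable U & G = W tau xi @^-1` U]].

Let adapted s (X : Omega -> R) := measurable_fun setT (X : space s -> R).

Let adapted_preimage s X U : adapted s X -> measurable U -> F s (X @^-1` U).
Proof. by move=> aX mU; have := aX measurableT U mU; rewrite setTI. Qed.

Let adapted_measurable s X : s <= T -> adapted s X -> measurable_fun setT X.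
Proof.
move=> sT aX _ U mU; rewrite setTI; apply: (measurable_wiener_filtration sT).
exact: adapted_preimage.
Qed.

Let adapted_wiener s r xi : t <= r <= s -> adapted s (W r xi).
Proof.
move=> tr _ U mU; rewrite setTI; apply: sub_sigma_algebra.
by right; exists r, xi, U.
Qed.

Let adapted_indic s G : F s G -> adapted s (\1_G : Omega -> R).
Proof. by move=> FG; exact: (@measurable_indic _ (space s) R setT G). Qed.

Definition increment (s r : R) (xi : Xi) (w : Omega) : R := W r xi w - W s xi w.
Local Notation dW := increment.

Lemma measurable_increment s r xi : t <= s <= T -> t <= r <= T ->
  measurable_fun setT (dW s r xi).
Proof. by move=> hs hr; apply: measurable_funB; exact: (wiener_meas hW). Qed.

Lemma increment_linear s r (k : R) xi eta : t <= s <= T -> t <= r <= T ->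
  {ae P, forall w, dW s r (k *: xi + eta) w = k * dW s r xi w + dW s r eta w}.
Proof.
move=> hs hr; have := wiener_linear hW k xi eta hs.
have := wiener_linear hW k xi eta hr; apply: filterS2 => w h1 h2.
by rewrite /increment h1 h2; ring.
Qed.

Lemma increment0 s r : t <= s <= T -> t <= r <= T ->
  {ae P, forall w, dW s r 0 w = 0}.
Proof.
move=> hs hr; have := increment_linear 1 0 0 hs hr.
by apply: filterS => w; rewrite scaler0 addr0 mul1r; lra.
Qed.

Lemma incrementZ s r (k : R) xi : t <= s <= T -> t <= r <= T ->
  {ae P, forall w, dW s r (k *: xi) w = k * dW s r xi w}.
Proof.
move=> hs hr; have := increment_linear k xi 0 hs hr.
have := increment0 hs hr; apply: filterS2 => w h1.
by rewrite addr0 h1 addr0.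
Qed.

Lemma incrementD s r xi eta : t <= s <= T -> t <= r <= T ->
  {ae P, forall w, dW s r (xi + eta) w = dW s r xi w + dW s r eta w}.
Proof.
move=> hs hr; have := increment_linear 1 xi eta hs hr.
by apply: filterS => w; rewrite scale1r mul1r.
Qed.

(** Kept symbolic, it enters the later constants as a factor. [fine] would send an infinite integral
    to 0, which [normal_second_moment] excludes. *)
Definition normal_variance : R := fine (\int[normal_prob (0 : R) 1]_x (x ^+ 2)%:E).

Lemma normal_variance_ge0 : 0 <= normal_variance.
Proof. by apply/fine_ge0/integral_ge0 => x _; rewrite lee_fin sqr_ge0. Qed.

Let ge0_increment_law s r xi (f : R -> \bar R) : t <= s -> s < r -> r <= T ->
  xi != 0 -> measurable_fun setT f -> (forall x, 0 <= f x)%E ->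
  (\int[P]_w f (dW s r xi w) =
   \int[normal_prob 0 (Num.sqrt (r - s) * `|xi|)]_x f x)%E.
Proof.
move=> ts sr rT xi0 mf f0.
apply: (@ge0_integral_law _ _ _ P _ (measurableTypeR R)) => //.
  by apply: measurable_increment; rewrite ?ts ?rT ?(le_trans (ltW sr))// ?(le_trans ts) ?ltW.
by move=> U mU; exact: (wiener_normal hW ts sr rT xi0 mU).
Qed.

Let increment_law s r xi : t <= s -> s < r -> r <= T ->
  xi != 0 -> Int (dW s r xi) ->
  (\int[P]_w (dW s r xi w)%:E =
   \int[normal_prob 0 (Num.sqrt (r - s) * `|xi|)]_x x%:E)%E.
Proof.
move=> ts sr rT xi0 iX.
apply: (@integral_law _ _ _ P _ (measurableTypeR R) _ _ EFin) => //.
  by apply: measurable_increment; rewrite ?ts ?rT ?(le_trans (ltW sr))// ?(le_trans ts) ?ltW.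
by move=> U mU; exact: (wiener_normal hW ts sr rT xi0 mU).
Qed.

(** Rescaling the direction to [k *: xi] makes the increment standard normal; homogeneity, valid
    almost surely, brings back the factor [k ^+ 2]. *)
Lemma increment_sq s r xi : t <= s -> s <= r -> r <= T ->
  (\int[P]_w (dW s r xi w ^+ 2)%:E =
   (normal_variance * (r - s) * `|xi| ^+ 2)%:E)%E.
Proof.
move=> ts; rewrite le_eqVlt => /predU1P[<- rT|sr rT].
  rewrite subrr mulr0 mul0r; apply: integral0_eq => w _.
  by rewrite /increment subrr expr0n.
have hs : t <= s <= T by rewrite ts (le_trans _ rT)// ltW.
have hr : t <= r <= T by rewrite rT (le_trans ts)// ltW.
have msq z : measurable_fun setT (fun w => (dW s r z w ^+ 2)%:E).
  by apply/measurable_EFinP; apply: measurable_funX; exact: measurable_increment.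
have [->|xi0] := eqVneq xi 0.
  rewrite normr0 expr0n mulr0.
  rewrite (ae_eq_integral (cst 0%E))//; first by rewrite integral0.
  by have := increment0 hs hr; apply: filterS => w /= -> _; rewrite expr0n.
pose k : R := (Num.sqrt (r - s) * `|xi|)^-1.
have sq0 : 0 < Num.sqrt (r - s) by rewrite sqrtr_gt0 subr_gt0.
have k0 : 0 < k by rewrite invr_gt0 mulr_gt0// normr_gt0.
have kxi0 : k *: xi != 0 by rewrite scaler_eq0 negb_or gt_eqF.
have k1 : Num.sqrt (r - s) * `|k *: xi| = 1.
  rewrite normrZ (gtr0_norm k0) mulrCA mulrC mulfV// gt_eqF// -invr_gt0//.
have := @ge0_increment_law s r (k *: xi) (fun x => (x ^+ 2)%:E) ts sr rT kxi0.
have mx2 : measurable_fun setT (fun x : R => (x ^+ 2)%:E).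
  by apply/measurable_EFinP; exact: measurable_funX.
rewrite k1 => /(_ mx2 (fun x => _)) E.
have {}E : (\int[P]_w (dW s r (k *: xi) w ^+ 2)%:E = normal_variance%:E)%E.
  rewrite E; last by move=> x; rewrite lee_fin sqr_ge0.
  rewrite fineK// ge0_fin_numE; first exact: normal_second_moment.
  by apply: integral_ge0 => x _; rewrite lee_fin sqr_ge0.
have E2 : (\int[P]_w (dW s r (k *: xi) w ^+ 2)%:E =
    (k ^+ 2)%:E * \int[P]_w (dW s r xi w ^+ 2)%:E)%E.
  rewrite -ge0_integralZl//; last by rewrite lee_fin sqr_ge0.
  - apply: ae_eq_integral => //.
    + exact: measurable_funeM.
    + have := incrementZ k xi hs hr; apply: filterS => w /= -> _.
      by rewrite exprMn EFinM.
  - by move=> w _; rewrite lee_fin sqr_ge0.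
have k2 : k ^+ 2 != 0 by rewrite gt_eqF// exprn_gt0.
have E3 : (\int[P]_w (dW s r xi w ^+ 2)%:E = ((k ^+ 2)^-1)%:E *
    ((k ^+ 2)%:E * \int[P]_w (dW s r xi w ^+ 2)%:E))%E.
  by rewrite muleA -EFinM mulVf// mul1e.
rewrite E3 -E2 E -EFinM; congr EFin.
rewrite /k -exprVn invrK exprMn sqr_sqrtr ?subr_ge0 1?ltW//; ring.
Qed.

Lemma increment_sq_integrable s r xi : t <= s -> s <= r -> r <= T ->
  Int (fun w => dW s r xi w ^+ 2).
Proof.
move=> ts sr rT; have hs : t <= s <= T by rewrite ts (le_trans _ rT).
have hr : t <= r <= T by rewrite rT (le_trans ts).
apply/integrableP; split.
  by apply/measurable_EFinP; apply: measurable_funX; exact: measurable_increment.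
under eq_integral do rewrite /= ger0_norm ?sqr_ge0//.
by rewrite increment_sq// ltry.
Qed.

Lemma increment_integrable s r xi : t <= s -> s <= r -> r <= T ->
  Int (dW s r xi).
Proof.
move=> ts sr rT; have hs : t <= s <= T by rewrite ts (le_trans _ rT).
have hr : t <= r <= T by rewrite rT (le_trans ts).
by apply: integrable_of_sq; [exact: measurable_increment|exact: increment_sq_integrable].
Qed.

(* The increments along [xi] and [- xi] have the same law. *)
Lemma increment_mean s r xi : t <= s -> s <= r -> r <= T -> Ex (dW s r xi) = 0.
Proof.
move=> ts; rewrite le_eqVlt => /predU1P[<- rT|sr rT].
  rewrite /Rintegral integral0_eq// => w _.
  by rewrite /increment subrr.
have hs : t <= s <= T by rewrite ts (le_trans _ rT)// ltW.
have hr : t <= r <= T by rewrite rT (le_trans ts)// ltW.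
have md z : measurable_fun setT (dW s r z) by exact: measurable_increment.
have [->|xi0] := eqVneq xi 0.
  rewrite (ae_eq_Rintegral (g := fun=> 0))//; last exact: increment0.
  by rewrite Rintegral_cst// mul0r.
have iW z : Int (dW s r z) by exact: increment_integrable _ ts (ltW sr) rT.
have e1 : Ex (dW s r xi) = Ex (dW s r (- xi)).
  have nxi0 : - xi != 0 by rewrite oppr_eq0.
  congr fine; rewrite (increment_law ts sr rT xi0 (iW xi)).
  by rewrite (increment_law ts sr rT nxi0 (iW (- xi))) normrN.
have e2 : Ex (dW s r (- xi)) = - Ex (dW s r xi).
  rewrite -mulN1r -(RintegralZl (-1) measurableT (iW xi)).
  apply: (@ae_eq_Rintegral _ _ _ P); first exact: md.
    by apply: measurable_funM => //; exact: md.
  by have := incrementZ (-1) xi hs hr; apply: filterS => w; rewrite scaleN1r.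
lra.
Qed.

Lemma increment_indep s r xi (h : R -> R) (X : Omega -> R) :
  t <= s -> s < r -> r <= T ->
  (forall U, measurable U -> F s (X @^-1` U)) -> measurable_fun setT h ->
  Int X -> Int (h \o dW s r xi) ->
  Int (fun w => X w * h (dW s r xi w)) /\
  Ex (fun w => X w * h (dW s r xi w)) = Ex X * Ex (h \o dW s r xi).
Proof.
move=> ts sr rT aX mh iX ih.
have hs : t <= s <= T by rewrite ts (le_trans _ rT)// ltW.
have hr : t <= r <= T by rewrite rT (le_trans ts)// ltW.
apply: (RintegralM_indep (Y := h \o dW s r xi)) => //.
- move=> _ U mU; rewrite setTI.
  by apply: (measurable_wiener_filtration (s := s)); [case/andP: hs|exact: aX].
- by apply: measurableT_comp => //; exact: measurable_increment.
- move=> U V mU mV; have := wiener_indep hW (U := h @^-1` V) xi ts sr rT (aX U mU).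
  apply; rewrite -[X in measurable X]setTI; exact: mh.
Qed.

Lemma indic_increment_sq s r xi (G : set Omega) : t <= s -> s <= r -> r <= T ->
  F s G ->
  Int (fun w => \1_G w * dW s r xi w ^+ 2) /\
  Ex (fun w => \1_G w * dW s r xi w ^+ 2) =
    normal_variance * (r - s) * `|xi| ^+ 2 * fine (P G).
Proof.
move=> ts; rewrite le_eqVlt => /predU1P[<- rT|sr rT] FG.
  have -> : (fun w => \1_G w * dW s s xi w ^+ 2) = (fun=> 0).
    by apply/funext => w; rewrite /increment subrr expr0n mulr0.
  by split; [exact: integrable_cst_prob|rewrite Rintegral_cst// subrr mulr0 !mul0r].
have sT : s <= T by rewrite (le_trans _ rT)// ltW.
have mG : measurable G by exact: (measurable_wiener_filtration sT).
have iG : Int (\1_G : Omega -> R).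
  apply: (le_integrable _ _ _ (integrable_cst_prob P 1)) => //.
    by apply/measurable_EFinP; exact: measurable_indic.
  by move=> w _; rewrite /= lee_fin /indic; case: (_ \in _); rewrite ?normr1 ?normr0.
have [||||] := @increment_indep s r xi (fun x => x ^+ 2) (\1_G : Omega -> R) ts sr rT.
- by move=> U mU; apply: adapted_preimage => //; exact: adapted_indic.
- exact: measurable_funX.
- exact: iG.
- exact: increment_sq_integrable ts (ltW sr) rT.
- move=> i e; split=> //; rewrite e /Rintegral integral_indic// setIT.
  by rewrite /comp increment_sq//= 1?ltW// mulrC.
Qed.

(** Polarization of [indic_increment_sq], using that increments are almost surely additive in the
    direction. *)
Lemma indic_incrementM s r xi eta (G : set Omega) : t <= s -> s <= r -> r <= T ->
  F s G ->
  Int (fun w => \1_G w * dW s r xi w * dW s r eta w) /\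
  Ex (fun w => \1_G w * dW s r xi w * dW s r eta w) =
    normal_variance * (r - s) * inner xi eta * fine (P G).
Proof.
move=> ts sr rT FG.
have hs : t <= s <= T by rewrite ts (le_trans _ rT).
have hr : t <= r <= T by rewrite rT (le_trans ts).
have mG : measurable G.
  by apply: (measurable_wiener_filtration (s := s)); [case/andP: hs|].
have md z : measurable_fun setT (dW s r z) by exact: measurable_increment.
have mi : measurable_fun setT (\1_G : Omega -> R) by exact: measurable_indic.
pose f z w : R := \1_G w * dW s r z w ^+ 2.
have [i1 e1] := indic_increment_sq xi ts sr rT FG.
have [i2 e2] := indic_increment_sq eta ts sr rT FG.
have [i3 e3] := indic_increment_sq (xi + eta) ts sr rT FG.
have mf z : measurable_fun setT (f z).
  by apply: measurable_funM => //; exact: measurable_funX.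
have i12 : Int (fun w => f xi w + f eta w) by exact: (integrableD _ i1 i2).
have i312 : Int (fun w => f (xi + eta) w - (f xi w + f eta w)).
  exact: (integrableB _ i3 i12).
have mM : measurable_fun setT (fun w => \1_G w * dW s r xi w * dW s r eta w).
  by do 2 apply: measurable_funM => //.
split.
  apply: (le_integrable _ _ _ i12) => //; first exact/measurable_EFinP.
  move=> w _; rewrite /= lee_fin /f -mulrDr -mulrA normrM [leRHS]normrM.
  rewrite ler_wpM2l// (le_trans (normrM_le_sqr _ _))//.
  exact: ler_norm.
have -> : Ex (fun w => \1_G w * dW s r xi w * dW s r eta w) =
    Ex (fun w => 2^-1 * (f (xi + eta) w - (f xi w + f eta w))).
  apply: ae_eq_Rintegral => //.
    apply: measurable_funM => //; apply: measurable_funB => //.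
    exact: measurable_funD.
  have := incrementD xi eta hs hr; apply: filterS => w.
  by rewrite /f => ->; field.
rewrite RintegralZl// RintegralB// RintegralD// e1 e2 e3.
by rewrite sqnormD; field.
Qed.

(** All factors but the later increment are known at time [s'], and that increment is independent of
    them with mean zero. *)
Lemma cross_increments s r s' r' xi eta (G G' : set Omega) :
  t <= s -> s <= r -> r <= s' -> s' <= r' -> r' <= T -> F s G -> F s' G' ->
  Int (fun w => (\1_G w * dW s r xi w) * (\1_G' w * dW s' r' eta w)) /\
  Ex (fun w => (\1_G w * dW s r xi w) * (\1_G' w * dW s' r' eta w)) = 0.
Proof.
move=> ts sr rs' + rT FG FG'; rewrite le_eqVlt => /predU1P[<-|sr'].
  have -> : (fun w => \1_G w * dW s r xi w * (\1_G' w * dW s' s' eta w)) = (fun=> 0).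
    by apply/funext => w; rewrite /increment subrr !mulr0.
  by split; [exact: integrable_cst_prob|rewrite Rintegral_cst// mul0r].
have s'T : s' <= T by rewrite (le_trans _ rT)// ltW.
have rT0 : r <= T by rewrite (le_trans rs').
have hs : t <= s <= T by rewrite ts (le_trans _ rT0).
have hr : t <= r <= T by rewrite rT0 (le_trans ts).
have mG : measurable G.
  by apply: (measurable_wiener_filtration (s := s)); [case/andP: hs|].
have mG' : measurable G' by apply: (measurable_wiener_filtration s'T).
have ts' : t <= s' by rewrite (le_trans ts)// (le_trans sr).
pose X w : R := (\1_G w * dW s r xi w) * \1_G' w.
have aX : adapted s' X.
  apply: measurable_funM; last exact: adapted_indic.
  apply: measurable_funM.
    by apply: adapted_indic; apply: wiener_filtration_le FG; exact: le_trans rs'.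
  apply: measurable_funB; apply: adapted_wiener.
    by rewrite rs' (le_trans ts).
  by rewrite ts (le_trans sr).
have iX : Int X.
  apply: (le_integrable _ _ _ (increment_integrable xi ts sr rT0)) => //.
    by apply/measurable_EFinP; exact: adapted_measurable aX.
  move=> w _; rewrite /= lee_fin /X !normrM /indic.
  by case: (_ \in _); case: (_ \in _); rewrite ?normr1 ?normr0 ?mul1r ?mulr1 ?mul0r ?mulr0.
have [||||] := @increment_indep s' r' eta id X ts' sr' rT.
- by move=> U mU; exact: adapted_preimage.
- exact: measurable_id.
- exact: iX.
- exact: increment_integrable ts' (ltW sr') rT.
- move=> i e; have E : (fun w => (\1_G w * dW s r xi w) * (\1_G' w * dW s' r' eta w)) =
     (fun w => X w * id (dW s' r' eta w)).
    by apply/funext => w; rewrite /X mulrA.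
  rewrite E; split=> //; rewrite e.
  by rewrite [X in _ * X](increment_mean eta ts' (ltW sr') rT) mulr0.
Qed.

Let Rintegral_sum (I : Type) (s : seq I) (f : I -> Omega -> R) :
  (forall i, Int (f i)) ->
  Int (fun w => \sum_(i <- s) f i w) /\
  Ex (fun w => \sum_(i <- s) f i w) = \sum_(i <- s) Ex (f i).
Proof.
move=> fi; elim: s => [|i s [IHi IHe]].
  under [X in EFin \o X]eq_fun do rewrite big_nil.
  under eq_Rintegral do rewrite big_nil.
  by rewrite big_nil Rintegral_cst// mul0r; split => //; exact: integrable_cst_prob.
have E : (fun w => \sum_(j <- i :: s) f j w) = (fun w => f i w + \sum_(j <- s) f j w).
  by apply/funext => w; rewrite big_cons.
rewrite E big_cons -IHe; split; first exact: (integrableD _ (fi i) IHi).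
by rewrite RintegralD.
Qed.

(** * Ito isometry on a finite grid *)

Section elementary_sum.
Context {H : hilbertType R} (I : finType) (N : nat) (tau : nat -> R).
Variables (dir : I -> Xi) (v : I -> H).
Hypothesis tau_le : {homo tau : i j / (i <= j)%N >-> i <= j}.
Hypothesis t_tau : t <= tau 0%N.
Hypothesis tau_T : tau N <= T.
Variable E : set Xi.
Hypothesis hE : orthonormal_basis E.

Let D (A : nat -> I -> set Omega) w : H :=
  \sum_(k < N) \sum_i (\1_(A k i) w * dW (tau k) (tau k.+1) (dir i) w) *: v i.

(** The squared Hilbert-Schmidt norm of the integrand on the [k]-th cell, as a Gram sum;
    [dt k * q A k] is the increment of the quadratic variation there. *)
Let q (A : nat -> I -> set Omega) k w : R :=
  \sum_i \sum_j \1_(A k i) w * \1_(A k j) w *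
    (inner (dir i) (dir j) * inner (v i) (v j)).

Let dt k := tau k.+1 - tau k.

Let dt_ge0 k : 0 <= dt k.
Proof. by rewrite subr_ge0 tau_le. Qed.

Let t_le k : t <= tau k.
Proof. by rewrite (le_trans t_tau)// tau_le. Qed.

Let le_T k : (k <= N)%N -> tau k <= T.
Proof. by move=> kN; rewrite (le_trans _ tau_T)// tau_le. Qed.

Let q_ge0 A k w : 0 <= q A k w.
Proof.
have := gram_ge0 hE dir (fun i => (\1_(A k i) w : R) *: v i).
rewrite /q; congr (_ <= _); apply: eq_bigr => i _; apply: eq_bigr => j _.
by rewrite innerZl innerZr; ring.
Qed.

Let measurable_event (A : nat -> I -> set Omega) :
  (forall k i, (k < N)%N -> F (tau k) (A k i)) ->
  forall k i, (k < N)%N -> measurable (A k i).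
Proof.
move=> FA k i kN; apply: (measurable_wiener_filtration (s := tau k)); last exact: FA.
exact/le_T/ltnW.
Qed.

Let zeta (A : nat -> I -> set Omega) k i w : R :=
  \1_(A k i) w * dW (tau k) (tau k.+1) (dir i) w.

Let zetaM (A : nat -> I -> set Omega) k i l j :
  (forall k i, (k < N)%N -> F (tau k) (A k i)) -> (k < N)%N -> (l < N)%N ->
  Int (fun w => zeta A k i w * zeta A l j w) /\
  Ex (fun w => zeta A k i w * zeta A l j w) =
    if k == l then normal_variance * (dt k * inner (dir i) (dir j) *
       Ex (fun w => \1_(A k i) w * \1_(A k j) w)) else 0.
Proof.
move=> FA kN lN; have mA := measurable_event FA.
have [kl|lk|->] := ltngtP k l.
- exact: (cross_increments (dir i) (dir j) (t_le k) (tau_le (leqnSn k)) (tau_le kl)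
    (tau_le (leqnSn l)) (le_T lN) (FA k i kN) (FA l j lN)).
- under [X in EFin \o X]eq_fun do rewrite mulrC.
  under eq_Rintegral do rewrite mulrC.
  exact: (cross_increments (dir j) (dir i) (t_le l) (tau_le (leqnSn l)) (tau_le lk)
    (tau_le (leqnSn k)) (le_T kN) (FA l j lN) (FA k i kN)).
have FI : F (tau l) (A l i `&` A l j).
  have mI : measurable ((A l i : set (space (tau l))) `&` A l j).
    by apply: measurableI; exact: FA.
  exact: mI.
have [i1 e1] := indic_incrementM (dir i) (dir j) (t_le l) (tau_le (leqnSn l))
   (le_T lN) FI.
have zE : (fun w => zeta A l i w * zeta A l j w) = (fun w => \1_(A l i `&` A l j) w *
   dW (tau l) (tau l.+1) (dir i) w * dW (tau l) (tau l.+1) (dir j) w).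
  by apply/funext => w; rewrite /zeta indicI /=; ring.
rewrite zE; split=> //; rewrite e1.
have -> : (fun w => \1_(A l i) w * \1_(A l j) w) = (\1_(A l i `&` A l j) : Omega -> R).
  by apply/funext => w; rewrite indicI.
rewrite [Ex (\1_ _)]/Rintegral integral_indic//; last by apply: measurableI; exact: mA.
by rewrite setIT /dt; ring.
Qed.

(** Squaring gives a double sum over pairs of cells; [zetaM] kills the pairs of distinct cells and
    evaluates the others. *)
Let ito_isometry (A : nat -> I -> set Omega) :
  (forall k i, (k < N)%N -> F (tau k) (A k i)) ->
  [/\ Int (fun w => `|D A w| ^+ 2),
      Int (fun w => \sum_(k < N) dt k * q A k w) &
  Ex (fun w => `|D A w| ^+ 2) =
    normal_variance * Ex (fun w => \sum_(k < N) dt k * q A k w)].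
Proof.
move=> FA.
have mA := measurable_event FA.
pose f (p r : 'I_N * I) w := zeta A p.1 p.2 w * zeta A r.1 r.2 w * inner (v p.2) (v r.2).
have DE w : `|D A w| ^+ 2 = \sum_p \sum_r f p r w.
  have -> : D A w = \sum_(p : 'I_N * I) zeta A p.1 p.2 w *: v p.2 by rewrite /D pair_big.
  rewrite -inner_norm inner_suml; apply: eq_bigr => p _.
  rewrite inner_sumr; apply: eq_bigr => r _.
  by rewrite innerZl innerZr mulrA.
have fi p r : Int (f p r) /\ Ex (f p r) = (if (p.1 : nat) == r.1 then normal_variance * (dt p.1 *
     inner (dir p.2) (dir r.2) * Ex (fun w => \1_(A p.1 p.2) w * \1_(A p.1 r.2) w)) else 0) *
     inner (v p.2) (v r.2).
  have [i1 e1] := zetaM p.2 r.2 FA (ltn_ord p.1) (ltn_ord r.1).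
  split; last by rewrite /f RintegralZr// e1.
  by apply: eq_integrable (integrableZr _ (inner (v p.2) (v r.2)) i1) => // w _.
have gi k i j : (k < N)%N -> Int (fun w => \1_(A k i) w * \1_(A k j) w : R).
  move=> kN; apply: (le_integrable _ _ _ (integrable_cst_prob P 1)) => //.
    by apply/measurable_EFinP; apply: measurable_funM; apply: measurable_indic; exact: mA.
  move=> w _; rewrite /= lee_fin /indic normrM.
  by case: (_ \in _); case: (_ \in _); rewrite ?normr1 ?normr0 ?mul1r ?mulr1 ?mul0r ?mulr0.
pose g (k : 'I_N) i j w : R := dt k * (inner (dir i) (dir j) * inner (v i) (v j)) *
   (\1_(A k i) w * \1_(A k j) w).
have gE w : \sum_(k < N) dt k * q A k w = \sum_(k < N) \sum_i \sum_j g k i j w.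
  apply: eq_bigr => k _; rewrite /q mulr_sumr; apply: eq_bigr => i _.
  by rewrite mulr_sumr; apply: eq_bigr => j _; rewrite /g; ring.
have ggi k i j : Int (g k i j) /\ Ex (g k i j) = dt k * (inner (dir i) (dir j) * inner (v i) (v j)) *
    Ex (fun w => \1_(A k i) w * \1_(A k j) w).
  split; last by rewrite /g RintegralZl//; exact: gi.
  by apply: eq_integrable (integrableZl _ (dt k * (inner (dir i) (dir j) * inner (v i) (v j))) (gi k i j (ltn_ord k))) => // w _.
have g3 k i := Rintegral_sum (index_enum I) (fun j => (ggi k i j).1).
have g2 k := Rintegral_sum (index_enum I) (fun i => (g3 k i).1).
have g1 := Rintegral_sum (index_enum 'I_N) (fun k => (g2 k).1).
have f2 p := Rintegral_sum (index_enum _) (fun r => (fi p r).1).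
have f1 := Rintegral_sum (index_enum _) (fun p => (f2 p).1).
rewrite (_ : (fun w => `|D A w| ^+ 2) = (fun w => \sum_p \sum_r f p r w)); last exact/funext.
rewrite (_ : (fun w => \sum_(k < N) dt k * q A k w) =
  (fun w => \sum_(k < N) \sum_i \sum_j g k i j w)); last exact/funext.
split; [exact: f1.1|exact: g1.1|].
rewrite f1.2 g1.2 -(pair_big xpredT xpredT (fun k i => Ex (fun w => \sum_r f (k, i) r w))) /= mulr_sumr.
apply: eq_bigr => k _; rewrite (g2 k).2 mulr_sumr; apply: eq_bigr => i _.
rewrite (f2 (k, i)).2 (g3 k i).2 mulr_sumr.
rewrite -(pair_big xpredT xpredT (fun l j => Ex (f (k, i) (l, j)))) /= (bigD1 k)//=.
rewrite [X in _ + X]big1 ?addr0; last first.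
  move=> l lk; apply: big1 => j _; rewrite (fi (k, i) (l, j)).2 /= ifF ?mul0r//.
  by apply/negbTE; rewrite eq_sym; exact: lk.
apply: eq_bigr => j _; rewrite (fi (k, i) (k, j)).2 /= eqxx (ggi k i j).2; ring.
Qed.

(* Stopping the grid when the accumulated quadratic variation exceeds [c] keeps
   the integrand elementary, because [q A k] is known at time [tau k]. *)
Lemma elementary_sum_truncated (A : nat -> I -> set Omega) (c : R) : 0 <= c ->
  (forall k i, (k < N)%N -> F (tau k) (A k i)) ->
  [/\ measurable_fun setT (fun w => \sum_(k < N) dt k * q A k w),
      measurable_fun setT (fun w => `|D A w| ^+ 2) &
  (\int[P]_w (\1_[set w | \sum_(k < N) dt k * q A k w <= c] w * `|D A w| ^+ 2)%:E <=
   normal_variance%:E * \int[P]_w (Num.min (\sum_(k < N) dt k * q A k w) c)%:E)%E].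
Proof.
move=> c0 FA.
pose Q n w := \sum_(k < n) dt k * q A k w.
pose B k := [set w | Q k.+1 w <= c].
have aQ k n : (k < N)%N -> (n <= k.+1)%N -> adapted (tau k) (Q n).
  move=> kN nk; apply: measurable_sum => l; apply: measurable_funM => //.
  apply: measurable_sum => i; apply: measurable_sum => j.
  apply: measurable_funM => //; apply: measurable_funM; apply: adapted_indic.
    apply: (wiener_filtration_le (s := tau l)); last first.
      by apply: FA; rewrite (leq_trans (ltn_ord l))// (leq_trans nk).
    by apply: tau_le; rewrite -ltnS (leq_trans (ltn_ord l)).
  apply: (wiener_filtration_le (s := tau l)); last first.
    by apply: FA; rewrite (leq_trans (ltn_ord l))// (leq_trans nk).
  by apply: tau_le; rewrite -ltnS (leq_trans (ltn_ord l)).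
have FB k : (k < N)%N -> F (tau k) (B k).
  move=> kN; have := adapted_preimage (aQ k k.+1 kN (leqnn _)) (measurable_itv `]-oo, c]).
  by congr (F _ _); apply/seteqP; split => w /=; rewrite in_itv.
have mQ : measurable_fun setT (Q N).
  case: (posnP N) => [N0|N0].
    have -> : Q N = fun=> 0 by apply/funext => w; rewrite /Q N0 big_ord0.
    exact: measurable_cst.
  apply: (adapted_measurable (s := tau N.-1)).
    by apply: le_T; exact: leq_pred.
  by apply: aQ; rewrite prednK.
pose A' k i := B k `&` A k i.
have FA' k i : (k < N)%N -> F (tau k) (A' k i).
  move=> kN.
  have mI : measurable ((B k : set (space (tau k))) `&` A k i).
    by apply: measurableI; [exact: FB|exact: FA].
  exact: mI.
have Q_ge0 n w : 0 <= Q n w by apply: sumr_ge0 => k _; rewrite mulr_ge0 ?dt_ge0 ?q_ge0.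
have Q_le n m w : (n <= m)%N -> Q n w <= Q m w.
  move=> nm; rewrite /Q -!(big_mkord xpredT (fun k => dt k * q A k w)).
  rewrite (big_cat_nat (leq0n n) nm) /= lerDl.
  by apply: sumr_ge0 => k _; rewrite mulr_ge0 ?dt_ge0 ?q_ge0.
have qA' k w : q A' k w = \1_(B k) w * q A k w.
  rewrite /q mulr_sumr; apply: eq_bigr => i _; rewrite mulr_sumr.
  apply: eq_bigr => j _; rewrite !indicI /=.
  rewrite /indic; case: (w \in B k) => /=; ring.
(* A cell is kept only if the quadratic variation including that cell is still at most [c], so the
   stopped sum never overshoots [c]. *)
have QA' w : \sum_(k < N) dt k * q A' k w <= Num.min (Q N w) c.
  suff h n : \sum_(k < n) dt k * q A' k w <= Num.min (Q n w) c by exact: h.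
  elim: n => [|n IH]; first by rewrite big_ord0 le_min Q_ge0.
  rewrite big_ord_recr /= qA' /indic.
  case: (boolP (w \in B n)) => wB /=.
    rewrite mul1r; have : Q n.+1 w <= c by move: wB; rewrite inE.
    move=> Qc; rewrite (min_idPl Qc) [leRHS]/Q big_ord_recr/= lerD2r.
    by move: IH; rewrite le_min => /andP[].
  rewrite mul0r mulr0 addr0 (le_trans IH)// le_min !ge_min lexx orbT andbT.
  by rewrite Q_le.
have [i1 i2 e] := ito_isometry FA'.
(* [Q n] increases with [n], so where [Q N <= c] no cell is stopped and the two sums coincide. *)
have D_le w : \1_[set w | Q N w <= c] w * `|D A w| ^+ 2 <= `|D A' w| ^+ 2.
  rewrite /indic; case: (boolP (w \in _)) => [|_]; last by rewrite mul0r sqr_ge0.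
  rewrite inE /= => Qc; rewrite mul1r.
  rewrite (_ : D A' w = D A w)//; apply: eq_bigr => k _; apply: eq_bigr => i _.
  rewrite /A' indicI /= [\1_(B k) w]indicE mem_set ?mul1r//.
  by rewrite /B /=; exact: le_trans (Q_le _ _ _ (ltn_ord k)) Qc.
have mD (G : nat -> I -> set Omega) : (forall k i, (k < N)%N -> F (tau k) (G k i)) ->
    measurable_fun setT (fun w => `|D G w| ^+ 2).
  by move=> FG; have [/integrableP[/measurable_EFinP]] := ito_isometry FG.
split; [exact: mQ|exact: mD|].
apply: (@le_trans _ _ (\int[P]_w (`|D A' w| ^+ 2)%:E)%E).
  apply: ge0_le_integral => //.
  - apply/measurable_EFinP; apply: measurable_funM; last exact: mD.
    apply: measurable_indic.
    have := mQ measurableT _ (measurable_itv `]-oo, c]); rewrite setTI.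
    by congr (measurable _); apply/seteqP; split => w /=; rewrite in_itv.
  - by apply/measurable_EFinP; exact: mD.
  by move=> w _; rewrite lee_fin; exact: D_le.
have -> : (\int[P]_w (`|D A' w| ^+ 2)%:E = (Ex (fun w => `|D A' w| ^+ 2)%R)%:E)%E.
  by rewrite fineK//; exact: integrable_fin_num.
rewrite e EFinM; apply: lee_wpmul2l; first by rewrite lee_fin normal_variance_ge0.
rewrite fineK; last exact: integrable_fin_num.
apply: ge0_le_integral => //.
- by move=> w _; rewrite lee_fin; apply: sumr_ge0 => k _; rewrite mulr_ge0 ?dt_ge0 ?q_ge0.
- by have /integrableP[] := i2.
- by apply/measurable_EFinP; apply: measurable_minr => //; exact: mQ.
- by move=> w _; rewrite lee_fin QA'.
Qed.

End elementary_sum.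

End wiener.

(** * Elementary stochastic integrals *)

Section monotone_integral.
Context d (T : measurableType d) {R : realType} (mu : {measure set T -> \bar R}).
Local Open Scope ereal_scope.
Import HBNNSimple.

(* Unlike [ge0_le_integral], no measurability is required: the integral of a
   nonnegative function is a supremum over simple functions below it. *)
Lemma ge0_le_integral_nonmeas (D : set T) (f g : T -> \bar R) :
  (forall x, D x -> 0 <= f x) -> (forall x, D x -> f x <= g x) ->
  \int[mu]_(x in D) f x <= \int[mu]_(x in D) g x.
Proof.
move=> f0 fg; rewrite !ge0_integralE//; last first.
  by move=> x Dx; exact: le_trans (f0 _ Dx) (fg _ Dx).
apply: ereal_sup_le => _ [h hf <-]; exists h => // x.
apply: le_trans (hf x) _; rewrite /patch; case: ifPn => // /set_mem; exact: fg.
Qed.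

End monotone_integral.

Section grid.
Context {R : realType} (tau : nat -> R) (N : nat).
Hypothesis tau_le : {homo tau : i j / (i <= j)%N >-> i <= j}.

Let active a b k := (a <= tau k) && (tau k.+1 <= b).

(** Grid points may repeat, so [a] and [b] do not determine their indices; an active cell outside
    the range from [i] to [j] has zero length and contributes nothing. *)
Lemma grid_telescope (f : R -> R) a b i j :
  (i <= N)%N -> (j <= N)%N -> a = tau i -> b = tau j -> a <= b ->
  \sum_(k < N) (active a b k)%:R * (f (tau k.+1) - f (tau k)) = f b - f a.
Proof.
move=> iN jN ai bj ab.
wlog ij : i iN ai / (i <= j)%N.
  move=> h; have [ij|/ltnW ji] := leqP i j; first exact: (h i).
  apply: (h j) => //; apply/eqP; rewrite eq_le -bj ab /= bj ai.
  exact: tau_le.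
transitivity (\sum_(i <= k < j) (f (tau k.+1) - f (tau k))); last first.
  by rewrite telescope_sumr// ai bj.
rewrite -(big_mkord xpredT (fun k => (active a b k)%:R * (f (tau k.+1) - f (tau k)))).
rewrite (big_cat_nat (leq0n i) iN) /= (big_cat_nat ij jN) /=.
rewrite big_nat_cond big1 ?add0r; last first.
  move=> k /andP[/andP[_ ki] _]; rewrite /active.
  case: (boolP (_ && _)) => [/andP[ak _]|_]; last by rewrite mul0r.
  rewrite (_ : tau k.+1 = tau k) ?subrr ?mulr0//.
  apply/eqP; rewrite eq_le; apply/andP; split; last exact: tau_le.
  by rewrite (le_trans _ ak)// ai tau_le.
rewrite [X in _ + X]big_nat_cond [X in _ + X]big1 ?addr0; last first.
  move=> k /andP[/andP[jk _] _]; rewrite /active.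
  case: (boolP (_ && _)) => [/andP[_ kb]|_]; last by rewrite mul0r.
  rewrite (_ : tau k.+1 = tau k) ?subrr ?mulr0//.
  apply/eqP; rewrite eq_le; apply/andP; split; last exact: tau_le.
  by rewrite (le_trans kb)// bj tau_le.
apply: eq_big_nat => k /andP[ik kj].
by rewrite /active ai bj !tau_le//= mul1r.
Qed.

Lemma grid_cell_active (r a b : R) i j k : a = tau i -> b = tau j ->
  tau k < r <= tau k.+1 -> (a < r <= b) = active a b k.
Proof.
move=> ai bj /andP[kr rk]; apply/idP/idP => /andP[h1 h2]; apply/andP; split.
- rewrite ai tau_le// leqNgt; apply/negP => ki.
  by have := lt_le_trans h1 (le_trans rk (tau_le ki)); rewrite ai ltxx.
- rewrite bj tau_le// ltnNge; apply/negP => jk.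
  by have := lt_le_trans (le_lt_trans (tau_le jk) kr) h2; rewrite bj ltxx.
- exact: le_lt_trans h1 kr.
- exact: le_trans rk h2.
Qed.

Lemma grid_cell_unique (r : R) k l : tau k < r <= tau k.+1 ->
  tau l < r <= tau l.+1 -> k = l.
Proof.
move=> /andP[k1 k2] /andP[l1 l2]; have [kl|lk|//] := ltngtP k l.
  by have := lt_le_trans l1 (le_trans k2 (tau_le kl)); rewrite ltxx.
by have := lt_le_trans k1 (le_trans l2 (tau_le lk)); rewrite ltxx.
Qed.

End grid.

Section elementary_integral.
Context {R : realType} {H Xi : hilbertType R}.
Context {d : measure_display} {Omega : measurableType d}.
Variables (P : probability Omega R) (W : R -> Xi -> Omega -> R) (t T : R).
Hypothesis P_complete : measure_is_complete P.
Hypothesis hW : cylindrical_wiener P W t T.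
Variable E : set Xi.
Hypothesis hE : orthonormal_basis E.

(** The intervals of all terms are cut along one common grid. [Q] is the quadratic variation written
    as a finite Gram sum, and the Hilbert-Schmidt energy bounds it from above. *)
Lemma elementary_integral_truncated (s : R)
    (phi : seq (@elementary R H Xi d Omega P W t s)) : t <= s <= T ->
  exists Q : Omega -> R,
  [/\ measurable_fun setT Q,
      forall w, 0 <= Q w,
      forall w, ((Q w)%:E <= \int[lebesgue_measure]_(r in `[t, s])
        hs_sqnorm E (elementary_process phi r w))%E,
      measurable_fun setT (fun w => `|elementary_integral phi w| ^+ 2) &
      forall c, 0 <= c ->
  (\int[P]_w (\1_[set w | Q w <= c] w * `|elementary_integral phi w| ^+ 2)%:E <=
   (@normal_variance R)%:E * \int[P]_w (Num.min (Q w) c)%:E)%E].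
Proof.
move=> /andP[ts sT].
pose c (i : 'I_(size phi)) := tnth (in_tuple phi) i.
(* Including [t] makes the list nonempty even if [phi] is empty. *)
pose L := t :: [seq el_lo (c i) | i <- enum 'I_(size phi)] ++
  [seq el_hi (c i) | i <- enum 'I_(size phi)].
(* The default [s] continues the sorted points beyond their end: [tau N = s] for the length [N], and
   monotonicity persists. *)
pose tau k := nth s (sort <=%R L) k.
pose N := size (sort <=%R L).
have memL x : (x \in sort <=%R L) = (x \in L) by rewrite mem_sort.
have ltL i : (el_lo (c i) \in L) && (el_hi (c i) \in L).
  rewrite !inE !mem_cat (map_f (fun i => el_lo (c i))) ?mem_enum//.
  by rewrite (map_f (fun i => el_hi (c i))) ?mem_enum// !orbT.
have Lb x : x \in L -> t <= x <= s.
  rewrite inE mem_cat => /orP[/eqP->|/orP[]/mapP[i _ ->]]; first by rewrite lexx.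
    by have [/andP[h1 h2] h3] := el_time (c i); rewrite h1 (le_trans h2).
  by have [/andP[h1 h2] h3] := el_time (c i); rewrite h3 (le_trans h1).
have tau_le : {homo tau : i j / (i <= j)%N >-> i <= j}.
  move=> i j ij; have [jN|Nj] := ltnP j N.
    apply: (sorted_leq_nth le_trans lexx s (sort_le_sorted L)) => //.
    by rewrite inE (leq_ltn_trans ij).
  rewrite [leRHS]nth_default//; have [iN|Ni] := ltnP i N.
    by have := mem_nth s iN; rewrite memL => /Lb/andP[].
  by rewrite /tau nth_default.
have t_tau : t <= tau 0%N.
  have N0 : (0 < N)%N by rewrite /N size_sort.
  by have := mem_nth s N0; rewrite memL => /Lb/andP[].
have tauN : tau N = s by rewrite /tau nth_default.
have tau_T : tau N <= T by rewrite tauN.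
pose lo i := el_lo (c i); pose hi i := el_hi (c i).
have loE i : exists2 n, (n <= N)%N & lo i = tau n.
  exists (index (lo i) (sort <=%R L)); first exact: index_size.
  by rewrite /tau nth_index// memL; have /andP[] := ltL i.
have hiE i : exists2 n, (n <= N)%N & hi i = tau n.
  exists (index (hi i) (sort <=%R L)); first exact: index_size.
  by rewrite /tau nth_index// memL; have /andP[] := ltL i.
have lohi i : lo i <= hi i by have [/andP[]] := el_time (c i).
pose active i k := (lo i <= tau k) && (tau k.+1 <= hi i).
pose A k i := if active i k then el_event (c i) else set0.
have FA k i : (k < N)%N -> wiener_filtration P W t (tau k) (A k i).
  move=> kN; rewrite /A; case: ifPn => [/andP[lk _]|_].
    by apply: wiener_filtration_le lk _ _; exact: el_adapted.
  exact: wiener_filtration_set0.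
have AE k i w : \1_(A k i) w = (active i k)%:R * \1_(el_event (c i)) w :> R.
  by rewrite /A; case: ifPn => _; rewrite ?mul1r// mul0r indic0.
pose dir i := el_dir (c i); pose v i := el_val (c i).
have intE w : elementary_integral phi w = \sum_(k < N) \sum_i
    (\1_(A k i) w * increment W (tau k) (tau k.+1) (dir i) w) *: v i.
  rewrite /elementary_integral big_tnth exchange_big /=; apply: eq_bigr => i _.
  rewrite -scaler_suml; congr (_ *: _).
  under eq_bigr do rewrite AE mulrAC.
  rewrite -mulr_suml mulrC; congr (_ * _).
  have [n1 n1N h1] := loE i; have [n2 n2N h2] := hiE i.
  by rewrite -(grid_telescope tau_le (fun u => W u (dir i) w) n1N n2N h1 h2 (lohi i)).
pose q k w : R := \sum_i \sum_j \1_(A k i) w * \1_(A k j) w *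
  (inner (dir i) (dir j) * inner (v i) (v j)).
pose Q w := \sum_(k < N) (tau k.+1 - tau k) * q k w.
have trunc a (a0 : 0 <= a) := elementary_sum_truncated P_complete hW dir v tau_le t_tau tau_T hE a0 FA.
have q_ge0 k w : 0 <= q k w.
  have := gram_ge0 hE dir (fun i => (\1_(A k i) w : R) *: v i).
  rewrite /q; congr (_ <= _); apply: eq_bigr => i _; apply: eq_bigr => j _.
  by rewrite innerZl innerZr; ring.
have Q_ge0 w : 0 <= Q w.
  by apply: sumr_ge0 => k _; rewrite mulr_ge0// subr_ge0 tau_le.
have mI : measurable_fun setT (fun w => `|elementary_integral phi w| ^+ 2).
  have [_ + _] := trunc 0 (lexx 0).
  by under [X in measurable_fun _ X -> _]eq_fun do rewrite -intE.
exists Q; split => //; [by have [] := trunc 0 (lexx 0)| |]; last first.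
  move=> a a0; have [_ _] := trunc a a0.
  by under [X in (X <= _)%E -> _]eq_integral do rewrite -intE.
move=> w.
(* Half-open cells are disjoint, so the energy density can be compared with [q k w] cell by cell; a
   time in no cell needs only its nonnegativity. *)
pose cell k : set R := `]tau k, tau k.+1]%classic.
have cellS k : (k < N)%N -> cell k `<=` `[t, s]%classic.
  move=> kN r; rewrite /cell /= !in_itv /= => /andP[kr rk]; apply/andP; split.
    by rewrite (le_trans _ (ltW kr))// (le_trans t_tau)// tau_le.
  by rewrite (le_trans rk)// -tauN tau_le.
have mcell k : measurable_fun `[t, s]%classic (\1_(cell k) : R -> R).
  by apply: measurable_indic; exact: measurable_itv.
apply: (@le_trans _ _ (\int[lebesgue_measure]_(r in `[t, s])
    (\sum_(k < N) q k w * \1_(cell k) r)%:E)%E).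
  under eq_integral do rewrite -sumEFin.
  rewrite ge0_integral_sum//; last 2 first.
  - by move=> k; apply/measurable_EFinP; apply: measurable_funM => //; exact: mcell.
  - by move=> k r _; rewrite lee_fin mulr_ge0.
  rewrite -sumEFin; apply: lee_sum => k _.
  under eq_integral do rewrite EFinM.
  rewrite ge0_integralZl//; last 2 first.
  - by apply/measurable_EFinP; exact: mcell.
  - by rewrite lee_fin.
  rewrite integral_indic; try exact: measurable_itv.
  rewrite setIidl; last exact: cellS.
  rewrite mulrC EFinM lee_wpmul2l ?lee_fin//.
  apply: (@le_trans _ _ (lebesgue_measure (cell k))); last exact: lexx.
  rewrite /cell lebesgue_measure_itv/= lte_fin; case: ifPn => //.
  by rewrite -leNgt lee_fin subr_le0.
apply: ge0_le_integral_nonmeas => [r _|r _].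
  by rewrite lee_fin sumr_ge0// => k _; rewrite mulr_ge0.
have [[k rk]|nr] := pselect (exists k : 'I_N, cell k r); last first.
  rewrite big1; first exact: esum_ge0.
  move=> k _; rewrite indicE memNset ?mulr0// => kr; apply: nr.
  by exists k.
rewrite (bigD1 k)//= big1 ?addr0; last first.
  move=> l lk; rewrite indicE memNset ?mulr0//.
  move: rk; rewrite /cell /= !in_itv /= => rk rl.
  by move: lk; rewrite -val_eqE /= (grid_cell_unique tau_le rk rl) eqxx.
rewrite indicE mem_set// mulr1.
have := finite_rank_hs_sqnorm_ge hE dir (fun i => (\1_(A k i) w : R) *: v i).
congr (_ <= _)%E.
  congr EFin; apply: eq_bigr => i _; apply: eq_bigr => j _.
  by rewrite innerZl innerZr; ring.
congr (hs_sqnorm E _); apply/funext => xi.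
rewrite /elementary_process [RHS]big_tnth; apply: eq_bigr => i _.
rewrite scalerA -/(c i); congr (_ *: _); rewrite AE mulrC; congr (_ * _).
congr (_ * _).
have [n1 n1N h1] := loE i; have [n2 n2N h2] := hiE i.
move: rk; rewrite /cell /= in_itv /= => rk.
rewrite /active -(grid_cell_active tau_le h1 h2 rk) indicE.
by congr (nat_of_bool _)%:R; apply/idP/idP; rewrite inE /= in_itv.
Qed.

End elementary_integral.

Section hs_sqnorm_theory.
Context {R : realType} {H Xi : hilbertType R} (E : set Xi).
Implicit Types Q : Xi -> H.

Lemma hs_sqnorm_ge0 Q : (0 <= hs_sqnorm E Q)%E.
Proof. by apply: esum_ge0 => e _; rewrite lee_fin sqr_ge0. Qed.

Lemma le_hs_sqnorm Q Q' : (forall e, `|Q e| <= `|Q' e|) ->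
  (hs_sqnorm E Q <= hs_sqnorm E Q')%E.
Proof.
by move=> QQ'; apply: le_esum => e _; rewrite lee_fin lerXn2r// nnegrE.
Qed.

Lemma esum2l (a : Xi -> \bar R) : (forall e, 0 <= a e)%E ->
  (\esum_(e in E) (2%:E * a e) = 2%:E * \esum_(e in E) a e)%E.
Proof.
move=> a0; rewrite mule_natl mule2n -esumD//.
by apply: eq_esum => e _; rewrite mule_natl mule2n.
Qed.

Lemma hs_sqnormD Q Q' : (hs_sqnorm E (Q \+ Q')%R <=
  2%:E * hs_sqnorm E Q + 2%:E * hs_sqnorm E Q')%E.
Proof.
rewrite /hs_sqnorm -!esum2l; try by move=> e; rewrite lee_fin sqr_ge0.
rewrite -esumD; try by move=> e _; rewrite mule_ge0// lee_fin sqr_ge0.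
by apply: le_esum => e _; rewrite -!EFinM -EFinD lee_fin sqnormD_le.
Qed.

Lemma hs_sqnormB Q Q' : (hs_sqnorm E (Q \- Q')%R <=
  2%:E * hs_sqnorm E Q + 2%:E * hs_sqnorm E Q')%E.
Proof.
have -> : hs_sqnorm E Q' = hs_sqnorm E (\- Q')%R.
  by apply: eq_esum => e _ /=; rewrite normrN.
exact: hs_sqnormD.
Qed.

(** [hs_norm] goes through [fine] and reads 0 on an infinite sum, hence the finiteness
    hypothesis. *)
Lemma hs_sqnorm_le_sqr Q (c : R) : (hs_sqnorm E Q < +oo)%E -> 0 <= c ->
  hs_norm E Q <= c -> (hs_sqnorm E Q <= (c ^+ 2)%:E)%E.
Proof.
move=> Qfin c0 Qc; have Qf : hs_sqnorm E Q \is a fin_num.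
  by rewrite ge0_fin_numE// hs_sqnorm_ge0.
rewrite -(fineK Qf) lee_fin -[leLHS]sqr_sqrtr ?fine_ge0 ?hs_sqnorm_ge0//.
by rewrite lerXn2r// nnegrE// sqrtr_ge0.
Qed.

End hs_sqnorm_theory.

Section countable_basis.
Context {R : realType} {Xi : hilbertType R} (E : set Xi).
Hypothesis sepXi : separable_space Xi.
Hypothesis hE : orthonormal_basis E.

(** Distinct basis vectors are at distance [sqrt 2], so no two of them share a ball of radius [1/2]
    around a point of a dense sequence. *)
Lemma orthonormal_basis_countable : countable E.
Proof.
have [v Hv] := separable_dense_seq sepXi; have [E1 E0 _] := hE.
have h2 : 0 < 2^-1 :> R by rewrite invr_gt0.
have /choice[f Hf] : forall e, exists n, ball (v n) 2^-1 e by move=> e; exact: Hv.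
apply/countable_injP; exists f => e e'; rewrite !inE => Ee Ee' ff.
apply: contrapT => ee'.
have : `|e - e'| < 1.
  have := Hf e; have := Hf e'; rewrite -ff -!ball_normE /= => h1 h1'.
  have -> : e - e' = (v (f e) - e') - (v (f e) - e).
    by rewrite opprB [RHS]addrC addrA subrK.
  rewrite (le_lt_trans (ler_normB _ _))//.
  by have -> : (1 : R) = 2^-1 + 2^-1; [by field|exact: ltrD].
rewrite -(@ltr_sqr R) ?nnegrE// expr1n sqnormB (E1 _ Ee) (E1 _ Ee') E0//.
by rewrite mulr0 subr0 expr1n; lra.
Qed.

Lemma measurable_esum d (T : measurableType d) (D : set T) (f : Xi -> T -> \bar R) :
  (forall e z, D z -> E e -> 0 <= f e z)%E ->
  (forall e, E e -> measurable_fun D (f e)) ->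
  measurable_fun D (fun z => \esum_(e in E) f e z)%E.
Proof.
move=> f0 mf; have /countable_bijP[N] := orthonormal_basis_countable.
rewrite card_eq_sym => /card_set_bijP[g gbij].
have gE n : N n -> E (g n) by have [+ _ _] := gbij; exact.
apply: (eq_measurable_fun (fun z => \sum_(n <oo | n \in N) f (g n) z)%E).
  move=> z /set_mem Dz; rewrite (reindex_esum N E g)//.
  rewrite nneseries_esum; last by move=> n /set_mem Nn; apply: f0 => //; exact: gE.
  by congr esum; apply/seteqP; split => n /=; rewrite inE.
by apply: ge0_emeasurable_sum => [n z Dz /set_mem Nn|n /set_mem Nn];
  [apply: f0 => //; exact: gE|apply: mf; exact: gE].
Qed.

End countable_basis.

(** * Joint measurability in time and chance *)

Section time_space.
Context {R : realType} {d : measure_display} {Omega : measurableType d}.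
Variables (P : probability Omega R) (t s : R).
Local Open Scope ereal_scope.

Let TR := measurableTypeR R.
Let TO : measurableType _ := (TR * Omega)%type.

Definition strip : set (R * Omega) := [set z | (t <= z.1 <= s)%R].

Lemma measurable_strip : measurable strip.
Proof.
have -> : strip = `[t, s]%classic `*` setT.
  by apply/seteqP; split => z; rewrite /strip /= in_itv //= => -[].
by apply: measurableX => //; exact: measurable_itv.
Qed.

Variable f : R * Omega -> \bar R.
Hypothesis mf : measurable_fun strip f.
Hypothesis f0 : forall z, strip z -> 0 <= f z.

Let g : TO -> \bar R := f \_ strip.

Let mg : measurable_fun setT g.
Proof. exact/(measurable_restrictT _ measurable_strip). Qed.

Let g0 z : 0 <= g z.
Proof. by rewrite /g /patch; case: ifPn => // /set_mem; exact: f0. Qed.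

Let gE w : \int[lebesgue_measure]_(r in `[t, s]) f (r, w) =
  \int[lebesgue_measure]_r g (r, w).
Proof.
rewrite [LHS]integral_mkcond; apply: eq_integral => r _.
rewrite /g /patch; congr (if _ then _ else _).
Qed.

Lemma measurable_time_integral :
  measurable_fun setT (fun w => \int[lebesgue_measure]_(r in `[t, s]) f (r, w)).
Proof.
have -> : (fun w => \int[lebesgue_measure]_(r in `[t, s]) f (r, w)) =
    (fun w => \int[lebesgue_measure]_r g (r, w)) by apply/funext => w; exact: gE.
exact: (@measurable_fun_fubini_tonelli_G _ _ TR Omega R lebesgue_measure g mg g0).
Qed.

Lemma measurable_time_section w :
  measurable_fun (`[t, s]%classic : set R) (fun r => f (r, w)).
Proof.
apply: (@measurable_comp _ _ _ _ _ _ strip f) => //; first exact: measurable_strip.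
  by move=> z /= [r]; rewrite in_itv /= => rts <-.
by apply: measurable_funTS; exact: pair2_measurable.
Qed.

Lemma measurable_space_section r : (t <= r <= s)%R ->
  measurable_fun setT (fun w => f (r, w)).
Proof.
move=> rts; apply: (@measurable_comp _ _ _ _ _ _ strip f) => //.
  exact: measurable_strip.
by move=> _ [w _ <-].
Qed.

Lemma tonelli_time :
  \int[P]_w \int[lebesgue_measure]_(r in `[t, s]) f (r, w) =
  \int[lebesgue_measure]_(r in `[t, s]) \int[P]_w f (r, w).
Proof.
transitivity (\int[P]_w \int[lebesgue_measure]_r g (r, w)).
  by apply: eq_integral => w _; exact: gE.
rewrite -(@fubini_tonelli _ _ TR Omega R lebesgue_measure P g mg g0).
rewrite [RHS]integral_mkcond; apply: eq_integral => r _.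
rewrite /patch; case: ifPn => rts.
  by apply: eq_integral => w _; rewrite /g /patch ifT.
rewrite integral0_eq// => w _; rewrite /g /patch ifF//.
by apply/negbTE; move: rts; rewrite !notin_setE /strip /= in_itv.
Qed.

Lemma measurable_expectation :
  measurable_fun (`[t, s]%classic : set R) (fun r => \int[P]_w f (r, w)).
Proof.
apply: (@eq_measurable_fun _ _ _ _ _ (fun r => \int[P]_w g (r, w))).
  move=> r rts; apply: eq_integral => w _; rewrite /g /patch ifT//.
apply: measurable_funTS.
exact: (@measurable_fun_fubini_tonelli_F _ _ TR Omega R P g mg g0).
Qed.

End time_space.

Section measurable_sqnorm.
Context {R : realType} {H : hilbertType R} d (T : measurableType d) (D : set T).

Lemma measurable_inner (v : H) (f : T -> H) :
  (forall U, open U -> measurable (D `&` f @^-1` U)) ->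
  measurable_fun D (fun z => inner v (f z)).
Proof.
by move=> mf; apply: (measurable_fun_comp_continuous mf); exact: continuous_innerr.
Qed.

Lemma continuous_sqnorm : continuous (fun h : H => `|h| ^+ 2).
Proof.
move=> h; apply: (@continuous_comp _ _ _ (fun h : H => `|h|) (fun u : R => u ^+ 2)).
  exact: norm_continuous.
exact: exprn_continuous.
Qed.

(** Expanding the square leaves finitely many real inner products, which avoids measurability of
    sums in [H]. *)
Lemma measurable_sqnorm_sumB (I : Type) (r : seq I) (x : I -> T -> R) (v : I -> H)
    (f : T -> H) :
  (forall i, measurable_fun D (x i)) ->
  (forall U, open U -> measurable (D `&` f @^-1` U)) ->
  measurable_fun D (fun z => `|\sum_(i <- r) x i z *: v i - f z| ^+ 2).
Proof.
move=> mx mf.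
have -> : (fun z => `|\sum_(i <- r) x i z *: v i - f z| ^+ 2) =
   (fun z => \sum_(i <- r) \sum_(j <- r) x i z * x j z * inner (v i) (v j)
      - 2 * (\sum_(i <- r) x i z * inner (v i) (f z)) + `|f z| ^+ 2).
  apply/funext => z; rewrite sqnormB; congr (_ - _ + _).
    rewrite -inner_norm inner_suml; apply: eq_bigr => i _.
    rewrite inner_sumr; apply: eq_bigr => j _.
    by rewrite innerZl innerZr mulrA.
  by rewrite inner_suml; congr (_ * _); apply: eq_bigr => i _; rewrite innerZl.
apply: measurable_funD; last first.
  exact: (measurable_fun_comp_continuous mf continuous_sqnorm).
apply: measurable_funB.
  apply: measurable_sum => i; apply: measurable_sum => j.
  by apply: measurable_funM => //; exact: measurable_funM.
apply: measurable_funM => //; apply: measurable_sum => i.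
by apply: measurable_funM => //; exact: measurable_inner.
Qed.

Lemma continuous_sqnormB (v : H) : continuous (fun h : H => `|h - v| ^+ 2).
Proof.
move=> h; apply: (@continuous_comp _ _ _ (fun h : H => h - v) (fun h : H => `|h| ^+ 2)).
  by apply: cvgB; [exact: cvg_id|exact: cvg_cst].
exact: continuous_sqnorm.
Qed.

Lemma measurable_fun_subr (f f' : T -> H) (F : H -> R) : separable_space H ->
  (forall U, open U -> measurable (D `&` f @^-1` U)) ->
  (forall U, open U -> measurable (D `&` f' @^-1` U)) ->
  continuous F -> measurable_fun D (fun z => F (f z - f' z)).
Proof.
move=> sepH mf mf' cF.
apply: (@measurable_fun_pair_within R _ _ H H setT D f f' (fun u => F (u.1 - u.2))) => //.
apply: continuous_subspaceT => u.
apply: (@continuous_comp _ _ _ (fun u : H * H => u.1 - u.2) F); last exact: cF.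
by apply: cvgB; [exact: cvg_fst|exact: cvg_snd].
Qed.

End measurable_sqnorm.

Section progressive_measurability.
Context {R : realType} {H Xi : hilbertType R}.
Context {d : measure_display} {Omega : measurableType d}.
Variables (P : probability Omega R) (W : R -> Xi -> Omega -> R) (t T : R).
Hypothesis P_complete : measure_is_complete P.
Hypothesis hW : cylindrical_wiener P W t T.

(** Completeness of [P] puts the negligible sets of the filtration into the ambient sigma-algebra,
    so progressive processes are jointly measurable. *)
Lemma progressive_measurable (V : topologicalType) (s r : R)
    (f : R -> Omega -> V) :
  t <= r <= s -> r <= T -> progressive P W t s f ->
  forall U, open U ->
    measurable (strip t r `&` (fun z : R * Omega => f z.1 z.2) @^-1` U).
Proof.
move=> trs rT pf U oU.
have := pf r trs U oU; apply: smallest_sub; first exact: sigma_algebra_measurable.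
move=> _ [I mI [G FG <-]]; apply: measurableX => //.
exact: (measurable_wiener_filtration P_complete hW rT FG).
Qed.

Lemma measurable_sqnorm_elementaryB (s : R) (f : R * Omega -> H)
    (phi : seq (@elementary R H Xi d Omega P W t s)) (xi : Xi) : s <= T ->
  (forall U, open U -> measurable (strip t s `&` f @^-1` U)) ->
  measurable_fun (strip t s)
    (fun z : R * Omega => `|elementary_process phi z.1 z.2 xi - f z| ^+ 2).
Proof.
move=> sT mf.
apply: (measurable_sqnorm_sumB phi (x := fun c (z : R * Omega) =>
  (\1_(`]el_lo c, el_hi c]) z.1 : R) * (\1_(el_event c) z.2 : R)
      * inner (el_dir c) xi)) => // c.
apply: measurable_funTS; apply: measurable_funM => //; apply: measurable_funM.
  exact: (measurableT_comp (f := \1_(`]el_lo c, el_hi c]%classic : set R) : R -> R)).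
apply: (measurableT_comp (f := \1_(el_event c) : Omega -> R)) => //.
apply: measurable_indic; have [/andP[h1 h2] h3] := el_time c.
apply: (measurable_wiener_filtration P_complete hW (s := el_lo c)); last exact: el_adapted.
by rewrite (le_trans h2)// (le_trans h3).
Qed.

Lemma measurable_sqnorm_integralB (s : R) (J : Omega -> H)
    (phi : seq (@elementary R H Xi d Omega P W t s)) : s <= T ->
  (forall U, open U -> measurable (J @^-1` U)) ->
  measurable_fun setT (fun w => `|elementary_integral phi w - J w| ^+ 2).
Proof.
move=> sT mJ.
apply: (measurable_sqnorm_sumB phi (x := fun c w =>
  (\1_(el_event c) w : R) * (W (el_hi c) (el_dir c) w - W (el_lo c) (el_dir c) w))).
  move=> c; have [/andP[h1 h2] h3] := el_time c; apply: measurable_funM.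
    apply: measurable_indic.
    apply: (measurable_wiener_filtration P_complete hW (s := el_lo c)); last exact: el_adapted.
    by rewrite (le_trans h2)// (le_trans h3).
  apply: measurable_funB; apply: (wiener_meas hW).
    by rewrite (le_trans h1 h2) (le_trans h3).
  by rewrite h1 (le_trans h2)// (le_trans h3).
by move=> U oU; rewrite setTI; exact: mJ.
Qed.

End progressive_measurability.

(** * Comparison of stochastic and of Bochner integrals *)

Section truncation.
Context d (T : measurableType d) {R : realType} (mu : {measure set T -> \bar R}).

Lemma ge0_integral_le_truncated (f : T -> R) (b : \bar R) :
  measurable_fun setT f -> (forall x, 0 <= f x) ->
  (forall n : nat, (\int[mu]_x (Num.min (f x) n%:R)%:E <= b)%E) ->
  (\int[mu]_x (f x)%:E <= b)%E.
Proof.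
move=> mf f0 fb.
pose g (n : nat) x := (Num.min (f x) n%:R)%:E.
have -> : (\int[mu]_x (f x)%:E = \int[mu]_x limn (g ^~ x))%E.
  apply: eq_integral => x _; apply/esym/cvg_lim => //.
  apply: cvg_near_cst; exists (Num.truncn (f x)).+1 => // n /= fn.
  rewrite /g (min_idPl _)//.
  by rewrite (le_trans (ltW (truncnS_gt _)))// ler_nat.
rewrite monotone_convergence//.
- apply: lime_le; last exact: nearW.
  apply: ereal_nondecreasing_is_cvgn => m n mn.
  apply: ge0_le_integral_nonmeas => x _; first by rewrite lee_fin le_min f0/=.
  by rewrite lee_fin le_min ge_min lexx/= ge_min ler_nat mn orbT.
- by move=> n; apply/measurable_EFinP; apply: measurable_minr.
- by move=> n x _; rewrite lee_fin le_min f0/=.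
- move=> x _ m n mn; rewrite lee_fin le_min ge_min lexx/= ge_min.
  by rewrite ler_nat mn orbT.
Qed.

End truncation.

Lemma cvg0_le {R : realType} (u : nat -> \bar R) (e : R) : 0 < e -> (u n @[n --> \oo] --> 0%E) ->
  \forall n \near \oo, (u n <= e%:E)%E.
Proof.
move=> e0 u0; have : nbhs (0 : \bar R)%E [set y | (y < e%:E)%E].
  by apply: open_nbhs_nbhs; split; [exact: open_ereal_lt_ereal|rewrite /= lte_fin].
move=> h; have h' : \forall n \near \oo, (u n < e%:E)%E by exact: (u0 _ h).
by apply: filterS h' => n /ltW.
Qed.

Definition time_energy {R : realType} {Omega : Type} (t s : R)
    (k : R -> Omega -> R) (w : Omega) : \bar R :=
  (\int[lebesgue_measure]_(r in `[t, s]) (k r w ^+ 2)%:E)%E.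

Section stochastic_integral_estimate.
Context {R : realType} {H Xi : hilbertType R}.
Context {d : measure_display} {Omega : measurableType d}.
Variables (P : probability Omega R) (W : R -> Xi -> Omega -> R) (t T : R).
Hypothesis P_complete : measure_is_complete P.
Hypothesis hW : cylindrical_wiener P W t T.
Hypothesis sepH : separable_space H.
Hypothesis sepXi : separable_space Xi.
Variable E : set Xi.
Hypothesis hE : orthonormal_basis E.

Local Notation cN := (@normal_variance R).

Let opp_elementary (s : R) (e : @elementary R H Xi d Omega P W t s) :=
  @Elementary R H Xi d Omega P W t s (el_lo e) (el_hi e) (el_time e) (el_event e)
    (@el_adapted _ _ _ _ _ _ _ _ _ e) (el_dir e) (- el_val e).

Let elementary_processB s (phi phi' : seq (@elementary R H Xi d Omega P W t s)) r w xi :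
  elementary_process (phi ++ map (@opp_elementary s) phi') r w xi =
  elementary_process phi r w xi - elementary_process phi' r w xi.
Proof.
rewrite /elementary_process big_cat big_map /= -sumrN; congr (_ + _).
by apply: eq_bigr => c _; rewrite scalerN.
Qed.

Let elementary_integralB s (phi phi' : seq (@elementary R H Xi d Omega P W t s)) w :
  elementary_integral (phi ++ map (@opp_elementary s) phi') w =
  elementary_integral phi w - elementary_integral phi' w.
Proof.
rewrite /elementary_integral big_cat big_map /= -sumrN; congr (_ + _).
by apply: eq_bigr => c _; rewrite scalerN.
Qed.

(* On the event where both elementary approximations are [eps]-close the
   truncated isometry of their difference applies; the complement has small
   probability and is harmless once the integrand is cut off at a level [N0]. *)
Lemma stochastic_integral_estimate (s : R) (Phi Phi' : R -> Omega -> Xi -> H)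
    (J J' : Omega -> H) (k : R -> Omega -> R) (c : R) :
  t <= s <= T ->
  is_stochastic_integral P W E t s Phi J ->
  is_stochastic_integral P W E t s Phi' J' ->
  measurable_fun (strip t s) (fun z : R * Omega => k z.1 z.2) ->
  (forall r w, t <= r <= s ->
    (hs_sqnorm E (Phi r w \- Phi' r w)%R <= (k r w ^+ 2)%:E)%E) ->
  0 <= c ->
  (\int[P]_w (\1_[set w | (time_energy t s k w < c%:E)%E] w * `|J w - J' w| ^+ 2)%:E <=
   (4 * cN)%:E * \int[P]_w mine (time_energy t s k w) c%:E)%E.
Proof.
move=> /andP[ts sT] [pPhi _ mJ [phi [dphi Iphi]]] [pPhi' _ mJ' [phi' [dphi' Iphi']]].
move=> mk hsk c0; set K := time_energy t s k.
have tsT : t <= s <= T by rewrite ts.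
have tss : t <= s <= s by rewrite ts lexx.
pose chi n := phi n ++ map (@opp_elementary s) (phi' n).
pose hs (ph : nat -> seq (@elementary R H Xi d Omega P W t s)) F n (z : R * Omega) :=
  hs_sqnorm E (elementary_process (ph n) z.1 z.2 \- F z.1 z.2)%R.
pose dl ph F n w := (\int[lebesgue_measure]_(r in `[t, s]) hs ph F n (r, w))%E.
have mhs ph F n : (forall xi, progressive P W t s (fun r w => F r w xi)) ->
    measurable_fun (strip t s) (hs ph F n).
  move=> pF; apply: (measurable_esum sepXi hE) => [e z _ _|e _].
    by rewrite lee_fin sqr_ge0.
  apply/measurable_EFinP.
  apply: (measurable_sqnorm_elementaryB P_complete hW (f := fun z => F z.1 z.2 e)) => //.
  exact: (progressive_measurable P_complete hW tss sT (pF e)).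
have hs0 ph F n z : (0 <= hs ph F n z)%E by exact: hs_sqnorm_ge0.
have mdl ph F n : (forall xi, progressive P W t s (fun r w => F r w xi)) ->
    measurable_fun setT (dl ph F n).
  by move=> pF; apply: measurable_time_integral => //; exact: mhs.
have mk2 : measurable_fun (strip t s) (fun z : R * Omega => (k z.1 z.2 ^+ 2)%:E).
  by apply/measurable_EFinP; exact: measurable_funX.
have mK : measurable_fun setT K.
  apply: (measurable_time_integral mk2) => z _.
  by rewrite lee_fin sqr_ge0.
have K0 w : (0 <= K w)%E by apply: integral_ge0 => r _; rewrite lee_fin sqr_ge0.
have /choice[Q HQ] := fun n => elementary_integral_truncated P_complete hW hE (chi n) tsT.
(* The integrand of [chi n] splits into [Phi - Phi'] and two approximation errors; [2] and [4] come
   from using [|a + b|^2 <= 2 |a|^2 + 2 |b|^2] once and twice. *)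
have QK n w : ((Q n w)%:E <= 2%:E * K w + (4%:E * dl phi Phi n w + 4%:E * dl phi' Phi' n w))%E.
  have [_ _ + _ _] := HQ n => /(_ w) /le_trans; apply.
  pose up r := (2%:E * (k r w ^+ 2)%:E +
     (4%:E * hs phi Phi n (r, w) + 4%:E * hs phi' Phi' n (r, w)))%E.
  apply: (@le_trans _ _ (\int[lebesgue_measure]_(r in `[t, s]) up r)%E).
    apply: ge0_le_integral_nonmeas => [r _|r]; first exact: hs_sqnorm_ge0.
    rewrite /= in_itv /= => rts.
    have -> : hs_sqnorm E (elementary_process (chi n) r w) =
        hs_sqnorm E ((Phi r w \- Phi' r w) \+ ((elementary_process (phi n) r w \- Phi r w) \-
          (elementary_process (phi' n) r w \- Phi' r w)))%R.
      congr (hs_sqnorm E _); apply/funext => xi; rewrite /chi elementary_processB /=.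
      by rewrite opprB addrCA [X in _ = _ + X]addrA subrK addrA subrK.
    apply: le_trans (hs_sqnormD _ _ _) _; apply: leeD.
      by rewrite lee_wpmul2l ?lee_fin// hsk.
    apply: (@le_trans _ _ (2%:E * (2%:E * hs phi Phi n (r, w) + 2%:E * hs phi' Phi' n (r, w)))%E).
      by rewrite lee_wpmul2l ?lee_fin//; exact: hs_sqnormB.
    rewrite ge0_muleDr ?mule_ge0 ?lee_fin// !muleA -!EFinM.
    by have -> : 2 * 2 = 4 :> R by ring.
  have mS f : measurable_fun (strip t s) f ->
     measurable_fun (`[t, s]%classic : set R) (fun r => f (r, w) : \bar R).
    by move=> mf; exact: measurable_time_section.
  have m1 := mS _ mk2.
  have m2 := mS _ (mhs phi Phi n pPhi).
  have m3 := mS _ (mhs phi' Phi' n pPhi').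
  rewrite /up ge0_integralD//=; first last.
  - by apply: emeasurable_funD; exact: measurable_funeM.
  - by move=> r _; rewrite adde_ge0// mule_ge0.
  - exact: measurable_funeM.
  - by move=> r _; rewrite mule_ge0// lee_fin sqr_ge0.
  rewrite ge0_integralZl//=; last by move=> r _; rewrite lee_fin sqr_ge0.
  rewrite ge0_integralD//=; first last.
  - exact: measurable_funeM.
  - by move=> r _; rewrite mule_ge0.
  - exact: measurable_funeM.
  - by move=> r _; rewrite mule_ge0.
  by rewrite !ge0_integralZl.
have mJJ : measurable_fun setT (fun w => `|J w - J' w| ^+ 2).
  apply: (measurable_fun_subr (F := fun h => `|h| ^+ 2) sepH) => [U oU|U oU|].
  - by rewrite setTI; exact: mJ.
  - by rewrite setTI; exact: mJ'.
  - exact: continuous_sqnorm.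
have mKc : measurable [set w | (K w < c%:E)%E].
  by rewrite -[X in measurable X]setTI; exact: emeasurable_fun_infty_o.
apply: ge0_integral_le_truncated => [|w|N0].
- by apply: measurable_funM => //; exact: measurable_indic.
- by rewrite mulr_ge0// sqr_ge0.
set h := (\int[P]_w mine (K w) c%:E)%E.
have h0 : (0 <= h)%E by apply: integral_ge0 => w _; rewrite le_min K0 lee_fin.
have hc : (h <= c%:E)%E.
  apply: (@le_trans _ _ (\int[P]_w (cst c%:E) w)%E).
    by apply: ge0_le_integral_nonmeas => w _; rewrite ?ge_min ?lexx ?orbT// le_min K0 lee_fin.
  by rewrite [leLHS]integral_cst//= probability_setT mule1.
have hfin : h \is a fin_num by rewrite ge0_fin_numE// (le_lt_trans hc)// ltry.
have cN0 := @normal_variance_ge0 R.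
apply/lee_addgt0Pr => th th0.
(* The final bound will be [M * P bad + 8 eps^2 + 16 cN eps + 4 cN h]: the two terms with [eps] get
   one half of [th], the term with [P bad] the other. *)
pose eps := Num.min 1 (th / (2 * (8 + 16 * cN))).
have den0 : 0 < 2 * (8 + 16 * cN) by lra.
have eps0 : 0 < eps by rewrite lt_min ltr01 divr_gt0.
have eps1 : eps <= 1 by rewrite ge_min lexx.
have epsth : (8 + 16 * cN) * eps <= th / 2.
  have : eps <= th / (2 * (8 + 16 * cN)) by rewrite ge_min lexx orbT.
  rewrite ler_pdivlMr// => ?; lra.
(* Outside the bad event, [K < c] forces [Q <= c1], by [QK] with both errors below [eps]. *)
pose c1 := 2 * c + 8 * eps.
have c10 : 0 <= c1 by rewrite /c1; lra.
pose M := N0%:R + 2 * cN * c1.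
have M0 : 0 <= M by rewrite addr_ge0// mulr_ge0// mulr_ge0.
(* [M] depends on [eps] through [c1], so the probability allowed to the bad event is fixed last. *)
pose eta := th / (2 * (M + 1)).
have eta0 : 0 < eta by rewrite divr_gt0// mulr_gt0// ltr_wpDl.
have etaM : M * eta <= th / 2.
  rewrite /eta mulrA ler_pdivrMr; last by lra.
  by nra.
have eta4 : 0 < eta / 4 by rewrite divr_gt0.
have [n [n1 n2 n3 n4]] : exists n, [/\ P [set w | (eps%:E <= dl phi Phi n w)%E] <= (eta / 4)%:E,
    P [set w | (eps%:E <= dl phi' Phi' n w)%E] <= (eta / 4)%:E,
    P [set w | (eps%:E <= (`|elementary_integral (phi n) w - J w|)%:E)%E] <= (eta / 4)%:E &
    P [set w | (eps%:E <= (`|elementary_integral (phi' n) w - J' w|)%:E)%E] <= (eta / 4)%:E]%E.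
  have a1 := cvg0_le eta4 (dphi eps eps0); have a2 := cvg0_le eta4 (dphi' eps eps0).
  have a3 := cvg0_le eta4 (Iphi eps eps0); have a4 := cvg0_le eta4 (Iphi' eps eps0).
  have [n [[? ?] [? ?]]] := filter_ex (filterI (filterI a1 a2) (filterI a3 a4)).
  by exists n.
pose b1 := [set w | (eps%:E <= dl phi Phi n w)%E].
pose b2 := [set w | (eps%:E <= dl phi' Phi' n w)%E].
pose b3 := [set w | (eps%:E <= (`|elementary_integral (phi n) w - J w|)%:E)%E].
pose b4 := [set w | (eps%:E <= (`|elementary_integral (phi' n) w - J' w|)%:E)%E].
have mb1 : measurable b1.
  by rewrite -[X in measurable X]setTI; apply: emeasurable_fun_c_infty => //; exact: mdl.
have mb2 : measurable b2.
  by rewrite -[X in measurable X]setTI; apply: emeasurable_fun_c_infty => //; exact: mdl.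
have mb ph F : (forall U, open U -> measurable (F @^-1` U)) ->
    measurable [set w | (eps%:E <= (`|@elementary_integral R H Xi d Omega P W t s ph w - F w|)%:E)%E].
  move=> mF.
  have := measurable_sqnorm_integralB P_complete hW ph sT mF.
  move=> /(_ measurableT _ (measurable_itv `[eps ^+ 2, +oo[)); rewrite setTI.
  congr (measurable _); apply/seteqP; split => w /=; rewrite in_itv /= andbT lee_fin.
    by rewrite ler_sqr ?nnegrE// ltW.
  by rewrite ler_sqr ?nnegrE// ltW.
have mb3 : measurable b3 by exact: mb.
have mb4 : measurable b4 by exact: mb.
pose bad := b1 `|` b2 `|` (b3 `|` b4).
have mbad : measurable bad by do !apply: measurableU.
have Pbad : (P bad <= eta%:E)%E.
  have -> : eta%:E = ((eta / 4)%:E + (eta / 4)%:E + ((eta / 4)%:E + (eta / 4)%:E))%E.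
    by rewrite -!EFinD; congr EFin; field.
  apply: (@le_trans _ _ (P (b1 `|` b2) + P (b3 `|` b4))%E).
    by apply: measureU2; exact: measurableU.
  by apply: leeD; [apply: (@le_trans _ _ (P b1 + P b2)%E)|apply: (@le_trans _ _ (P b3 + P b4)%E)];
    [exact: measureU2|exact: leeD|exact: measureU2|exact: leeD].
have [mQ Q0 _ mI ineq] := HQ n.
pose I w := `|elementary_integral (chi n) w| ^+ 2.
have notbad w : w \notin bad -> [/\ (dl phi Phi n w < eps%:E)%E, (dl phi' Phi' n w < eps%:E)%E,
   `|elementary_integral (phi n) w - J w| < eps &
   `|elementary_integral (phi' n) w - J' w| < eps].
  rewrite notin_setE => nb; split; rewrite ltNge; apply/negP => h1; apply: nb.
  - by left; left.
  - by left; right.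
  - by right; left; rewrite /b3 /= lee_fin.
  - by right; right; rewrite /b4 /= lee_fin.
have Q_le w : w \notin bad -> ((Q n w)%:E <= 2%:E * K w + (8 * eps)%:E)%E.
  move=> /notbad[h1 h2 _ _]; apply: le_trans (QK n w) _; rewrite leeD2l//.
  have -> : (8 * eps)%:E = (4%:E * eps%:E + 4%:E * eps%:E)%E.
    by rewrite -!EFinM -EFinD; congr EFin; ring.
  by apply: leeD; rewrite lee_wpmul2l ?lee_fin// ltW.
have cl1 w : Num.min (\1_[set w | (K w < c%:E)%E] w * `|J w - J' w| ^+ 2) N0%:R <=
    N0%:R * \1_bad w + (8 * eps ^+ 2 + 2 * (\1_[set w | Q n w <= c1] w * I w)).
  have I0 : 0 <= \1_[set w | Q n w <= c1] w * I w by rewrite mulr_ge0// sqr_ge0.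
  have e20 : 0 <= 8 * eps ^+ 2 by rewrite mulr_ge0// sqr_ge0.
  rewrite (indicE _ bad); case: (boolP (w \in bad)) => [wb|wb].
    by rewrite mulr1 ge_min lerDl orbC addr_ge0// mulr_ge0.
  rewrite mulr0 add0r ge_min; apply/orP; left.
  rewrite indicE; case: (boolP (w \in _)) => [|_]; last by rewrite mul0r addr_ge0// mulr_ge0.
  rewrite inE /= mul1r => Kc.
  have Qc1 : Q n w <= c1.
    rewrite -lee_fin (le_trans (Q_le w wb))//.
    have -> : c1%:E = (2%:E * c%:E + (8 * eps)%:E)%E by rewrite -EFinM -EFinD.
    by apply: leeD => //; rewrite lee_wpmul2l ?lee_fin// ltW.
  rewrite indicE mem_set// mul1r.
  have [_ _ h3 h4] := notbad w wb.
  have -> : J w - J' w = elementary_integral (chi n) w +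
     ((elementary_integral (phi' n) w - J' w) - (elementary_integral (phi n) w - J w)).
    rewrite /chi elementary_integralB.
    have aux (x y u v : H) : x - y = u - v + (v - y - (u - x)).
      by rewrite opprB [RHS]addrA [u - v + _]addrA subrK [RHS]addrC addrA subrK.
    exact: aux.
  rewrite (le_trans (sqnormD_le _ _))// addrC lerD2r.
  have : `|(elementary_integral (phi' n) w - J' w) - (elementary_integral (phi n) w - J w)| <= 2 * eps.
    rewrite (le_trans (ler_normB _ _))//; lra.
  rewrite -(@ler_sqr R) ?nnegrE//; last by lra.
  by rewrite exprMn; lra.
have cl2 w : ((Num.min (Q n w) c1)%:E <=
    (c1 * \1_bad w)%:E + (2%:E * mine (K w) c%:E + (8 * eps)%:E))%E.
  have m0 : (0 <= 2%:E * mine (K w) c%:E + (8 * eps)%:E)%E.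
    by rewrite adde_ge0 ?mule_ge0 ?lee_fin ?le_min ?K0 ?lee_fin//; lra.
  rewrite indicE; case: (boolP (w \in bad)) => [wb|wb].
    by rewrite mulr1 -[leLHS]adde0 leeD// lee_fin ge_min lexx orbT.
  rewrite mulr0 add0e; have [Kc|cK] := leP (K w) c%:E.
    rewrite (le_trans _ (Q_le w wb))// lee_fin.
    by rewrite ge_min lexx.
  by rewrite -EFinM -EFinD lee_fin ge_min lexx orbT.
have mmin : measurable_fun setT (fun w => mine (K w) c%:E) by exact: measurable_mine.
have mindbad : measurable_fun setT (\1_bad : Omega -> R) by exact: measurable_indic.
have E1bad : (\int[P]_w (\1_bad w)%:E = P bad)%E by rewrite integral_indic// setIT.
have mQc : measurable [set w | Q n w <= c1].
  have := mQ measurableT _ (measurable_itv `]-oo, c1]); rewrite setTI.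
  by congr (measurable _); apply/seteqP; split => w /=; rewrite in_itv.
have mQI : measurable_fun setT (fun w => \1_[set w | Q n w <= c1] w * I w).
  by apply: measurable_funM => //; exact: measurable_indic.
have st2 : (\int[P]_w (Num.min (Q n w) c1)%:E <= c1%:E * P bad + (2%:E * h + (8 * eps)%:E))%E.
  apply: (@le_trans _ _ (\int[P]_w ((c1 * \1_bad w)%:E + (2%:E * mine (K w) c%:E + (8 * eps)%:E)))%E).
    by apply: ge0_le_integral_nonmeas => w _; [rewrite lee_fin le_min Q0|exact: cl2].
  have mK0 w : (0 <= mine (K w) c%:E)%E by rewrite le_min K0 lee_fin.
  have e80 : 0 <= 8 * eps by lra.
  rewrite ge0_integralD//=; first last.
  - by apply: emeasurable_funD => //; exact: measurable_funeM.
  - by move=> w _; rewrite adde_ge0// mule_ge0.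
  - by apply/measurable_EFinP; exact: measurable_funM.
  - by move=> w _; rewrite lee_fin mulr_ge0.
  under eq_integral do rewrite EFinM.
  rewrite ge0_integralZl//=; last exact/measurable_EFinP.
  rewrite E1bad leeD2l// ge0_integralD//=; first last.
  - exact: measurable_funeM.
  - by move=> w _; rewrite mule_ge0.
  rewrite ge0_integralZl//= leeD2l// integral_cst//.
  by rewrite [X in (_ * X)%E](@probability_setT _ _ _ P) mule1.
apply: (@le_trans _ _ (N0%:R%:E * P bad + ((8 * eps ^+ 2)%:E +
    2%:E * (cN%:E * (c1%:E * P bad + (2%:E * h + (8 * eps)%:E)))))%E).
  apply: (@le_trans _ _ (\int[P]_w ((N0%:R * \1_bad w)%:E + ((8 * eps ^+ 2)%:E +
      2%:E * (\1_[set w | Q n w <= c1] w * I w)%:E)))%E).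
    apply: ge0_le_integral_nonmeas => w _.
      by rewrite lee_fin le_min ler0n andbT mulr_ge0// sqr_ge0.
    by rewrite -EFinM -!EFinD lee_fin cl1.
  have QI0 w : (0 <= (\1_[set w | Q n w <= c1] w * I w)%:E)%E.
    by rewrite lee_fin mulr_ge0// sqr_ge0.
  rewrite ge0_integralD//=; first last.
  - by apply: emeasurable_funD => //; apply: measurable_funeM; exact/measurable_EFinP.
  - by move=> w _; rewrite adde_ge0 ?mule_ge0// lee_fin mulr_ge0// sqr_ge0.
  - by apply/measurable_EFinP; exact: measurable_funM.
  under eq_integral do rewrite EFinM.
  rewrite ge0_integralZl//=; last exact/measurable_EFinP.
  rewrite E1bad leeD2l// ge0_integralD//=; first last.
  - by apply: measurable_funeM; exact/measurable_EFinP.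
  - by move=> w _; rewrite mule_ge0.
  - by move=> w _; rewrite lee_fin mulr_ge0// sqr_ge0.
  rewrite integral_cst// [X in (_ * X + _)%E](@probability_setT _ _ _ P) mule1 leeD2l//.
  rewrite ge0_integralZl//=; last exact/measurable_EFinP.
  rewrite lee_wpmul2l ?lee_fin//; apply: le_trans (ineq c1 c10) _.
  by rewrite lee_wpmul2l ?lee_fin.
have Pfin : P bad \is a fin_num by exact: fin_num_measure.
rewrite -(fineK Pfin) -(fineK hfin) -!EFinM -!EFinD lee_fin.
have p0 : 0 <= fine (P bad) by rewrite fine_ge0.
have pe : fine (P bad) <= eta by rewrite -lee_fin fineK.
have Mp : M * fine (P bad) <= th / 2 by rewrite (le_trans _ etaM)// ler_wpM2l.
have eps2 : eps ^+ 2 <= eps by rewrite expr2 ler_piMl// ltW.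
rewrite /M in Mp; move: (fine (P bad)) (fine h) Mp => p hh Mp.
nra.
Qed.

End stochastic_integral_estimate.

(** * Norm estimates for Bochner integrals *)

Section bochner_estimate.
Context {R : realType} {H : hilbertType R}.
Local Notation mu := (@lebesgue_measure R).

Lemma measurable_norm_sumB d (T : measurableType d) (D : set T) (I : Type)
    (r : seq I) (x : I -> T -> R) (v : I -> H) (f : T -> H) :
  (forall i, measurable_fun D (x i)) ->
  (forall U, open U -> measurable (D `&` f @^-1` U)) ->
  measurable_fun D (fun z => `|\sum_(i <- r) x i z *: v i - f z|).
Proof.
move=> mx mf; have -> : (fun z => `|\sum_(i <- r) x i z *: v i - f z|) =
    Num.sqrt \o (fun z => `|\sum_(i <- r) x i z *: v i - f z| ^+ 2).
  by apply/funext => z /=; rewrite sqrtr_sqr normr_id.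
apply: measurableT_comp; last exact: measurable_sqnorm_sumB.
by apply: continuous_measurable_fun; exact: sqrt_continuous.
Qed.

Variable D : set R.
Hypothesis mD : measurable D.
Hypothesis D_fin : (mu D < +oo)%E.

Lemma step_integral_inner (phi : seq (@step R H)) (u : H) :
  mu.-integrable D (EFin \o (fun r => inner u (step_fun phi r))) /\
  (\int[mu]_(r in D) (inner u (step_fun phi r))%:E =
     (inner u (step_integral D phi))%:E)%E.
Proof.
elim: phi => [|c phi [ih1 ih2]].
  rewrite (_ : (fun r => _) = cst 0); last first.
    by apply/funext => r; rewrite /step_fun big_nil inner0r.
  split; first exact: integrable0.
  by rewrite /step_integral big_nil inner0r integral0_eq// => r _;
    rewrite /step_fun big_nil inner0r.
have mA := step_meas c.
have AD : (mu (step_set c `&` D) < +oo)%E.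
  by rewrite (le_lt_trans _ D_fin)//; apply: le_measure; rewrite ?inE//; exact: measurableI.
have iA : mu.-integrable D (EFin \o (\1_(step_set c) : R -> R)).
  apply/integrableP; split.
    by apply/measurable_EFinP; apply: measurable_indic.
  apply: le_lt_trans AD; rewrite -integral_indic//.
  by apply: ge0_le_integral_nonmeas => r _ //=; rewrite ger0_norm.
have iAc : mu.-integrable D (fun r => (\1_(step_set c) r : R)%:E * (inner u (step_val c))%:E)%E.
  exact: integrableZr.
have eqf r : (inner u (step_fun (c :: phi) r))%:E =
   ((\1_(step_set c) r : R)%:E * (inner u (step_val c))%:E + (inner u (step_fun phi r))%:E)%E.
  by rewrite /step_fun big_cons innerDr innerZr.
split.
  rewrite (_ : _ \o _ = (fun r => (\1_(step_set c) r : R)%:E * (inner u (step_val c))%:E) \+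
     (EFin \o (fun r => inner u (step_fun phi r))))%E; last by apply/funext => r; exact: eqf.
  exact: integrableD.
under eq_integral do rewrite eqf.
rewrite integralD// integralZr// ih2 integral_indic//.
rewrite /step_integral big_cons innerDr innerZr EFinD EFinM; congr (_ * _ + _)%E.
by rewrite fineK// ge0_fin_numE.
Qed.

(** The sets of a step function may overlap, so a termwise triangle inequality is too weak. Pairing
    with the integral [u] itself gives [|u|^2 <= |u| * \int |phi|] without a disjoint refinement. *)
Lemma norm_step_integral_le (phi : seq (@step R H)) :
  ((`|step_integral D phi|)%:E <= \int[mu]_(r in D) (`|step_fun phi r|)%:E)%E.
Proof.
set u := step_integral D phi; have [u0|u0] := eqVneq u 0.
  by rewrite u0 normr0; apply: integral_ge0 => r _; rewrite lee_fin.
have up : 0 < `|u| by rewrite normr_gt0.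
have mphi : measurable_fun D (fun r => `|step_fun phi r|).
  rewrite (_ : (fun r => _) = (fun r => `|step_fun phi r - 0|)); last first.
    by apply/funext => r; rewrite subr0.
  apply: (@measurable_norm_sumB _ _ _ _ _ (fun c r => \1_(step_set c) r) (@step_val R H)).
    by move=> c; apply: measurable_indic; exact: step_meas.
  by move=> U _; rewrite preimage_cst; case: ifPn => _; rewrite ?setIT ?setI0.
have [iu eu] := step_integral_inner phi u.
have : (`|u|%:E * `|u|%:E <= `|u|%:E * \int[mu]_(r in D) (`|step_fun phi r|)%:E)%E.
  rewrite -EFinM -expr2 -inner_norm -/u.
  rewrite -[X in (X <= _)%E]gee0_abs; last by rewrite lee_fin inner_norm sqr_ge0.
  rewrite -{2}[u]/(step_integral D phi) -eu.
  have := le_abse_integral mu mD (measurable_int _ iu); move/le_trans; apply.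
  rewrite -ge0_integralZl//; last exact/measurable_EFinP.
  apply: ge0_le_integral_nonmeas => r _ //.
  by rewrite /= lee_fin cauchy_schwarz.
by rewrite lee_pmul2l// ?lte_fin.
Qed.

Let opp_step (c : @step R H) := Step (step_meas c) (- step_val c).

Let step_funB (phi phi' : seq (@step R H)) r :
  step_fun (phi ++ map opp_step phi') r = step_fun phi r - step_fun phi' r.
Proof.
rewrite /step_fun big_cat big_map /= -sumrN; congr (_ + _).
by apply: eq_bigr => c _; rewrite scalerN.
Qed.

Let step_integralB (phi phi' : seq (@step R H)) :
  step_integral D (phi ++ map opp_step phi') =
  step_integral D phi - step_integral D phi'.
Proof.
rewrite /step_integral big_cat big_map /= -sumrN; congr (_ + _).
by apply: eq_bigr => c _; rewrite scalerN.
Qed.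

Lemma bochner_integral_estimate (f f' : R -> H) (y y' : H) (k : R -> R) :
  is_bochner_integral D f y -> is_bochner_integral D f' y' ->
  measurable_fun D k -> (forall r, D r -> `|f r - f' r| <= k r) ->
  ((`|y - y'|)%:E <= \int[mu]_(r in D) (k r)%:E)%E.
Proof.
move=> [mf [phi [dphi Iphi]]] [mf' [phi' [dphi' Iphi']]] mk hk.
have k0 r : D r -> 0 <= k r by move=> /hk; exact: le_trans.
have mB (ph : seq (@step R H)) (g : R -> H) : (forall U, open U -> measurable (D `&` g @^-1` U)) ->
    measurable_fun D (fun r => (`|step_fun ph r - g r|)%:E).
  move=> mg; apply/measurable_EFinP.
  apply: (@measurable_norm_sumB _ _ _ _ _ (fun c r => \1_(step_set c) r) (@step_val R H)) => //.
  by move=> c; apply: measurable_indic; exact: step_meas.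
apply/lee_addgt0Pr => th th0.
have e0 : 0 < th / 4 by rewrite divr_gt0.
have I1 : \forall n \near \oo, `|y - step_integral D (phi n)| <= th / 4.
  by move/cvgrPdist_le : Iphi; apply.
have I2 : \forall n \near \oo, `|y' - step_integral D (phi' n)| <= th / 4.
  by move/cvgrPdist_le : Iphi'; apply.
have [n [[n1 n2] [n3 n4]]] := filter_ex (filterI
  (filterI (cvg0_le e0 dphi) (cvg0_le e0 dphi'))
  (filterI I1 I2)).
pose chi := phi n ++ map opp_step (phi' n).
have chi_le : ((`|step_integral D chi|)%:E <=
    \int[mu]_(r in D) (k r)%:E + ((th / 4)%:E + (th / 4)%:E))%E.
  apply: le_trans (norm_step_integral_le _) _.
  apply: (@le_trans _ _ (\int[mu]_(r in D) ((k r)%:E +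
      ((`|step_fun (phi n) r - f r|)%:E + (`|step_fun (phi' n) r - f' r|)%:E)))%E).
    apply: ge0_le_integral_nonmeas => r Dr; rewrite -?EFinD lee_fin//.
    have -> : step_fun chi r = (f r - f' r) +
        ((step_fun (phi n) r - f r) - (step_fun (phi' n) r - f' r)).
      rewrite step_funB opprB addrCA [X in _ = _ + X]addrA subrK addrA subrK//.
    by rewrite (le_trans (ler_normD _ _))// lerD ?hk// ler_normB.
  rewrite ge0_integralD//; first last.
  - by apply: emeasurable_funD; exact: mB.
  - by move=> r _; rewrite adde_ge0.
  - exact/measurable_EFinP.
  rewrite leeD2l// ge0_integralD//; [exact: leeD|exact: mB|exact: mB].
have -> : y - y' = step_integral D chi +
    ((y - step_integral D (phi n)) - (y' - step_integral D (phi' n))).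
  rewrite step_integralB opprB addrCA [X in _ = _ + X]addrA subrK addrA subrK//.
apply: (@le_trans _ _ ((`|step_integral D chi|)%:E + ((th / 4)%:E + (th / 4)%:E))%E).
  rewrite -!EFinD lee_fin (le_trans (ler_normD _ _))// lerD2l.
  by rewrite (le_trans (ler_normB _ _))// lerD.
apply: (@le_trans _ _ (\int[mu]_(r in D) (k r)%:E + ((th / 4)%:E + (th / 4)%:E) + ((th / 4)%:E + (th / 4)%:E))%E).
  exact: leeD.
rewrite -addeA leeD2l// -!EFinD lee_fin; lra.
Qed.

End bochner_estimate.

(** * Energy estimate *)

Section real_integrals.
Context {R : realType}.
Local Notation mu := (@lebesgue_measure R).

Lemma integral_expR_le (t s lam : R) : t <= s -> 0 < lam ->
  (\int[mu]_(r in `[t, s]) (expR (lam * (r - t)))%:E <=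
     (expR (lam * (s - t)) / lam)%:E)%E.
Proof.
move=> ts lam0; have [<-|neq] := eqVneq t s.
  by rewrite set_itv1 integral_set1 lee_fin divr_ge0// ?expR_ge0// ltW.
have {neq ts}ts : t < s by rewrite lt_neqAle neq.
pose F r := lam^-1 * expR (lam * (r - t)).
have dF (r : R) : is_derive r 1 F (expR (lam * (r - t))).
  apply: is_derive_eq.
  rewrite /GRing.scale /=; field; exact: lt0r_neq0.
have cF : continuous F by move=> r; apply/differentiable_continuous/derivable1_diffP; case: (dF r).
rewrite (@continuous_FTC2 _ _ F)//.
- have F0 : 0 <= F t by rewrite mulr_ge0 ?expR_ge0// invr_ge0 ltW.
  by rewrite -EFinB lee_fin [leRHS]mulrC -/(F s) lerBlDr lerDl.
- apply: continuous_subspaceT => r.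
  apply: (@continuous_comp _ _ _ (fun r => lam * (r - t)) expR); last exact: continuous_expR.
  by apply: cvgM; [exact: cvg_cst|apply: cvgB; [exact: cvg_id|exact: cvg_cst]].
- split; [by move=> r _; case: (dF r)| |].
  + exact: cvg_at_right_filter (cF t).
  + exact: cvg_at_left_filter (cF s).
- by move=> r _; rewrite derive1E; apply: derive_val.
Qed.

(* AM-GM: [2 k <= th e + k^2 / (th e)] with [e = exp (lam (r - t))], then [th] is optimized. *)
Lemma weighted_cauchy_schwarz (t s lam y : R) (k : R -> R) :
  t <= s -> 1 <= lam -> measurable_fun `[t, s] k ->
  (forall r, t <= r <= s -> 0 <= k r) -> 0 <= y ->
  (y%:E <= \int[mu]_(r in `[t, s]) (k r)%:E)%E ->
  ((y ^+ 2)%:E <= (expR (lam * (s - t)))%:E *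
     \int[mu]_(r in `[t, s]) (expR (lam * (t - r)) * k r ^+ 2)%:E)%E.
Proof.
move=> ts lam1 mk k0 y0 yk; have lam0 : 0 < lam by lra.
set K := (X in (_ * X)%E).
have K0 : (0 <= K)%E.
  by apply: integral_ge0 => r _; rewrite lee_fin mulr_ge0 ?sqr_ge0// expR_ge0.
have [->|yn0] := eqVneq y 0; first by rewrite expr0n/= mule_ge0// lee_fin expR_ge0.
have {yn0}yp : 0 < y by rewrite lt_neqAle eq_sym yn0.
have [Koo|Kfin] := eqVneq K +oo%E.
  by rewrite Koo gt0_muley ?leey// lte_fin expR_gt0.
have {}Kfin : K \is a fin_num by rewrite ge0_fin_numE// lt_neqAle Kfin leey.
set e := expR (lam * (s - t)); have e0 : 0 < e by exact: expR_gt0.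
(* With this choice the first term is at most [y / 2] and is absorbed on the left; [lam >= 1]
   removes the factor [1 / lam]. *)
pose th := y / e; have th0 : 0 < th by rewrite divr_gt0.
have mexp (a : R -> R) : measurable_fun setT a -> measurable_fun (`[t, s]%classic : set R) (expR \o a).
  by move=> ma; apply: measurable_funTS; exact: measurableT_comp.
have m1 : measurable_fun (`[t, s]%classic : set R) (fun r => expR (lam * (r - t))).
  by apply: mexp; apply: measurable_funM => //; exact: measurable_funB.
have m2 : measurable_fun (`[t, s]%classic : set R) (fun r => expR (lam * (t - r)) * k r ^+ 2).
  apply: measurable_funM; last exact: measurable_funX.
  by apply: mexp; apply: measurable_funM => //; exact: measurable_funB.
have : (y%:E <= (2^-1 * th)%:E * (e / lam)%:E + (2^-1 / th)%:E * K)%E.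
  apply: (le_trans yk).
  apply: (@le_trans _ _ (\int[mu]_(r in `[t, s])
     ((2^-1 * th)%:E * (expR (lam * (r - t)))%:E +
      (2^-1 / th)%:E * (expR (lam * (t - r)) * k r ^+ 2)%:E))%E).
    apply: ge0_le_integral_nonmeas => r; rewrite /= in_itv /= => rts.
      by rewrite lee_fin k0.
    rewrite -!EFinM -EFinD lee_fin.
    have -> : lam * (t - r) = - (lam * (r - t)) by ring.
    rewrite expRN; have := expR_gt0 (lam * (r - t)).
    move: (expR _) => u u0; rewrite -subr_ge0.
    have -> : 2^-1 * th * u + 2^-1 / th * (u^-1 * k r ^+ 2) - k r =
       2^-1 * (th * u) * (1 - k r / (th * u)) ^+ 2.
      by field; rewrite !gt_eqF.
    by rewrite mulr_ge0 ?sqr_ge0// mulr_ge0// mulr_ge0// ltW.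
  have th20 : 0 <= 2^-1 * th by rewrite mulr_ge0// ltW.
  have th21 : 0 <= 2^-1 / th by rewrite divr_ge0// ltW.
  rewrite ge0_integralD//=; first last.
  - by apply: measurable_funeM; exact/measurable_EFinP.
  - by move=> r _; rewrite mule_ge0// lee_fin mulr_ge0 ?sqr_ge0// expR_ge0.
  - by apply: measurable_funeM; exact/measurable_EFinP.
  - by move=> r _; rewrite mule_ge0// lee_fin expR_ge0.
  rewrite ge0_integralZl//=; first last.
  - exact/measurable_EFinP.
  rewrite [X in (_ + X)%E]ge0_integralZl//=; first last.
  - by move=> r _; rewrite lee_fin mulr_ge0 ?sqr_ge0// expR_ge0.
  - exact/measurable_EFinP.
  by apply: leeD => //; rewrite lee_wpmul2l ?lee_fin//; exact: integral_expR_le.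
have K1 : 0 <= fine K by rewrite fine_ge0.
rewrite -(fineK Kfin) -!EFinM -EFinD !lee_fin => h.
have h1 : e / lam <= e by rewrite ler_pdivrMr// ler_peMr// ltW.
have h2 : y <= 2^-1 * th * e + 2^-1 / th * fine K.
  by rewrite (le_trans h)// lerD2r ler_wpM2l// mulr_ge0// ltW.
have h3 : y <= 2^-1 * y + 2^-1 * (fine K * e / y).
  rewrite (le_trans h2)// le_eqVlt; apply/orP; left; apply/eqP.
  by rewrite /th; field; rewrite !gt_eqF.
have h4 : y <= fine K * e / y by lra.
by rewrite expr2 mulrC [leRHS]mulrC -ler_pdivlMr.
Qed.

(* If [K s >= c > c'], the intermediate value theorem gives [r] with [K r = c'],
   and [K < c] on [[t, r]], so the right-hand side is at least [c']. *)
Lemma mine_integral_le (t s c : R) (f : R -> R) :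
  t <= s -> 0 <= c -> measurable_fun `[t, s] f ->
  (forall r, t <= r <= s -> 0 <= f r) ->
  (\int[mu]_(r in `[t, s]) (f r)%:E < +oo)%E ->
  (mine (\int[mu]_(r in `[t, s]) (f r)%:E) c%:E <=
   \int[mu]_(r in `[t, s])
     (\1_[set r : R | (\int[mu]_(u in `[t, r]) (f u)%:E < c%:E)%E] r * f r)%:E)%E.
Proof.
move=> ts c0 mf f0 ffin; pose K (r : R) := (\int[mu]_(u in `[t, r]) (f u)%:E)%E.
rewrite -/(K s).
set g := (fun r => \1_[set r | (K r < c%:E)%E] r * f r).
have g0 r : t <= r <= s -> 0 <= g r by move=> rts; rewrite mulr_ge0// f0.
have mfr r : t <= r <= s -> measurable_fun `[t, r] (fun u => (f u)%:E).
  move=> /andP[tr rs]; apply/measurable_EFinP; apply: measurable_funS mf => //.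
  by apply: subset_itvl; rewrite bnd_simp.
have Kle r r' : r <= r' -> t <= r' <= s -> (K r <= K r')%E.
  move=> rr' tr's; apply: ge0_subset_integral => //.
  - exact: mfr.
  - move=> u; rewrite /= in_itv /= => /andP[tu ur]; rewrite lee_fin f0// tu.
    by move/andP: tr's => [_]; exact: le_trans.
  - by apply: subset_itvl; rewrite bnd_simp.
have part r : t <= r <= s -> (K r < c%:E)%E -> (K r <= \int[mu]_(r in `[t, s]) (g r)%:E)%E.
  move=> /andP[tr rs] Kr.
  apply: (@le_trans _ _ (\int[mu]_(u in `[t, r]) (g u)%:E)%E).
    apply: ge0_le_integral_nonmeas => u; rewrite /= in_itv /= => /andP[tu ur].
      by rewrite lee_fin f0// tu (le_trans ur).
    rewrite lee_fin /g indicE mem_set ?mul1r//=.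
    by rewrite (le_lt_trans (Kle u r _ _)) ?tr.
  rewrite [leLHS]integral_mkcond [leRHS]integral_mkcond.
  apply: ge0_le_integral_nonmeas => u _; rewrite /patch.
    case: ifPn => //; rewrite inE /= in_itv /= => /andP[tu ur].
    by rewrite lee_fin g0// tu (le_trans ur).
  case: ifPn => [|_].
    rewrite inE /= in_itv /= => /andP[tu ur].
    by rewrite ifT// inE /= in_itv /= tu (le_trans ur).
  by case: ifPn => //; rewrite inE /= in_itv /= => h; rewrite lee_fin g0.
have tts : t <= s <= s by rewrite ts lexx.
have [Kc|cK] := ltP (K s) c%:E; first exact: part.
apply/lee_addgt0Pr => th th0; have I0 : (0 <= \int[mu]_(r in `[t, s]) (g r)%:E)%E.
  by apply: integral_ge0 => r; rewrite /= in_itv /= => h; rewrite lee_fin g0.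
have [cth|thc] := leP c th.
  by rewrite -[leLHS]add0e leeD// lee_fin.
have intf : mu.-integrable `[t, s] (EFin \o f).
  apply/integrableP; split; first exact/measurable_EFinP.
  apply: le_lt_trans ffin; apply: ge0_le_integral_nonmeas => r //=.
  by rewrite in_itv /= => h; rewrite ger0_norm// f0.
have cont := parameterized_integral_continuous ts intf.
have Kfin r : t <= r <= s -> K r \is a fin_num.
  move=> rts; rewrite ge0_fin_numE.
    by rewrite (le_lt_trans _ ffin)//; apply: Kle => //; case/andP: rts.
  apply: integral_ge0 => u; rewrite /= in_itv /= => /andP[tu ur].
  by rewrite lee_fin f0// tu (le_trans ur)//; case/andP: rts.
have [|r] := IVT (v := c - th) ts cont.
  rewrite /parameterized_integral set_itv1 Rintegral_set1.
  have Ks : c <= fine (K s) by rewrite -lee_fin fineK// Kfin.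
  rewrite ge_min le_max; apply/andP; split; apply/orP; [left; lra|right].
  by rewrite /Rintegral (le_trans _ Ks)//; lra.
rewrite in_itv /= => rts Kr.
have {Kr}Kr : K r = (c - th)%:E.
  by rewrite -Kr /parameterized_integral /Rintegral fineK// Kfin.
have : ((c - th)%:E <= \int[mu]_(r in `[t, s]) (g r)%:E)%E.
  by rewrite -Kr; apply: part => //; rewrite Kr lte_fin; lra.
by move=> h; rewrite -leeBlDr// -EFinB.
Qed.

End real_integrals.

Section running_integral.
Context {R : realType} {d : measure_display} {Omega : measurableType d}.
Variables (t T : R) (f : R * Omega -> \bar R).
Hypothesis mf : measurable_fun (strip t T) f.
Hypothesis f0 : forall z, strip t T z -> (0 <= f z)%E.

(** The variable upper limit is moved into the integrand as the indicator of [u <= r]; what remains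
    is a time integral over the fixed interval, with the pair of time and chance as parameter. *)
Lemma measurable_running_integral : measurable_fun (strip t T)
  (fun z : R * Omega => \int[lebesgue_measure]_(u in `[t, z.1]) f (u, z.2))%E.
Proof.
pose TO : measurableType _ := (measurableTypeR R * Omega)%type.
pose A : set (R * TO) := [set p | p.1 <= p.2.1].
have mA : measurable A.
  have -> : A = [set p : R * TO | p.1 - p.2.1 <= 0].
    by apply/seteqP; split => p; rewrite /A /= subr_le0.
  have mp : measurable_fun setT (fun p : measurableTypeR R * TO => p.1 - p.2.1).
    apply: measurable_funB; first exact: measurable_fst.
    exact: (measurableT_comp measurable_fst measurable_snd).
  have := mp measurableT _ (measurable_itv `]-oo, 0]); rewrite setTI.
  by congr (measurable _); apply/seteqP; split => w /=; rewrite in_itv.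
pose F (p : R * TO) := (f (p.1, p.2.2) * (\1_A p : R)%:E)%E.
have mF : measurable_fun (strip t T) F.
  apply: emeasurable_funM; last first.
    by apply: measurable_funTS; apply/measurable_EFinP; exact: measurable_indic.
  apply: (@measurable_comp _ _ _ _ _ _ (strip t T) f) => //.
  - exact: measurable_strip.
  - by move=> _ [p pT <-].
  - apply: measurable_funTS; apply/measurable_fun_pairP; split.
      exact: measurable_fst.
    exact: (measurableT_comp measurable_snd measurable_snd).
have F0 p : strip t T p -> (0 <= F p)%E.
  by move=> tp; rewrite mule_ge0// ?lee_fin//; exact: f0.
have := measurable_time_integral mF F0 => /(measurable_funTS (D := strip t T)).
apply: eq_measurable_fun => -[r w]; rewrite inE /strip /= => /andP[tr rT].
rewrite [LHS]integral_mkcond [RHS]integral_mkcond; apply: eq_integral => u _.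
rewrite /patch /F /= indicE; case: ifPn; rewrite ?notin_setE ?inE /= in_itv /=.
  move=> /andP[tu uT]; have [ur|ru] := leP u r.
    by rewrite mem_set// mule1 ifT// inE /= in_itv /= tu.
  rewrite memNset ?mule0; last by rewrite /A /= leNgt ru.
  by rewrite ifF//; apply/negP; rewrite inE /= in_itv /= [u <= r]leNgt ru andbF.
move=> ntuT; rewrite ifF//; apply/negP; rewrite inE /= in_itv /= => /andP[tu ur].
by apply: ntuT; rewrite tu (le_trans ur).
Qed.

End running_integral.

(** * Gronwall argument for the truncated weighted energy *)

Section energy_estimate.
Context {R : realType} {d : measure_display} {Omega : measurableType d}.
Variables (P : probability Omega R) (t T : R).
Variables (k a q : R -> Omega -> R) (lam gam del A : R).
Local Notation mu := (@lebesgue_measure R).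

Hypothesis tT : t <= T.
Hypothesis lam1 : 1 <= lam.
Hypothesis gam0 : 0 < gam.
Hypothesis del0 : 0 <= del.
Hypothesis mk : measurable_fun (strip t T) (fun z : R * Omega => k z.1 z.2).
Hypothesis k0 : forall s w, t <= s <= T -> 0 <= k s w.
Hypothesis ma : measurable_fun (strip t T) (fun z : R * Omega => a z.1 z.2).
Hypothesis a0 : forall s w, t <= s <= T -> 0 <= a s w.
Hypothesis mq : forall s, t <= s <= T -> measurable_fun setT (q s).
Hypothesis q0 : forall s w, 0 <= q s w.
Hypothesis kfin : {ae P, forall w, (time_energy t T k w < +oo)%E}.
Hypothesis kq : forall s w, t <= s <= T -> k s w ^+ 2 <= a s w + gam * q s w.
Hypothesis qJ : forall s, t <= s <= T -> exists jn : Omega -> R,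
  [/\ measurable_fun setT jn,
      forall c, 0 <= c ->
        (\int[P]_w (\1_[set w | (time_energy t s k w < c%:E)%E] w * jn w ^+ 2)%:E
           <= del%:E * \int[P]_w mine (time_energy t s k w) c%:E)%E
    & {ae P, forall w, exists y, [/\ 0 <= y,
        (y%:E <= \int[mu]_(r in `[t, s]) (k r w)%:E)%E &
        q s w <= y ^+ 2 + jn w ^+ 2]}].
Hypothesis aA : (\int[P]_w \int[mu]_(r in `[t, T])
  (expR (lam * (t - r)) * a r w)%:E <= A%:E)%E.

Let lam0 : 0 <= lam.
Proof. exact: le_trans lam1. Qed.

Let sub s : t <= s <= T -> strip t s `<=` (strip t T : set (R * Omega)).
Proof. by move=> /andP[_ sT] z /andP[tz zs]; rewrite /strip /= tz (le_trans zs). Qed.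

Let f (z : R * Omega) : \bar R := (expR (lam * (t - z.1)) * k z.1 z.2 ^+ 2)%:E.

Let mexp D : measurable_fun D (fun z : R * Omega => expR (lam * (t - z.1))).
Proof.
apply: measurable_funTS; apply: measurableT_comp => //.
by apply: measurable_funM => //; exact: measurable_funB.
Qed.

Let mf : measurable_fun (strip t T) f.
Proof.
by apply/measurable_EFinP; apply: measurable_funM => //; exact: measurable_funX.
Qed.

Let f0 z : (0 <= f z)%E.
Proof. by rewrite lee_fin mulr_ge0 ?sqr_ge0// expR_ge0. Qed.

Let K (s : R) w : \bar R := (\int[mu]_(r in `[t, s]) f (r, w))%E.
Let TE s w := time_energy t s k w.

Let K0 s w : (0 <= K s w)%E.
Proof. exact: integral_ge0. Qed.

Let mS s : t <= s <= T -> measurable_fun (strip t s) f.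
Proof. by move=> ts; apply: measurable_funS mf; [exact: measurable_strip|exact: sub]. Qed.

Let mK s : t <= s <= T -> measurable_fun setT (K s).
Proof. by move=> ts; apply: measurable_time_integral => //; exact: mS. Qed.

Let mk2 s : t <= s <= T ->
  measurable_fun (strip t s) (fun z : R * Omega => (k z.1 z.2 ^+ 2)%:E).
Proof.
move=> ts; apply/measurable_EFinP; apply: measurable_funX.
by apply: measurable_funS mk; [exact: measurable_strip|exact: sub].
Qed.

Let mTE s : t <= s <= T -> measurable_fun setT (TE s).
Proof.
move=> ts; apply: (measurable_time_integral (mk2 ts)) => z _.
by rewrite lee_fin sqr_ge0.
Qed.

Let TE0 s w : (0 <= TE s w)%E.
Proof. by apply: integral_ge0 => r _; rewrite lee_fin sqr_ge0. Qed.

Let KleTE s w : (K s w <= TE s w)%E.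
Proof.
apply: ge0_le_integral_nonmeas => // r; rewrite /= in_itv /= => /andP[tr _].
rewrite lee_fin ler_piMl ?sqr_ge0// -expR0 ler_expR.
by rewrite mulr_ge0_le0 ?subr_le0.
Qed.

Let TEleK s w : t <= s <= T -> (TE s w <= (expR (lam * (s - t)))%:E * K s w)%E.
Proof.
move=> ts; rewrite -ge0_integralZl//=; last exact: (measurable_time_section (mS ts)).
  apply: ge0_le_integral_nonmeas => r; rewrite /= in_itv /= => /andP[tr rs].
    by rewrite lee_fin sqr_ge0.
  rewrite -EFinM lee_fin mulrA ler_peMl ?sqr_ge0// -expRD -expR0 ler_expR.
  have -> : lam * (s - t) + lam * (t - r) = lam * (s - r) by ring.
  by rewrite mulr_ge0 ?subr_ge0.
Qed.

(** At most [c] a priori, which gives Gronwall a finite starting value even if the expectation of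
    [K s] were infinite. *)
Let h c s := (\int[P]_w mine (K s w) c%:E)%E.

Let kap := gam * (1 + del).

Let setK s c : t <= s <= T -> measurable [set w | (K s w < c%:E)%E].
Proof.
move=> ts; rewrite -[X in measurable X]setTI.
by apply: emeasurable_fun_infty_o => //; exact: mK.
Qed.

(** [qJ] is stated for the unweighted energy [TE]. With [e = expR (lam * (s - t))], the event
    [K s < c] lies in [TE s < e * c], so [qJ] applies at level [e * c], and
    [min (TE s) (e * c) <= e * min (K s) c] leads back to the weighted energy. *)
Let stopped_q s c : t <= s <= T -> 0 <= c ->
  (\int[P]_w (\1_[set w | (K s w < c%:E)%E] w * q s w)%:E <=
     ((1 + del) * expR (lam * (s - t)))%:E * h c s)%E.
Proof.
move=> tsT c0; have [ts sT] := andP tsT; have [jn [mjn hjn qy]] := qJ tsT.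
set e := expR _; have e0 : 0 <= e by exact: expR_ge0.
have ec0 : 0 <= e * c by rewrite mulr_ge0.
have mT : measurable [set w | (TE s w < (e * c)%:E)%E].
  rewrite -[X in measurable X]setTI.
  by apply: emeasurable_fun_infty_o => //; exact: mTE.
have mmin : measurable_fun setT (fun w => mine (K s w) c%:E).
  by apply: measurable_mine => //; exact: mK.
have min0 w : (0 <= mine (K s w) c%:E)%E by rewrite le_min K0 lee_fin.
have m1 : measurable_fun setT (fun w => (e%:E * mine (K s w) c%:E)%E).
  exact: measurable_funeM.
have m2 : measurable_fun setT
   (fun w => (\1_[set w | (TE s w < (e * c)%:E)%E] w * jn w ^+ 2)%:E).
  apply/measurable_EFinP; apply: measurable_funM; first exact: measurable_indic.
  exact: measurable_funX.
have j0 w : (0 <= (\1_[set w | (TE s w < (e * c)%:E)%E] w * jn w ^+ 2)%:E)%E.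
  by rewrite lee_fin mulr_ge0// sqr_ge0.
apply: (@le_trans _ _ (\int[P]_w (e%:E * mine (K s w) c%:E +
    (\1_[set w | (TE s w < (e * c)%:E)%E] w * jn w ^+ 2)%:E))%E).
  apply: ae_ge0_le_integral => //.
  - by move=> w _; rewrite lee_fin mulr_ge0.
  - apply/measurable_EFinP; apply: measurable_funM; last exact: mq.
    by apply: measurable_indic; exact: setK.
  - by move=> w _; rewrite adde_ge0// mule_ge0.
  - exact: emeasurable_funD.
  apply: filterS qy => w [y [y0 yk qle]] _.
  rewrite [in leLHS]indicE; case: (boolP (w \in _)) => [|_]; last first.
    by rewrite mul0r adde_ge0// mule_ge0.
  rewrite inE /= mul1r => Kc.
  apply: (@le_trans _ _ ((y ^+ 2)%:E + (jn w ^+ 2)%:E)%E).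
    by rewrite -EFinD lee_fin.
  apply: leeD.
    rewrite (min_idPl (ltW Kc)); apply: weighted_cauchy_schwarz => //.
      apply/measurable_EFinP.
      have mkE : measurable_fun (strip t s) (fun z : R * Omega => (k z.1 z.2)%:E).
        apply/measurable_EFinP.
        by apply: measurable_funS mk; [exact: measurable_strip|exact: sub].
      exact: (measurable_time_section mkE).
    by move=> r /andP[tr rs]; rewrite k0// tr (le_trans rs).
  rewrite indicE mem_set ?mul1r//=.
  have := TEleK w tsT => /le_lt_trans; apply.
  by rewrite EFinM lte_pmul2l// lte_fin expR_gt0.
rewrite ge0_integralD//=; last by move=> w _; rewrite mule_ge0.
rewrite ge0_integralZl//= mulrDl mul1r EFinD ge0_muleDl ?lee_fin//; last by rewrite mulr_ge0.
apply: leeD; first exact: lexx.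
apply: (le_trans (hjn _ ec0)).
have -> : ((del * e)%:E * h c s = del%:E * (e%:E * h c s))%E by rewrite muleA -EFinM.
rewrite lee_wpmul2l ?lee_fin//.
rewrite -ge0_integralZl//.
apply: ge0_le_integral_nonmeas => w _; first by rewrite le_min TE0 lee_fin.
have [Kc|cK] := leP (K s w) c%:E.
  by rewrite ge_min; apply/orP; left; exact: TEleK.
by rewrite ge_min -EFinM lexx orbT.
Qed.

Let A0 : 0 <= A.
Proof.
rewrite -lee_fin (le_trans _ aA)//; apply: integral_ge0 => w _.
apply: integral_ge0 => r; rewrite /= in_itv /= => tr.
by rewrite lee_fin mulr_ge0 ?expR_ge0// a0.
Qed.

Let g c (z : R * Omega) : \bar R :=
  (\1_[set z : R * Omega | (K z.1 z.2 < c%:E)%E] z * (expR (lam * (t - z.1)) * k z.1 z.2 ^+ 2))%:E.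

Let mg c : measurable_fun (strip t T) (g c).
Proof.
apply/measurable_EFinP; apply: measurable_funM; last first.
  by apply: measurable_funM => //; exact: measurable_funX.
have mKz : measurable_fun (strip t T) (fun z : R * Omega => K z.1 z.2).
  by apply: (measurable_running_integral mf) => z _.
have mB : measurable (strip t T `&` [set z : R * Omega | (K z.1 z.2 < c%:E)%E]).
  by apply: emeasurable_fun_infty_o => //; exact: measurable_strip.
apply: (eq_measurable_fun (\1_(strip t T `&` [set z : R * Omega | (K z.1 z.2 < c%:E)%E]) : R * Omega -> R)).
  by move=> z; rewrite !inE => tz; rewrite !indicE in_setI mem_set.
by apply: measurable_funTS; exact: measurable_indic.
Qed.

Let g0 c z : (0 <= g c z)%E.
Proof. by rewrite lee_fin mulr_ge0// mulr_ge0 ?sqr_ge0// expR_ge0. Qed.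

Let aE (z : R * Omega) : \bar R := (expR (lam * (t - z.1)) * a z.1 z.2)%:E.

Let maE : measurable_fun (strip t T) aE.
Proof. by apply/measurable_EFinP; exact: measurable_funM. Qed.

Let aE0 z : strip t T z -> (0 <= aE z)%E.
Proof. by move=> tz; rewrite lee_fin mulr_ge0 ?expR_ge0// a0. Qed.

(** Along a path [mine_integral_le] bounds the truncated energy by the energy collected while
    [K r < c]. Tonelli moves the expectation inside, where [stopped_q] applies at each time [r]. *)
Let h_renewal c s : t <= s <= T -> 0 <= c ->
  (h c s <= \int[mu]_(r in `[t, s]) (\int[P]_w aE (r, w) + kap%:E * h c r))%E.
Proof.
move=> tsT c0; have [ts sT] := andP tsT.
have mgs : measurable_fun (strip t s) (g c).
  by apply: measurable_funS (mg c); [exact: measurable_strip|exact: sub].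
apply: (@le_trans _ _ (\int[P]_w \int[mu]_(r in `[t, s]) g c (r, w))%E).
  apply: ae_ge0_le_integral => //.
  - by move=> w _; rewrite le_min K0 lee_fin.
  - by apply: measurable_mine => //; exact: mK.
  - by move=> w _; apply: integral_ge0.
  - exact: measurable_time_integral.
  apply: filterS kfin => w wfin _.
  apply: (mine_integral_le (f := fun r => expR (lam * (t - r)) * k r w ^+ 2)) => //.
  - by apply/measurable_EFinP; exact: (measurable_time_section (mS tsT)).
  - by move=> r _; rewrite mulr_ge0 ?sqr_ge0// expR_ge0.
  apply: le_lt_trans wfin; apply: (le_trans (KleTE s w)).
  apply: ge0_subset_integral => //.
  - have tTT : t <= T <= T by rewrite tT lexx.
    exact: (measurable_time_section (mk2 tTT)).
  - by move=> r _; rewrite lee_fin sqr_ge0.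
  - by apply: subset_itvl; rewrite bnd_simp.
rewrite tonelli_time//; apply: ge0_le_integral_nonmeas => r.
  by move=> _; apply: integral_ge0.
rewrite /= in_itv /= => /andP[tr rs]; have trT : t <= r <= T by rewrite tr (le_trans rs).
set e := expR (lam * (t - r)); have e0 : 0 <= e by exact: expR_ge0.
have ma1 : measurable_fun setT (fun w => aE (r, w)) by exact: (measurable_space_section maE).
have mKq : measurable_fun setT (fun w => (\1_[set w | (K r w < c%:E)%E] w * q r w)%:E).
  apply/measurable_EFinP; apply: measurable_funM; last exact: mq.
  by apply: measurable_indic; exact: setK.
have Kq0 w : (0 <= (\1_[set w | (K r w < c%:E)%E] w * q r w)%:E)%E.
  by rewrite lee_fin mulr_ge0.
have eg0 : 0 <= e * gam by rewrite mulr_ge0// ltW.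
apply: (@le_trans _ _ (\int[P]_w (aE (r, w) +
    (e * gam)%:E * (\1_[set w | (K r w < c%:E)%E] w * q r w)%:E))%E).
  apply: ge0_le_integral_nonmeas => // w _; rewrite /g /= !indicE.
  rewrite -EFinM -EFinD lee_fin.
  have -> : ((r, w) \in [set z : R * Omega | (K z.1 z.2 < c%:E)%E]) =
     (w \in [set w | (K r w < c%:E)%E]) by apply/idP/idP; rewrite !inE.
  case: (w \in _); last by rewrite !mul0r mulr0 addr0 mulr_ge0// a0.
  by rewrite !mul1r -/e -mulrA -mulrDr ler_wpM2l// kq.
rewrite ge0_integralD//=; first last.
- exact: measurable_funeM.
- by move=> w _; rewrite mule_ge0.
- by move=> w _; apply: aE0.
rewrite leeD2l// ge0_integralZl//.
apply: (@le_trans _ _ ((e * gam)%:E * (((1 + del) * expR (lam * (r - t)))%:E * h c r))%E).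
  by rewrite lee_wpmul2l ?lee_fin//; exact: stopped_q.
rewrite muleA -EFinM.
(* The decreasing weight [e] cancels the growth coming from [stopped_q], so the kernel is the
   constant [kap]. *)
have -> : e * gam * ((1 + del) * expR (lam * (r - t))) = kap * (e * expR (lam * (r - t))).
  by rewrite /kap; ring.
rewrite /e -expRD.
by have -> : lam * (t - r) + lam * (r - t) = 0; [ring|rewrite expR0 mulr1].
Qed.

Let kap0 : 0 < kap.
Proof. by rewrite mulr_gt0// ltr_pwDl. Qed.

(* The a priori bound [h c s <= c] is halved by each use of the renewal inequality. *)
Let h_bound_n c (n : nat) s : t <= s <= T -> 0 <= c ->
  (h c s <= ((2 * A + c / 2 ^+ n) * expR (2 * kap * (s - t)))%:E)%E.
Proof.
move=> tsT c0; have k20 : 0 < 2 * kap by rewrite mulr_gt0.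
have exp1 r : t <= r -> 1 <= expR (2 * kap * (r - t)).
  by move=> tr; rewrite -[leLHS]expR0 ler_expR mulr_ge0 ?subr_ge0// (ltW k20).
elim: n s tsT => [|n ih] s tsT; have [ts sT] := andP tsT.
  apply: (@le_trans _ _ (\int[P]_w (cst c%:E) w)%E).
    by apply: ge0_le_integral_nonmeas => w _; rewrite ?ge_min ?lexx ?orbT// le_min K0 lee_fin.
  rewrite [leLHS]integral_cst//= [X in (_ * X)%E](@probability_setT _ _ _ P) mule1.
  rewrite lee_fin expr0 divr1 (@le_trans _ _ (2 * A + c))//.
    by rewrite lerDr mulr_ge0.
  by rewrite ler_peMr ?exp1// addr_ge0// mulr_ge0.
apply: (le_trans (h_renewal tsT c0)).
set bn := 2 * A + c / 2 ^+ n.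
have bn0 : 0 <= bn by rewrite addr_ge0 ?mulr_ge0// invr_ge0 exprn_ge0.
have mEa : measurable_fun (`[t, s]%classic : set R) (fun r => \int[P]_w aE (r, w))%E.
  have maS : measurable_fun (strip t s) aE.
    by apply: measurable_funS maE; [exact: measurable_strip|exact: sub].
  by apply: (measurable_expectation P maS) => z tz; apply: aE0; exact: (sub tsT).
have Ea0 r : t <= r <= s -> (0 <= \int[P]_w aE (r, w))%E.
  move=> /andP[tr rs]; apply: integral_ge0 => w _.
  by apply: aE0; rewrite /strip /= tr (le_trans rs).
have mexp1 : measurable_fun (`[t, s]%classic : set R) (fun r => (expR (2 * kap * (r - t)))%:E).
  apply/measurable_EFinP; apply: measurable_funTS; apply: measurableT_comp => //.
  by apply: measurable_funM => //; exact: measurable_funB.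
have c00 : 0 <= kap * bn by rewrite mulr_ge0// ltW.
apply: (@le_trans _ _ (\int[mu]_(r in `[t, s]) (\int[P]_w aE (r, w) +
   (kap * bn)%:E * (expR (2 * kap * (r - t)))%:E))%E).
  apply: ge0_le_integral_nonmeas => r; rewrite /= in_itv /= => trs.
    rewrite adde_ge0 ?Ea0// mule_ge0//; first by rewrite lee_fin ltW.
    by apply: integral_ge0 => w _; rewrite le_min K0 lee_fin.
  have trT : t <= r <= T by move: trs => /andP[-> /le_trans]; apply.
  rewrite leeD2l//.
  have -> : ((kap * bn)%:E * (expR (2 * kap * (r - t)))%:E =
      kap%:E * (bn * expR (2 * kap * (r - t)))%:E)%E.
    by rewrite -!EFinM; congr EFin; ring.
  by apply: lee_wpmul2l; [rewrite lee_fin ltW|exact: ih].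
rewrite ge0_integralD//=; first last.
- exact: measurable_funeM.
- by move=> r _; rewrite mule_ge0 ?lee_fin ?expR_ge0.
rewrite ge0_integralZl//=.
apply: (@le_trans _ _ (A%:E + (kap * bn)%:E * (expR (2 * kap * (s - t)) / (2 * kap))%:E)%E).
  apply: leeD.
    apply: le_trans aA; rewrite (tonelli_time P maE aE0).
    apply: ge0_subset_integral => //.
    - exact: (measurable_expectation P maE aE0).
    - move=> r; rewrite /= in_itv /= => trT; apply: integral_ge0 => w _.
      exact: aE0.
    - by apply: subset_itvl; rewrite bnd_simp.
  by rewrite lee_wpmul2l ?lee_fin//; exact: integral_expR_le.
rewrite -EFinM -EFinD lee_fin.
have -> : kap * bn * (expR (2 * kap * (s - t)) / (2 * kap)) = bn / 2 * expR (2 * kap * (s - t)).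
  by field; rewrite gt_eqF.
have -> : c / 2 ^+ n.+1 = (c / 2 ^+ n) / 2.
  by rewrite exprS; field; rewrite expf_neq0.
have := exp1 s ts; rewrite /bn; move: (expR _) (c / _) => u v u1.
by have := A0; nra.
Qed.

(** Sufficiently many iterations make the term in [c / 2 ^+ n] negligible, so the truncation level
    leaves the bound. *)
Let h_bound c s : t <= s <= T -> 0 <= c ->
  (h c s <= (2 * A * expR (2 * kap * (s - t)))%:E)%E.
Proof.
move=> tsT c0; apply/lee_addgt0Pr => th th0; set u := expR _.
have u0 : 0 < u by exact: expR_gt0.
pose n := (Num.truncn (c * u / th)).+1.
apply: (le_trans (h_bound_n n tsT c0)); rewrite -EFinD lee_fin mulrDl lerD2l.
rewrite mulrAC ler_pdivrMr ?exprn_gt0// mulrC -ler_pdivrMl// mulrC.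
have := truncnS_gt (c * u / th); rewrite -/n [_^-1 * _]mulrC => /ltW/le_trans; apply.
by rewrite -natrX ler_nat ltnW// ltn_expl.
Qed.

(** As the bound on [h] does not involve [c], [stopped_q] can be used at levels [c = n]; monotone
    convergence then removes the stopping, because [K s] is almost surely finite. *)
Lemma energy_estimate s : t <= s <= T ->
  (\int[P]_w (q s w)%:E <=
     ((1 + del) * (2 * A) * expR ((lam + 2 * kap) * (s - t)))%:E)%E.
Proof.
move=> tsT; have [ts sT] := andP tsT.
set b := (_ * _ * _); pose G (n : nat) w := (\1_[set w | (K s w < n%:R%:E)%E] w * q s w)%:E.
have Gb n : (\int[P]_w G n w <= b%:E)%E.
  apply: (le_trans (stopped_q tsT (ler0n _ n))).
  apply: (@le_trans _ _ (((1 + del) * expR (lam * (s - t)))%:E *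
      (2 * A * expR (2 * kap * (s - t)))%:E)%E).
    rewrite lee_wpmul2l ?lee_fin ?h_bound//.
    by rewrite mulr_ge0 ?expR_ge0// addr_ge0.
  rewrite -EFinM lee_fin /b le_eqVlt; apply/orP; left; apply/eqP.
  have -> : (lam + 2 * kap) * (s - t) = lam * (s - t) + 2 * kap * (s - t) by ring.
  by rewrite expRD; ring.
have mG n : measurable_fun setT (G n).
  apply/measurable_EFinP; apply: measurable_funM; last exact: mq.
  by apply: measurable_indic; exact: setK.
have G0 n w : (0 <= G n w)%E by rewrite lee_fin mulr_ge0.
have Gmono w : {homo G ^~ w : n m / (n <= m)%N >-> (n <= m)%E}.
  move=> n m nm; rewrite lee_fin ler_wpM2r// !indicE.
  case: (boolP (w \in [set w | (K s w < n%:R%:E)%E])) => [|_]; last by rewrite ler0n.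
  rewrite inE /= => Kn; rewrite mem_set//=.
  by rewrite (lt_le_trans Kn)// lee_fin ler_nat.
apply: (@le_trans _ _ (\int[P]_w limn (G ^~ w))%E).
  apply: ae_ge0_le_integral => //.
  - by move=> w _; rewrite lee_fin.
  - by apply/measurable_EFinP; exact: mq.
  - move=> w _; apply: lime_ge; last exact: nearW.
    exact: ereal_nondecreasing_is_cvgn.
  - apply: (emeasurable_fun_cvg _ _ mG) => w _.
    exact: ereal_nondecreasing_is_cvgn.
  apply: filterS kfin => w wfin _.
  have Kfin : (K s w < +oo)%E.
    apply: le_lt_trans wfin; apply: (le_trans (KleTE s w)).
    apply: ge0_subset_integral => //.
    - have tTT : t <= T <= T by rewrite tT lexx.
      exact: (measurable_time_section (mk2 tTT)).
    - by move=> r _; rewrite lee_fin sqr_ge0.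
    - by apply: subset_itvl; rewrite bnd_simp.
  rewrite le_eqVlt; apply/orP; left; apply/eqP/esym/cvg_lim => //.
  apply: cvg_near_cst; exists (Num.truncn (fine (K s w))).+1 => // n /= fn.
  rewrite /G indicE mem_set ?mul1r//=.
  rewrite -(fineK (x := K s w)) ?ge0_fin_numE// lte_fin.
  by rewrite (lt_le_trans (truncnS_gt _))// ler_nat.
rewrite monotone_convergence//.
apply: lime_le; last exact: nearW.
apply: ereal_nondecreasing_is_cvgn => m n mn.
by apply: ge0_le_integral_nonmeas => w _ //; exact: Gmono.
Qed.

End energy_estimate.

(** * Mild solutions *)

Section mild_processes.
Context {R : realType} {H Xi : hilbertType R}.
Context {d : measure_display} {Omega : measurableType d}.
Variables (P : probability Omega R) (W : R -> Xi -> Omega -> R) (t T : R).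
Hypothesis P_complete : measure_is_complete P.
Hypothesis hW : cylindrical_wiener P W t T.
Hypothesis sepH : separable_space H.
Hypothesis sepXi : separable_space Xi.
Variable E : set Xi.
Hypothesis hE : orthonormal_basis E.
Variable S : R -> {linear H -> H}.
Hypothesis S_semigroup : contraction_semigroup S.
Hypothesis tT : t <= T.
Local Notation mu := (@lebesgue_measure R).
Local Notation cN := (@normal_variance R).

(** The integrands are arbitrary rather than given by [b] and [sigma]: the zero process with zero
    integrands is then an instance even though [b] and [sigma] need not vanish at 0. *)
Definition mild_process (z : H) (f : R -> Omega -> H)
    (Phi : R -> Omega -> Xi -> H) (X : R -> Omega -> H) : Prop :=
  forall s, t <= s <= T -> exists J : Omega -> H,
    is_stochastic_integral P W E t s (fun r w xi => S (s - r) (Phi r w xi)) J /\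
    {ae P, forall w, exists y : H,
      is_bochner_integral `[t, s] (fun r => S (s - r) (f r w)) y /\
      X s w = S (s - t) z + y + J w}.

Lemma is_bochner_integral0 (D : set R) : measurable D ->
  is_bochner_integral D (fun=> 0 : H) 0.
Proof.
move=> mD; split.
  by move=> U _; rewrite preimage_cst; case: ifPn => _; rewrite ?setIT ?setI0.
exists (fun=> [::]); split; last first.
  by rewrite /step_integral big_nil; exact: cvg_cst.
rewrite (_ : (fun n => _) = cst 0%E); first exact: cvg_cst.
apply/funext => n; rewrite integral0_eq// => r _.
by rewrite /step_fun big_nil subrr normr0.
Qed.

Lemma progressive_cst (V : topologicalType) (v : V) s :
  progressive P W t s (fun=> fun=> v).
Proof.
move=> r _ U _; have [Uv|Uv] := pselect (U v).
  rewrite (_ : [set _ | _] = `[t, r]%classic `*` setT); last first.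
    by apply/seteqP; split => z /=; rewrite in_itv/=; [move=> []|move=> [? _]; split].
  apply: sub_gen_smallest; exists `[t, r]%classic; first exact: measurable_itv.
  exists setT => //; rewrite -(setD0 setT).
  have [_ + _] := smallest_sigma_algebra setT [set G | P.-negligible G \/
     exists tau xi U, [/\ t <= tau <= r, measurable U & G = W tau xi @^-1` U]].
  by apply; exact: wiener_filtration_set0.
rewrite (_ : [set _ | _] = set0); last by apply/seteqP; split => z //= -[].
by have [+ _ _] := smallest_sigma_algebra (setT : set (R * Omega))
  [set I `*` G | I in measurable & G in wiener_filtration P W t r].
Qed.

Let cvg_to0_in_prob0 : cvg_to0_in_prob P (fun=> fun=> 0%E).
Proof.
move=> e e0; rewrite (_ : (fun n => _) = cst 0%E); first exact: cvg_cst.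
apply/funext => n; rewrite (_ : [set _ | _] = set0) ?measure0//.
by apply/seteqP; split => // w /=; rewrite lee_fin leNgt e0.
Qed.

Lemma is_stochastic_integral0 s :
  is_stochastic_integral P W E t s (fun=> fun=> fun=> 0 : H) (fun=> 0).
Proof.
have hs0 : hs_sqnorm E (fun=> 0 : H) = 0%E.
  by apply: esum1 => e _; rewrite normr0 expr0n.
split.
- by move=> xi; exact: progressive_cst.
- by apply: nearW => w; rewrite integral0_eq// => r _.
- by move=> U _; rewrite preimage_cst; case: ifPn.
exists (fun=> [::]); split.
  rewrite (_ : (fun n w => _) = fun=> fun=> 0%E); first exact: cvg_to0_in_prob0.
  apply/funext => n; apply/funext => w; apply: integral0_eq => r _.
  rewrite -[RHS]hs0; congr hs_sqnorm; apply/funext => xi /=.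
  by rewrite /elementary_process big_nil subr0.
rewrite (_ : (fun n w => _) = fun=> fun=> 0%E); first exact: cvg_to0_in_prob0.
by apply/funext => n; apply/funext => w; rewrite /elementary_integral big_nil subr0 normr0.
Qed.

Lemma mild_process0 : mild_process 0 (fun=> fun=> 0) (fun=> fun=> fun=> 0) (fun=> fun=> 0).
Proof.
move=> s tsT; exists (fun=> 0); split.
  rewrite (_ : (fun r w xi => _) = fun=> fun=> fun=> 0); first exact: is_stochastic_integral0.
  by apply/funext => r; apply/funext => w; apply/funext => xi; rewrite linear0.
apply: nearW => w; exists 0; rewrite linear0 !addr0; split=> //.
rewrite (_ : (fun r => _) = fun=> 0); first exact: is_bochner_integral0.
by apply/funext => r; rewrite linear0.
Qed.

(** Subtracting [S (s - t) (z - z')] leaves just the two integrals, and contraction removes the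
    kernels [S (s - r)] from their integrands. The [4 * cN] is the constant of
    [stochastic_integral_estimate]. *)
Lemma mild_process_estimate (z z' : H) (f f' : R -> Omega -> H)
    (Phi Phi' : R -> Omega -> Xi -> H) (X X' : R -> Omega -> H)
    (k a : R -> Omega -> R) (lam gam A : R) :
  1 <= lam -> 0 < gam ->
  measurable_fun (strip t T) (fun u : R * Omega => k u.1 u.2) ->
  measurable_fun (strip t T) (fun u : R * Omega => a u.1 u.2) ->
  (forall s w, t <= s <= T -> 0 <= a s w) ->
  (forall s U, t <= s <= T -> open U -> measurable (X s @^-1` U)) ->
  (forall s U, t <= s <= T -> open U -> measurable (X' s @^-1` U)) ->
  {ae P, forall w, (time_energy t T k w < +oo)%E} ->
  (forall r w, t <= r <= T -> `|f r w - f' r w| <= k r w) ->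
  (forall r w, t <= r <= T ->
     (hs_sqnorm E (Phi r w \- Phi' r w)%R <= (k r w ^+ 2)%:E)%E) ->
  mild_process z f Phi X -> mild_process z' f' Phi' X' ->
  (forall s w, t <= s <= T -> k s w ^+ 2 <=
     a s w + gam * `|X s w - X' s w - S (s - t) (z - z')| ^+ 2) ->
  (\int[P]_w \int[mu]_(r in `[t, T])
    (expR (lam * (t - r)) * a r w)%:E <= A%:E)%E ->
  forall s, t <= s <= T ->
  (\int[P]_w (`|X s w - X' s w - S (s - t) (z - z')| ^+ 2)%:E <=
     (4 * (1 + 4 * cN) * A *
        expR ((lam + 4 * (gam * (1 + 4 * cN))) * (s - t)))%:E)%E.
Proof.
move=> lam1 gam0 mk ma a0 mX mX' kfin hf hPhi hX hX' kq aA s tsT.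
have [_ _ Sc _] := S_semigroup.
(* The factor [2^-1] compensates [|u + v|^2 <= 2 |u|^2 + 2 |v|^2], so that [q] is below a plain sum
   of squares as [energy_estimate] requires; [gam] doubles in exchange. *)
pose q (s : R) w := 2^-1 * `|X s w - X' s w - S (s - t) (z - z')| ^+ 2.
have mq r : t <= r <= T -> measurable_fun setT (q r).
  move=> trT; apply: measurable_funM => //.
  apply: (measurable_fun_subr (F := fun h => `|h - S (r - t) (z - z')| ^+ 2) sepH) => [U oU|U oU|].
  - by rewrite setTI; exact: mX.
  - by rewrite setTI; exact: mX'.
  - exact: continuous_sqnormB.
have q0 r w : 0 <= q r w by rewrite mulr_ge0// sqr_ge0.
have cN0 := @normal_variance_ge0 R.
have k0 r w : t <= r <= T -> 0 <= k r w by move=> trT; exact: le_trans (hf r w trT).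
have gam20 : 0 < 2 * gam by rewrite mulr_gt0.
have del0 : 0 <= 4 * cN by rewrite mulr_ge0.
have key := energy_estimate (q := q) (del := 4 * cN) tT lam1 gam20 del0 mk k0 ma a0 mq q0 kfin.
have -> : (\int[P]_w (`|X s w - X' s w - S (s - t) (z - z')| ^+ 2)%:E =
    2%:E * \int[P]_w (q s w)%:E)%E.
  rewrite -ge0_integralZl//; last first.
  - by move=> w _; rewrite lee_fin.
  - by apply/measurable_EFinP; exact: mq.
  by apply: eq_integral => w _; rewrite -EFinM /q mulrA mulfV// mul1r.
apply: (@le_trans _ _ (2%:E * ((1 + 4 * cN) * (2 * A) *
    expR ((lam + 2 * (2 * gam * (1 + 4 * cN))) * (s - t)))%:E)%E).
  apply: lee_wpmul2l => //; apply: key => //.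
  - move=> r w trT; apply: (le_trans (kq r w trT)).
    rewrite le_eqVlt; apply/orP; left; apply/eqP; rewrite /q.
    by field.
  move=> r trT; have [tr rT] := andP trT.
  have [J [hJ yJ]] := hX r trT; have [J' [hJ' yJ']] := hX' r trT.
  have mkr : measurable_fun (strip t r) (fun u : R * Omega => k u.1 u.2).
    apply: measurable_funS mk; first exact: measurable_strip.
    by move=> u /andP[tu ur]; rewrite /strip /= tu (le_trans ur).
  exists (fun w => `|J w - J' w|); split.
  - have [_ _ mJ _] := hJ; have [_ _ mJ' _] := hJ'.
    apply: (measurable_fun_subr (F := fun h => `|h|) sepH) => [U oU|U oU|].
    + by rewrite setTI; exact: mJ.
    + by rewrite setTI; exact: mJ'.
    + exact: norm_continuous.
  - move=> c c0.
    apply: (stochastic_integral_estimate P_complete hW sepH sepXi hE trT hJ hJ') => //.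
    move=> u w /andP[tu ur]; have tuT : t <= u <= T by rewrite tu (le_trans ur).
    apply: le_trans (hPhi u w tuT); apply: le_hs_sqnorm => xi /=.
    by rewrite -linearB Sc// subr_ge0.
  apply: filterS2 yJ yJ' => w [y [By Xy]] [y' [By' Xy']].
  exists `|y - y'|; split=> //.
    apply: (bochner_integral_estimate _ _ By By').
    - exact: measurable_itv.
    - by rewrite lebesgue_measure_itv/=; case: ifP => _; rewrite ?ltry// -EFinB ltry.
    - apply/measurable_EFinP.
      have mkE : measurable_fun (strip t r) (fun u : R * Omega => (k u.1 u.2)%:E).
        exact/measurable_EFinP.
      exact: (measurable_time_section mkE).
    - move=> u; rewrite /= in_itv /= => /andP[tu ur].
      have tuT : t <= u <= T by rewrite tu (le_trans ur).
      by apply: le_trans (hf u w tuT); rewrite -linearB Sc// subr_ge0.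
  rewrite /q.
  have -> : X r w - X' r w - S (r - t) (z - z') = (y - y') + (J w - J' w).
    rewrite Xy Xy' linearB -[_ + y + J w]addrA -[_ + y' + J' w]addrA !opprD addrACA.
    by rewrite opprK [- S _ _ + _]addrC subrK [S _ z + _]addrC addrK addrACA.
  by have := sqnormD_le (y - y') (J w - J' w); lra.
rewrite -EFinM lee_fin le_eqVlt; apply/orP; left; apply/eqP.
have -> : 2 * (2 * gam * (1 + 4 * cN)) = 4 * (gam * (1 + 4 * cN)) by ring.
by ring.
Qed.

Lemma progressive_section (V : topologicalType) (f : R -> Omega -> V) s U :
  t <= s <= T -> progressive P W t T f -> open U -> measurable (f s @^-1` U).
Proof.
move=> tsT pf oU; have tTT : t <= T <= T by rewrite tT lexx.
have := progressive_measurable P_complete hW tTT (lexx T) pf oU.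
move=> /(@measurable_xsection _ _ (measurableTypeR R) Omega _ s).
congr (measurable _); apply/seteqP; split => w; rewrite /xsection /= inE.
  by move=> [].
by move=> Ufw; split.
Qed.

End mild_processes.

Section constants.
Context {R : realType}.
Local Notation mu := (@lebesgue_measure R).

Lemma integral_itv_cst (t s c : R) : t <= s ->
  (\int[mu]_(r in `[t, s]) c%:E = (c * (s - t))%:E)%E.
Proof.
move=> ts; rewrite integral_cst//.
rewrite [X in (_ * X)%E](@lebesgue_measure_itv R `[t, s]) /= lte_fin; case: ltP => [_|st].
  by rewrite -EFinB -EFinM.
by have -> : s = t; [apply/eqP; rewrite eq_le st ts|rewrite subrr mulr0 mule0].
Qed.

Lemma integral_prob_cst d (Omega : measurableType d) (P : probability Omega R) (c : R) :
  (\int[P]_w c%:E = c%:E)%E.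
Proof.
by rewrite integral_cst//= [X in (_ * X)%E](@probability_setT _ _ _ P) mule1.
Qed.

(** Jensen's inequality through [2 f <= th + f^2 / th]; the choice [th = c + e] stays positive when
    [c = 0]. *)
Lemma integral_le_of_sqr d (Omega : measurableType d) (P : probability Omega R)
    (f : Omega -> R) (c : R) :
  measurable_fun setT f -> (forall w, 0 <= f w) -> 0 <= c ->
  (\int[P]_w (f w ^+ 2)%:E <= (c ^+ 2)%:E)%E -> (\int[P]_w (f w)%:E <= c%:E)%E.
Proof.
move=> mf f0 c0 fc; apply/lee_addgt0Pr => e e0; pose th := c + e.
have th0 : 0 < th by rewrite ltr_wpDl.
have h20 : 0 <= 2^-1 * th by rewrite mulr_ge0// ltW.
have h21 : 0 <= 2^-1 / th by rewrite divr_ge0// ltW.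
apply: (@le_trans _ _ (\int[P]_w ((2^-1 * th)%:E + (2^-1 / th)%:E * (f w ^+ 2)%:E))%E).
  apply: ge0_le_integral_nonmeas => w _; first by rewrite lee_fin.
  rewrite -EFinM -EFinD lee_fin -subr_ge0.
  have -> : 2^-1 * th + 2^-1 / th * f w ^+ 2 - f w = 2^-1 / th * (th - f w) ^+ 2.
    by field; rewrite gt_eqF.
  by rewrite mulr_ge0// sqr_ge0.
have mf2 : measurable_fun setT (fun w => (f w ^+ 2)%:E).
  by apply/measurable_EFinP; exact: measurable_funX.
have f20 w : (0 <= (f w ^+ 2)%:E)%E by rewrite lee_fin sqr_ge0.
rewrite ge0_integralD//; first last.
- exact: measurable_funeM.
- by move=> w _; rewrite mule_ge0.
rewrite ge0_integralZl// integral_prob_cst.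
apply: (@le_trans _ _ ((2^-1 * th)%:E + (2^-1 / th)%:E * (c ^+ 2)%:E)%E).
  by rewrite leeD2l// lee_wpmul2l ?lee_fin.
rewrite -EFinM -!EFinD lee_fin -/th.
have -> : 2^-1 * th + 2^-1 / th * c ^+ 2 = 2^-1 * th + 2^-1 * (c ^+ 2 / th).
  by field; rewrite gt_eqF.
have : c ^+ 2 / th <= th.
  by rewrite ler_pdivrMr// -expr2 ler_sqr ?nnegrE ?(ltW th0)// /th lerDl ltW.
by lra.
Qed.

Lemma ae_lt_pinfty d (Omega : measurableType d) (P : probability Omega R)
    (F : Omega -> \bar R) :
  measurable_fun setT F -> (forall w, 0 <= F w)%E -> (\int[P]_w F w < +oo)%E ->
  {ae P, forall w, (F w < +oo)%E}.
Proof.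
move=> mF F0 Ffin; have iF : P.-integrable setT F.
  apply/integrableP; split=> //; apply: le_lt_trans Ffin.
  by apply: ge0_le_integral_nonmeas => w _ //; rewrite gee0_abs.
by apply: filterS (integrable_ae measurableT iF) => w /(_ Logic.I); rewrite ge0_fin_numE.
Qed.

(** The functions may change sign; their difference is replaced by its positive part, to which it is
    almost everywhere equal. *)
Lemma ae_le_integral d (Omega : measurableType d) (m : {measure set Omega -> \bar R})
    (f h : Omega -> \bar R) :
  m.-integrable setT f -> m.-integrable setT h ->
  {ae m, forall w, (f w <= h w)%E} -> (\int[m]_w f w <= \int[m]_w h w)%E.
Proof.
move=> fi hi fh; have ffin := integrable_fin_num measurableT fi.
rewrite -sube_ge0 ?ffin//.
rewrite -integralB//; set k := (fun w => _).
have /integrableP[mk _] : m.-integrable setT k by exact: integrableB.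
rewrite (@ae_eq_integral _ _ _ _ setT (fun w => maxe (k w) 0%E) k)//.
- by apply: integral_ge0 => w _; rewrite le_max lexx orbT.
- exact: measurable_maxe.
apply: filterS2 fh (integrable_ae measurableT fi) => w fhw /(_ Logic.I) ffw _.
by rewrite (max_idPl _)// /k sube_ge0 ?ffw.
Qed.

Lemma path_bounded (V : normedModType R) (t T : R) (f : R -> V) : t <= T ->
  {within `[t, T], continuous f} ->
  exists M : R, forall s, t <= s <= T -> `|f s| <= M.
Proof.
move=> tT cf; have [|c _ hc] := @EVT_max R (fun s => `|f s|) t T tT.
  move=> s; apply: (@continuous_comp _ _ _ (f : subspace `[t, T]%classic -> V) (fun v : V => `|v|)).
    exact: cf.
  exact: norm_continuous.
by exists `|f c| => s sT; apply: hc; rewrite in_itv.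
Qed.

End constants.

(** * Weak distance and second moments of solutions *)

Section solutions.
Context {R : realType} {H Xi : hilbertType R} {Lam : completeNormedModType R}.
Context {d : measure_display} {Omega : measurableType d}.
Variables (P : probability Omega R) (W : R -> Xi -> Omega -> R) (t T : R).
Hypothesis P_complete : measure_is_complete P.
Hypothesis hW : cylindrical_wiener P W t T.
Hypothesis sepH : separable_space H.
Hypothesis sepXi : separable_space Xi.
Hypothesis sepLam : separable_space Lam.
Variable E : set Xi.
Hypothesis hE : orthonormal_basis E.
Variable S : R -> {linear H -> H}.
Hypothesis S_semigroup : contraction_semigroup S.
Hypothesis tT : t <= T.
Variable B : {linear H -> H}.
Hypothesis B_cont : continuous B.
Hypothesis B_sym : forall x y, inner (B x) y = inner x (B y).
Hypothesis B_gt0 : forall x, x != 0 -> 0 < inner (B x) x.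
Variables (M c0 : R).
Hypothesis M0 : 0 < M.
Hypothesis BM : forall x, inner (B x) x <= M * `|x| ^+ 2.
Hypothesis c00 : 0 <= c0.
Hypothesis SB : forall s x, 0 <= s ->
  inner (B (S s x)) (S s x) <= expR (2 * c0 * s) * inner (B x) x.
Variables (L0 : set Lam) (p C : R).
Hypothesis p2 : 2 < p.
Hypothesis C0 : 0 < C.
Variables (b : H -> Lam -> H) (sigma : H -> Lam -> {linear Xi -> H}).
Hypothesis sigma_hs : forall x a, hilbert_schmidt E (sigma x a).
Hypothesis coef : forall x x' a, L0 a ->
  [/\ `|b x a - b x' a| <= C * norm_m1 B (x - x'),
      hs_norm E (sigma x a \- sigma x' a) <= C * norm_m1 B (x - x'),
      `|b x a| <= C * (1 + `|x| + `|a|)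
    & hs_norm E (sigma x a) <= C * (1 + `|x| + `|a|)].
Local Notation mu := (@lebesgue_measure R).
Local Notation cN := (@normal_variance R).
Local Notation N x := (inner (B x) x).
Local Notation control a := (admissible_controls P W L0 p t T a).
Local Notation solution := (is_mild_solution P W E S b sigma t T).

Lemma solution_measurable x a X s U : solution x a X -> t <= s <= T -> open U ->
  measurable (X s @^-1` U).
Proof.
by move=> [pX _ _] tsT; exact: (progressive_section P_complete hW tT tsT pX).
Qed.

Lemma progressive_strip (V : topologicalType) (f : R -> Omega -> V) U :
  progressive P W t T f -> open U ->
  measurable (strip t T `&` (fun z : R * Omega => f z.1 z.2) @^-1` U).
Proof.
move=> pf; have tTT : t <= T <= T by rewrite tT lexx.
exact: (progressive_measurable P_complete hW tTT (lexx T) pf).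
Qed.

Lemma measurable_norm_progressive (V : normedModType R) (f : R -> Omega -> V) :
  progressive P W t T f ->
  measurable_fun (strip t T) (fun z : R * Omega => `|f z.1 z.2|).
Proof.
move=> pf; apply: (measurable_fun_comp_continuous (F := fun v : V => `|v|)).
  by move=> U oU; exact: progressive_strip.
exact: norm_continuous.
Qed.

(** With [lam = 1 + 2 c0] and [gam = 2 C^2 M] this is the rate [lam + 4 gam (1 + 4 cN)] of
    [mild_process_estimate]. The factor below adds [2], from splitting off the initial datum, to the
    product of [2 M], [4 (1 + 4 cN)] and [2 C^2]. Neither involves [T]. *)
Definition difference_rate : R := 1 + 2 * c0 + 4 * (2 * C ^+ 2 * M * (1 + 4 * cN)).
Definition difference_factor : R := 2 + 16 * M * C ^+ 2 * (1 + 4 * cN).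

Let cN0 : 0 <= cN. Proof. exact: normal_variance_ge0. Qed.

(** The loop closes through [BM]: the weak norm in [k] is split into the propagated initial datum,
    controlled by [SB], and the deviation, whose weak norm is bounded by its norm in [H]. *)
Lemma solution_difference x x' a X X' : control a ->
  solution x a X -> solution x' a X' ->
  forall s, t <= s <= T ->
  (\int[P]_w (N (X s w - X' s w))%:E <=
     (difference_factor * expR ((difference_rate + 1) * (T - t)) * N (x - x'))%:E)%E.
Proof.
move=> [aL0 pa _] sX sX' s tsT; have [pX cX hX] := sX; have [pX' cX' hX'] := sX'.
set z := x - x'; have Nz0 : 0 <= N z by exact: weak_sqnorm_ge0.
pose k r w := C * norm_m1 B (X r w - X' r w).
have k2 r w : k r w ^+ 2 = C ^+ 2 * N (X r w - X' r w).
  by rewrite exprMn sqr_norm_m1.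
have mk : measurable_fun (strip t T) (fun u : R * Omega => k u.1 u.2).
  apply: measurable_funM => //; apply: (measurable_fun_subr (F := norm_m1 B) sepH) => [U oU|U oU|].
  - exact: progressive_strip pX oU.
  - exact: progressive_strip pX' oU.
  - exact: continuous_norm_m1.
pose al (r : R) (w : Omega) := 2 * C ^+ 2 * (expR (2 * c0 * (r - t)) * N z).
have mal : measurable_fun (strip t T) (fun u : R * Omega => al u.1 u.2).
  apply: measurable_funTS; apply: measurable_funM => //; apply: measurable_funM => //.
  apply: measurableT_comp => //; apply: measurable_funM => //.
  exact: measurable_funB.
have al0 r w : t <= r <= T -> 0 <= al r w.
  move=> _; apply: mulr_ge0; first by rewrite mulr_ge0// sqr_ge0.
  by rewrite mulr_ge0// expR_ge0.
have split_N r w : t <= r -> N (X r w - X' r w) <=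
    2 * (expR (2 * c0 * (r - t)) * N z) + 2 * (M * `|X r w - X' r w - S (r - t) z| ^+ 2).
  move=> tr; rewrite -{1 2}[X r w - X' r w](subrKC (S (r - t) z)).
  apply: (le_trans (weak_sqnormD_le B_sym B_gt0 _ _)); apply: lerD.
    by rewrite ler_wpM2l// SB// subr_ge0.
  by rewrite ler_wpM2l.
(* The weight has to beat the growth [expR (2 * c0 * (r - t))] of [al]; with the rate [1 + 2 * c0]
   their product is [expR (t - r) <= 1]. *)
have lam1 : 1 <= 1 + 2 * c0 by rewrite lerDl mulr_ge0.
have gam0 : 0 < 2 * C ^+ 2 * M by rewrite !mulr_gt0// exprn_gt0.
(* Continuity of trajectories alone gives this: paths are bounded on the compact interval. *)
have kfin : {ae P, forall w, (time_energy t T k w < +oo)%E}.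
  apply: filterS2 cX cX' => w cXw cXw'.
  have [m1 h1] := path_bounded tT cXw; have [m2 h2] := path_bounded tT cXw'.
  apply: (@le_lt_trans _ _ (\int[mu]_(r in `[t, T]) (C ^+ 2 * (M * (m1 + m2) ^+ 2))%:E)%E); last first.
    by rewrite integral_itv_cst// ltry.
  apply: ge0_le_integral_nonmeas => r; rewrite /= in_itv /= => trT.
    by rewrite lee_fin sqr_ge0.
  rewrite lee_fin k2 ler_wpM2l ?sqr_ge0// (le_trans (BM _))// ler_wpM2l ?(ltW M0)//.
  rewrite lerXn2r ?nnegrE// ?(le_trans (ler_normB _ _))// ?lerD ?h1 ?h2//.
  by apply: addr_ge0; [exact: le_trans (h1 r trT)|exact: le_trans (h2 r trT)].
have hf r w : t <= r <= T -> `|b (X r w) (a r w) - b (X' r w) (a r w)| <= k r w.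
  by move=> trT; have [] := coef (X r w) (X' r w) (aL0 r w trT).
have hs r w : t <= r <= T ->
   (hs_sqnorm E (sigma (X r w) (a r w) \- sigma (X' r w) (a r w))%R <= (k r w ^+ 2)%:E)%E.
  move=> trT; have [_ + _ _] := coef (X r w) (X' r w) (aL0 r w trT).
  apply: hs_sqnorm_le_sqr.
    have [_ h1] := sigma_hs (X r w) (a r w); have [_ h2] := sigma_hs (X' r w) (a r w).
    by apply: (le_lt_trans (hs_sqnormB _ _ _)); rewrite lte_add_pinfty// lte_mul_pinfty// lee_fin.
  by rewrite mulr_ge0 ?norm_m1_ge0// ltW.
have kq r w : t <= r <= T -> k r w ^+ 2 <= al r w +
    2 * C ^+ 2 * M * `|X r w - X' r w - S (r - t) (x - x')| ^+ 2.
  move=> /andP[tr _]; rewrite k2 (le_trans (ler_wpM2l _ (split_N r w tr))) ?sqr_ge0//.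
  by rewrite /al le_eqVlt; apply/orP; left; apply/eqP; rewrite /z; ring.
have aA : (\int[P]_w \int[mu]_(r in `[t, T])
    (expR ((1 + 2 * c0) * (t - r)) * al r w)%:E <= (2 * C ^+ 2 * N z * (T - t))%:E)%E.
  rewrite -(integral_prob_cst P); apply: ge0_le_integral_nonmeas => w _.
    apply: integral_ge0 => r; rewrite /= in_itv /= => trT.
    by rewrite lee_fin mulr_ge0 ?expR_ge0// al0.
  rewrite -integral_itv_cst//; apply: ge0_le_integral_nonmeas => r; rewrite /= in_itv /= => trT.
    by rewrite lee_fin mulr_ge0 ?expR_ge0// al0.
  rewrite lee_fin /al.
  have -> : expR ((1 + 2 * c0) * (t - r)) * (2 * C ^+ 2 * (expR (2 * c0 * (r - t)) * N z)) =
     expR ((1 + 2 * c0) * (t - r)) * expR (2 * c0 * (r - t)) * (2 * C ^+ 2 * N z) by ring.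
  have F0 : 0 <= 2 * C ^+ 2 * N z by apply: mulr_ge0 => //; rewrite mulr_ge0// sqr_ge0.
  rewrite -expRD ler_piMl//.
  rewrite -[leRHS]expR0 ler_expR.
  have -> : (1 + 2 * c0) * (t - r) + 2 * c0 * (r - t) = t - r by ring.
  by rewrite subr_le0; case/andP: trT.
have est := mild_process_estimate P_complete hW sepH sepXi hE S_semigroup tT lam1 gam0 mk
  mal al0 (fun s U => @solution_measurable _ _ _ s U sX) (fun s U => @solution_measurable _ _ _ s U sX')
  kfin hf hs hX hX' kq aA tsT.
have [ts sT] := andP tsT.
apply: (@le_trans _ _ (\int[P]_w ((2 * (expR (2 * c0 * (s - t)) * N z))%:E +
    (2 * M)%:E * (`|X s w - X' s w - S (s - t) z| ^+ 2)%:E))%E).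
  apply: ge0_le_integral_nonmeas => w _; first by rewrite lee_fin weak_sqnorm_ge0.
  by rewrite -EFinM -EFinD lee_fin -[2 * M * _]mulrA; exact: split_N.
have M20 : 0 <= 2 * M by rewrite mulr_ge0// ltW.
have mq : measurable_fun setT (fun w => (`|X s w - X' s w - S (s - t) z| ^+ 2)%:E).
  apply/measurable_EFinP.
  apply: (measurable_fun_subr (F := fun h => `|h - S (s - t) z| ^+ 2) sepH) => [U oU|U oU|].
  - by rewrite setTI; exact: solution_measurable sX tsT oU.
  - by rewrite setTI; exact: solution_measurable sX' tsT oU.
  - exact: continuous_sqnormB.
have e0 : 0 <= 2 * (expR (2 * c0 * (s - t)) * N z).
  by rewrite !mulr_ge0// expR_ge0.
rewrite ge0_integralD//; first last.
- exact: measurable_funeM.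
- by move=> w _; rewrite mule_ge0// lee_fin sqr_ge0.
rewrite integral_prob_cst ge0_integralZl//.
apply: (le_trans (leeD2l _ (lee_wpmul2l _ est))); first by rewrite lee_fin.
rewrite -EFinM -EFinD lee_fin -/difference_rate.
set u := T - t; have u0 : 0 <= u by rewrite subr_ge0.
have rate0 : 0 <= difference_rate.
  by rewrite /difference_rate !addr_ge0// !mulr_ge0 ?sqr_ge0 ?addr_ge0 ?mulr_ge0// ltW.
set e := expR (difference_rate * u); have eg0 : 0 <= e by exact: expR_ge0.
have e1 : 1 <= expR u by rewrite -[leLHS]expR0 ler_expR.
(* This turns the factor [T - t] into an exponential and accounts for the [+ 1] added to the
   rate. *)
have eu : u <= expR u by rewrite (le_trans _ (expR_ge1Dx u))// lerDr.
have h1 : expR (2 * c0 * (s - t)) <= e.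
  rewrite ler_expR ler_pM ?mulr_ge0 ?subr_ge0//; last by rewrite lerB.
  by rewrite /difference_rate -addrA addrCA lerDl addr_ge0// !mulr_ge0 ?sqr_ge0 ?addr_ge0 ?mulr_ge0// ltW.
have h2 : expR (difference_rate * (s - t)) <= e by rewrite ler_expR ler_wpM2l// lerB.
have -> : expR ((difference_rate + 1) * u) = e * expR u by rewrite mulrDl mul1r expRD.
have K0 : 0 <= 16 * M * C ^+ 2 * (1 + 4 * cN).
  by rewrite !mulr_ge0 ?sqr_ge0 ?addr_ge0 ?mulr_ge0// ltW.
have -> : 2 * M * (4 * (1 + 4 * cN) * (2 * C ^+ 2 * N z * u) * expR (difference_rate * (s - t))) =
   16 * M * C ^+ 2 * (1 + 4 * cN) * N z * (u * expR (difference_rate * (s - t))) by ring.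
have h3 : u * expR (difference_rate * (s - t)) <= expR u * e by rewrite ler_pM// expR_ge0.
have h4 : expR (2 * c0 * (s - t)) <= expR u * e by rewrite (le_trans h1)// ler_peMl.
have -> : difference_factor * (e * expR u) * N z = 2 * (expR u * e * N z) +
   16 * M * C ^+ 2 * (1 + 4 * cN) * N z * (expR u * e) by rewrite /difference_factor; ring.
apply: lerD; first by rewrite ler_wpM2l// ler_wpM2r.
by rewrite ler_wpM2l// mulr_ge0.
Qed.

Let ET (f : R * Omega -> \bar R) := (\int[P]_w \int[mu]_(r in `[t, T]) f (r, w))%E.

Let ETD f h : measurable_fun (strip t T) f -> measurable_fun (strip t T) h ->
  (forall z, strip t T z -> 0 <= f z)%E -> (forall z, strip t T z -> 0 <= h z)%E ->
  (ET (fun z => f z + h z) = ET f + ET h)%E.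
Proof.
move=> mf mh f0 h0; rewrite /ET -ge0_integralD//; first last.
- exact: measurable_time_integral.
- move=> w _; apply: integral_ge0 => r; rewrite /= in_itv /= => trT; exact: h0.
- exact: measurable_time_integral.
- move=> w _; apply: integral_ge0 => r; rewrite /= in_itv /= => trT; exact: f0.
apply: eq_integral => w _; rewrite ge0_integralD//.
- by move=> r; rewrite /= in_itv /= => trT; exact: f0.
- exact: measurable_time_section.
- by move=> r; rewrite /= in_itv /= => trT; exact: h0.
- exact: measurable_time_section.
Qed.

Let ETZ (c : R) f : measurable_fun (strip t T) f ->
  (forall z, strip t T z -> 0 <= f z)%E -> 0 <= c ->
  (ET (fun z => c%:E * f z) = c%:E * ET f)%E.
Proof.
move=> mf f0 c0'; rewrite /ET -ge0_integralZl//; first last.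
- move=> w _; apply: integral_ge0 => r; rewrite /= in_itv /= => trT; exact: f0.
- exact: measurable_time_integral.
apply: eq_integral => w _; rewrite ge0_integralZl//.
- exact: measurable_time_section.
- by move=> r; rewrite /= in_itv /= => trT; exact: f0.
Qed.

Let ET_cst (c : R) : ET (fun=> c%:E) = (c * (T - t))%:E.
Proof.
rewrite -[RHS](integral_prob_cst P); apply: eq_integral => w _.
exact: integral_itv_cst.
Qed.

Let le_ET f h : (forall z, strip t T z -> 0 <= f z)%E ->
  (forall z, strip t T z -> f z <= h z)%E -> (ET f <= ET h)%E.
Proof.
move=> f0 fh; apply: ge0_le_integral_nonmeas => w _.
  by apply: integral_ge0 => r; rewrite /= in_itv /= => trT; exact: f0.
apply: ge0_le_integral_nonmeas => r; rewrite /= in_itv /= => trT; first exact: f0.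
exact: fh.
Qed.

(** Since [p > 2], one has [|a|^2 <= 1 + |a|^p] pointwise. *)
Lemma control_sqr_integrable a : control a -> exists2 al : R, 0 <= al &
  (\int[P]_w \int[mu]_(r in `[t, T]) (`|a r w| ^+ 2)%:E <= al%:E)%E.
Proof.
move=> [_ pa afin].
have mp : measurable_fun (strip t T) (fun z : R * Omega => (`|a z.1 z.2| `^ p)%:E).
  apply/measurable_EFinP; apply: (measurableT_comp (measurable_powR p)).
  exact: measurable_norm_progressive.
have p0 z : (0 <= (`|a z.1 z.2| `^ p)%:E)%E by rewrite lee_fin powR_ge0.
have ET0 : (0 <= ET (fun z => (`|a z.1 z.2| `^ p)%:E))%E.
  by apply: integral_ge0 => w _; apply: integral_ge0 => r _; exact: (p0 (r, w)).
have ETfin : ET (fun z => (`|a z.1 z.2| `^ p)%:E) \is a fin_num by rewrite ge0_fin_numE.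
exists (1 * (T - t) + fine (ET (fun z => (`|a z.1 z.2| `^ p)%:E))).
  by rewrite addr_ge0 ?fine_ge0// mul1r subr_ge0.
rewrite EFinD -ET_cst (fineK ETfin) -ETD//; try by move=> z _; rewrite ?lee_fin.
apply: (@le_ET (fun z => (`|a z.1 z.2| ^+ 2)%:E)) => z _.
  by rewrite lee_fin sqr_ge0.
rewrite -EFinD lee_fin; have [a1|a1] := leP `|a z.1 z.2| 1.
  rewrite (@le_trans _ _ 1)//; first by rewrite -(expr1n _ 2) lerXn2r// nnegrE.
  by rewrite lerDl powR_ge0.
rewrite (@le_trans _ _ (`|a z.1 z.2| `^ p))//; last by rewrite lerDr.
by rewrite -powR_mulrn// ler_powR// ltW.
Qed.

(** Here [al] is a bound on the control energy. The second term is twice the bound of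
    [mild_process_estimate] for [lam = 1] and [gam = 6 C^2]. The dependence on [T] is harmless, as
    the bound only makes costs finite. *)
Definition moment_bound (x : H) (al : R) : R := 2 * `|x| ^+ 2 + 8 * (1 + 4 * cN) *
  (3 * C ^+ 2 * ((1 + 2 * `|x| ^+ 2) * (T - t) + al)) *
  expR ((1 + 4 * (6 * C ^+ 2 * (1 + 4 * cN))) * (T - t)).

(** Linear growth gives [k^2 <= 3 C^2 (1 + |X|^2 + |a|^2)], and [|X|^2 <= 2 |x|^2 + 2 |X - S x|^2]
    brings this into the form required for the comparison with zero, with [gam = 6 C^2]. *)
Lemma solution_moment x a X al : control a -> solution x a X -> 0 <= al ->
  (\int[P]_w \int[mu]_(r in `[t, T]) (`|a r w| ^+ 2)%:E <= al%:E)%E ->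
  forall s, t <= s <= T -> (\int[P]_w (`|X s w| ^+ 2)%:E <= (moment_bound x al)%:E)%E.
Proof.
move=> [aL0 pa _] sX al0 aal s tsT; have [pX cX hX] := sX.
have C20 : 0 <= C ^+ 2 by exact: sqr_ge0.
have mX2 := measurable_norm_progressive pX; have ma2 := measurable_norm_progressive pa.
pose k r w := C * (1 + `|X r w| + `|a r w|).
have mk : measurable_fun (strip t T) (fun u : R * Omega => k u.1 u.2).
  by apply: measurable_funM => //; apply: measurable_funD => //; exact: measurable_funD.
pose be r w := 3 * C ^+ 2 * (1 + 2 * `|x| ^+ 2 + `|a r w| ^+ 2).
have mbe : measurable_fun (strip t T) (fun u : R * Omega => be u.1 u.2).
  by apply: measurable_funM => //; apply: measurable_funD => //; exact: measurable_funX.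
have be0 r w : t <= r <= T -> 0 <= be r w.
  by move=> _; apply: mulr_ge0; [rewrite mulr_ge0|rewrite !addr_ge0// ?mulr_ge0// sqr_ge0].
have k2 r w : k r w ^+ 2 <= 3 * C ^+ 2 * (1 + `|X r w| ^+ 2 + `|a r w| ^+ 2).
  rewrite /k exprMn [3 * _]mulrC -[leRHS]mulrA ler_wpM2l// -subr_ge0.
  move: (`|X r w|) (`|a r w|) => u v.
  have -> : 3 * (1 + u ^+ 2 + v ^+ 2) - (1 + u + v) ^+ 2 =
    (1 - u) ^+ 2 + (1 - v) ^+ 2 + (u - v) ^+ 2 by ring.
  by rewrite !addr_ge0// sqr_ge0.
have ma2E : measurable_fun (strip t T) (fun z : R * Omega => (`|a z.1 z.2| ^+ 2)%:E).
  by apply/measurable_EFinP; exact: measurable_funX.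
have a20 z : strip t T z -> (0 <= (`|a z.1 z.2| ^+ 2)%:E)%E.
  by move=> _; rewrite lee_fin sqr_ge0.
(* The state part is bounded along continuous paths; the control part is almost surely finite
   because its expectation is at most [al]. *)
have kfin : {ae P, forall w, (time_energy t T k w < +oo)%E}.
  have afin : {ae P, forall w, (\int[mu]_(r in `[t, T]) (`|a r w| ^+ 2)%:E < +oo)%E}.
    apply: ae_lt_pinfty.
    - exact: (measurable_time_integral ma2E).
    - by move=> w; apply: integral_ge0 => r _; rewrite lee_fin sqr_ge0.
    - by apply: (le_lt_trans aal); rewrite ltry.
  apply: filterS2 cX afin => w cXw aw.
  have [m h] := path_bounded tT cXw.
  have mt : t <= t <= T by rewrite lexx tT.
  have m0 : 0 <= m by exact: le_trans (h t mt).
  have c1 : 0 <= 3 * C ^+ 2 * (1 + m ^+ 2).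
    by apply: mulr_ge0; [rewrite mulr_ge0|rewrite addr_ge0// sqr_ge0].
  have c2 : 0 <= 3 * C ^+ 2 by rewrite mulr_ge0.
  apply: (@le_lt_trans _ _ (\int[mu]_(r in `[t, T]) ((3 * C ^+ 2 * (1 + m ^+ 2))%:E +
      (3 * C ^+ 2)%:E * (`|a r w| ^+ 2)%:E))%E).
    apply: ge0_le_integral_nonmeas => r; rewrite /= in_itv /= => trT.
      by rewrite lee_fin sqr_ge0.
    rewrite -EFinM -EFinD lee_fin -mulrDr (le_trans (k2 r w))// ler_wpM2l//.
    by rewrite lerD2r lerD2l lerXn2r ?nnegrE// h.
  have msec := measurable_time_section ma2E w.
  rewrite ge0_integralD//; first last.
  - exact: measurable_funeM.
  - by move=> r _; rewrite mule_ge0// lee_fin sqr_ge0.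
  rewrite integral_itv_cst// ge0_integralZl//.
  by rewrite lte_add_pinfty ?ltry// lte_mul_pinfty// lee_fin.
have lam1 : (1 : R) <= 1 by [].
have gam0 : 0 < 6 * C ^+ 2 by rewrite mulr_gt0// exprn_gt0.
have S0 (u : H) (r : R) : t <= r -> `|S (r - t) u| <= `|u|.
  by move=> tr; have [_ _ Sc _] := S_semigroup; rewrite Sc// subr_ge0.
have splitX r w : t <= r -> `|X r w| ^+ 2 <= 2 * `|x| ^+ 2 + 2 * `|X r w - 0 - S (r - t) (x - 0)| ^+ 2.
  move=> tr; rewrite !subr0 -{1}[X r w](subrKC (S (r - t) x)).
  apply: (le_trans (sqnormD_le _ _)); rewrite lerD2r ler_wpM2l//.
  by rewrite lerXn2r ?nnegrE// S0.
have kq r w : t <= r <= T -> k r w ^+ 2 <= be r w +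
    6 * C ^+ 2 * `|X r w - 0 - S (r - t) (x - 0)| ^+ 2.
  move=> /andP[tr _]; apply: (le_trans (k2 r w)).
  have := splitX r w tr; rewrite /be; move: (`|X r w| ^+ 2) (`|_ - _| ^+ 2) (`|a r w| ^+ 2) (`|x| ^+ 2).
  by move=> u v q y uv; move: C20; nra.
have aA : (\int[P]_w \int[mu]_(r in `[t, T]) (expR (1 * (t - r)) * be r w)%:E <=
    (3 * C ^+ 2 * ((1 + 2 * `|x| ^+ 2) * (T - t) + al))%:E)%E.
  have c2 : 0 <= 3 * C ^+ 2 by rewrite mulr_ge0.
  have c1 : 0 <= 3 * C ^+ 2 * (1 + 2 * `|x| ^+ 2).
    by apply: mulr_ge0 => //; rewrite addr_ge0// mulr_ge0// sqr_ge0.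
  apply: (@le_trans _ _ (ET (fun z => (3 * C ^+ 2 * (1 + 2 * `|x| ^+ 2))%:E +
      (3 * C ^+ 2)%:E * (`|a z.1 z.2| ^+ 2)%:E))%E).
    apply: (@le_ET (fun z => (expR (1 * (t - z.1)) * be z.1 z.2)%:E)) => -[r w] trT.
      by rewrite lee_fin mulr_ge0 ?expR_ge0// be0.
    rewrite -EFinM -EFinD lee_fin -mulrDr -/(be r w) ler_piMl ?be0//.
    by rewrite -[leRHS]expR0 ler_expR mul1r subr_le0; case/andP: trT.
  rewrite ETD//; first last.
  - by move=> z tz; rewrite mule_ge0 ?a20// lee_fin.
  - exact: measurable_funeM.
  rewrite ET_cst ETZ//.
  have -> : (3 * C ^+ 2 * ((1 + 2 * `|x| ^+ 2) * (T - t) + al))%:E =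
    ((3 * C ^+ 2 * (1 + 2 * `|x| ^+ 2) * (T - t))%:E + (3 * C ^+ 2)%:E * al%:E)%E.
    by rewrite -EFinM -EFinD; congr EFin; ring.
  by apply: leeD => //; apply: lee_wpmul2l; rewrite ?lee_fin.
have hf r w : t <= r <= T -> `|b (X r w) (a r w) - 0| <= k r w.
  by move=> trT; rewrite subr0; have [] := coef (X r w) (X r w) (aL0 r w trT).
have hs r w : t <= r <= T ->
   (hs_sqnorm E (sigma (X r w) (a r w) \- (fun=> 0))%R <= (k r w ^+ 2)%:E)%E.
  move=> trT; have [_ _ _ h] := coef (X r w) (X r w) (aL0 r w trT).
  apply: (@le_trans _ _ (hs_sqnorm E (sigma (X r w) (a r w)))).
    by apply: le_hs_sqnorm => xi /=; rewrite subr0.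
  apply: hs_sqnorm_le_sqr => //; first by have [] := sigma_hs (X r w) (a r w).
  by rewrite mulr_ge0 ?addr_ge0// ltW.
have m0 r U : t <= r <= T -> open U -> measurable ((fun=> 0 : H) @^-1` U : set Omega).
  by move=> _ _; rewrite preimage_cst; case: ifPn.
have mp0 : mild_process P W t T E S 0 (fun=> fun=> 0) (fun=> fun=> fun=> 0) (fun=> fun=> 0).
  exact: mild_process0.
have est := mild_process_estimate P_complete hW sepH sepXi hE S_semigroup tT lam1 gam0 mk
  mbe be0 (fun s U => @solution_measurable _ _ _ s U sX) m0
  kfin hf hs hX mp0 kq aA tsT.
have [ts sT] := andP tsT.
apply: (@le_trans _ _ (\int[P]_w ((2 * `|x| ^+ 2)%:E +
    2%:E * (`|X s w - 0 - S (s - t) (x - 0)| ^+ 2)%:E))%E).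
  apply: ge0_le_integral_nonmeas => w _; first by rewrite lee_fin sqr_ge0.
  by rewrite -EFinM -EFinD lee_fin; exact: splitX.
have mq : measurable_fun setT (fun w => (`|X s w - 0 - S (s - t) (x - 0)| ^+ 2)%:E).
  apply/measurable_EFinP.
  apply: (measurable_fun_subr (F := fun h => `|h - S (s - t) (x - 0)| ^+ 2) sepH) => [U oU|U oU|].
  - by rewrite setTI; exact: solution_measurable sX tsT oU.
  - by rewrite setTI; exact: m0 tsT oU.
  - exact: continuous_sqnormB.
rewrite ge0_integralD//; last exact: measurable_funeM.
rewrite integral_prob_cst ge0_integralZl//.
apply: (le_trans (leeD2l _ (lee_wpmul2l _ est))) => //.
rewrite -EFinM -EFinD lee_fin /moment_bound lerD2l.
set A := 3 * C ^+ 2 * _.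
have A0 : 0 <= A.
  apply: mulr_ge0; first by rewrite mulr_ge0.
  by rewrite addr_ge0// mulr_ge0 ?subr_ge0// addr_ge0// mulr_ge0// sqr_ge0.
have -> : 2 * (4 * (1 + 4 * cN) * A * expR ((1 + 4 * (6 * C ^+ 2 * (1 + 4 * cN))) * (s - t))) =
  8 * (1 + 4 * cN) * A * expR ((1 + 4 * (6 * C ^+ 2 * (1 + 4 * cN))) * (s - t)) by ring.
have D0 : 0 <= 1 + 4 * cN by rewrite addr_ge0// mulr_ge0.
rewrite ler_wpM2l//; first by rewrite mulr_ge0// mulr_ge0.
rewrite ler_expR ler_wpM2l ?lerB//.
by rewrite addr_ge0// mulr_ge0// mulr_ge0// mulr_ge0.
Qed.

(** * Costs and value function *)

Variables (l : H -> Lam -> R) (g : H -> R) (G : R).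
Hypothesis L0_neq0 : L0 !=set0.
Hypothesis G0 : 0 < G.
Hypothesis l_cont :
  {within [set: H] `*` L0, continuous (fun z : H * Lam => l z.1 z.2)}.
Hypothesis cost_coef : forall x x' a, L0 a ->
  [/\ `|l x a - l x' a| <= G * norm_m1 B (x - x'),
      `|l x a| <= G * (1 + `|x| + `|a| ^+ 2)
    & `|g x - g x'| <= G * norm_m1 B (x - x')].

Let norm_m1_le x : norm_m1 B x <= Num.sqrt M * `|x|.
Proof.
rewrite /norm_m1 -[`|x| in leRHS]normr_id -sqrtr_sqr -sqrtrM; last exact: ltW.
by rewrite ler_wsqrtr.
Qed.

Let g_lip x x' : `|g x - g x'| <= G * norm_m1 B (x - x').
Proof. by have [a La] := L0_neq0; have [] := cost_coef x x' La. Qed.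

Let g_cont : continuous g.
Proof.
move=> x; apply/cvgrPdist_le => e e0; pose K := G * Num.sqrt M + 1.
have K0 : 0 < K by rewrite ltr_wpDl// mulr_ge0 ?sqrtr_ge0// ltW.
have h : \forall y \near x, `|x - y| <= e / K.
  have /cvgrPdist_le := @cvg_id _ (nbhs x); apply.
  by rewrite divr_gt0.
apply: filterS h => y; rewrite ler_pdivlMr// => h.
apply: (le_trans (g_lip _ _)); apply: le_trans h.
apply: (@le_trans _ _ (G * (Num.sqrt M * `|x - y|))); first by rewrite ler_wpM2l// ltW.
by rewrite mulrA mulrC ler_wpM2l// /K lerDl.
Qed.

Let F (a : R -> Omega -> Lam) (X : R -> Omega -> H) (w : Omega) : \bar R :=
  (\int[mu]_(r in `[t, T]) (l (X r w) (a r w))%:E + (g (X T w))%:E)%E.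

Let ml a X x : control a -> solution x a X ->
  measurable_fun (strip t T) (fun z : R * Omega => l (X z.1 z.2) (a z.1 z.2)).
Proof.
move=> [aL0 pa _] [pX _ _].
apply: (@measurable_fun_pair_within R _ _ H Lam L0 (strip t T) (fun z => X z.1 z.2)
  (fun z => a z.1 z.2) (fun u => l u.1 u.2)) => //.
- by move=> U oU; exact: progressive_strip pX oU.
- by move=> U oU; exact: progressive_strip pa oU.
- by move=> z tz; exact: aL0.
Qed.

Let tTT : t <= T <= T. Proof. by rewrite tT lexx. Qed.

Let mg a X x : solution x a X -> measurable_fun setT (fun w => g (X T w)).
Proof.
move=> sX; apply: (measurable_fun_comp_continuous (f := X T) (F := g)) => //.
by move=> U oU; rewrite setTI; exact: solution_measurable sX tTT oU.
Qed.

(** The running cost may change sign, so its time integral is split into positive and negative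
    parts, to which Tonelli applies. *)
Let mF a X x : control a -> solution x a X -> measurable_fun setT (F a X).
Proof.
move=> ca sX; apply: emeasurable_funD; last by apply/measurable_EFinP; exact: mg sX.
have mlE : measurable_fun (strip t T) (fun z : R * Omega => (l (X z.1 z.2) (a z.1 z.2))%:E).
  by apply/measurable_EFinP; exact: ml ca sX.
have -> : (fun w => \int[mu]_(r in `[t, T]) (l (X r w) (a r w))%:E)%E =
  (fun w => \int[mu]_(r in `[t, T]) ((fun z : R * Omega => (l (X z.1 z.2) (a z.1 z.2))%:E)^\+ (r, w)) -
     \int[mu]_(r in `[t, T]) ((fun z : R * Omega => (l (X z.1 z.2) (a z.1 z.2))%:E)^\- (r, w)))%E.
  apply/funext => w; rewrite [LHS]integralE; apply: f_equal2; [|congr (- _)%E];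
    by apply: eq_integral => r _; rewrite !(funeposE, funenegE).
apply: emeasurable_funB.
  by apply: measurable_time_integral => //; exact: measurable_funepos.
by apply: measurable_time_integral => //; exact: measurable_funeneg.
Qed.

(** From [u <= 1 + u^2]: the running cost is at most [G (2 + |X|^2 + |a|^2)] and the terminal cost
    at most [|g 0| + G + G M |X T|^2]. *)
Let cost_bound (x : H) (al : R) : R :=
  G * (2 * (T - t) + moment_bound x al * (T - t) + al) + (`|g 0| + G + G * M * moment_bound x al).

Let cost_terms_bound x a X al : control a -> solution x a X -> 0 <= al ->
  (\int[P]_w \int[mu]_(r in `[t, T]) (`|a r w| ^+ 2)%:E <= al%:E)%E ->
  (\int[P]_w (\int[mu]_(r in `[t, T]) (`|l (X r w) (a r w)|)%:E + (`|g (X T w)|)%:E)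
     <= (cost_bound x al)%:E)%E.
Proof.
move=> ca sX al0 aal; have [aL0 pa _] := ca; have [pX _ _] := sX.
have mom := solution_moment ca sX al0 aal.
have mX2 : measurable_fun (strip t T) (fun z : R * Omega => (`|X z.1 z.2| ^+ 2)%:E).
  by apply/measurable_EFinP; apply: measurable_funX; exact: measurable_norm_progressive.
have ma2 : measurable_fun (strip t T) (fun z : R * Omega => (`|a z.1 z.2| ^+ 2)%:E).
  by apply/measurable_EFinP; apply: measurable_funX; exact: measurable_norm_progressive.
have mla : measurable_fun (strip t T) (fun z : R * Omega => (`|l (X z.1 z.2) (a z.1 z.2)|)%:E).
  by apply/measurable_EFinP; apply: measurableT_comp => //; exact: ml ca sX.
have mga : measurable_fun setT (fun w => (`|g (X T w)|)%:E).
  by apply/measurable_EFinP; apply: measurableT_comp => //; exact: mg sX.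
have X20 z : strip t T z -> (0 <= (`|X z.1 z.2| ^+ 2)%:E)%E by rewrite lee_fin sqr_ge0.
have a20 z : strip t T z -> (0 <= (`|a z.1 z.2| ^+ 2)%:E)%E by rewrite lee_fin sqr_ge0.
rewrite ge0_integralD//; first last.
- by apply: (measurable_time_integral mla) => z _; rewrite lee_fin.
- by move=> w _; apply: integral_ge0 => r _; rewrite lee_fin.
rewrite [leRHS]EFinD; apply: leeD.
  apply: (@le_trans _ _ (ET (fun z => G%:E * (2%:E + `|X z.1 z.2|%:E ^+ 2 + (`|a z.1 z.2| ^+ 2)%:E)))%E).
    apply: (@le_ET (fun z => (`|l (X z.1 z.2) (a z.1 z.2)|)%:E)) => -[r w] trT.
      by rewrite lee_fin.
    rewrite -!EFinD -EFinM lee_fin; have [_ h _] := cost_coef (X r w) (X r w) (aL0 r w trT).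
    apply: (le_trans h); rewrite ler_wpM2l// ?(ltW G0)// lerD2r.
    by have := sqr_ge0 (`|X r w| - 2^-1); nra.
  have m20 : measurable_fun (strip t T) (fun z : R * Omega => 2%:E + (`|X z.1 z.2| ^+ 2)%:E)%E.
    exact: emeasurable_funD.
  have p20 z : strip t T z -> (0 <= 2%:E + (`|X z.1 z.2| ^+ 2)%:E)%E.
    by move=> tz; rewrite adde_ge0// X20.
  rewrite ETZ ?(ltW G0)//; first last.
  - by move=> z tz; rewrite adde_ge0 ?a20// p20.
  - exact: emeasurable_funD.
  rewrite EFinM lee_wpmul2l ?lee_fin ?(ltW G0)// ETD// ETD// ET_cst !EFinD.
  apply: leeD => //; apply: leeD => //.
  rewrite /ET (tonelli_time P mX2 X20) -integral_itv_cst//.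
  apply: ge0_le_integral_nonmeas => r; rewrite /= in_itv /= => trT; last exact: mom.
  by apply: integral_ge0 => w _; rewrite lee_fin sqr_ge0.
have GM0 : 0 <= G * M by rewrite mulr_ge0// ltW.
have gG0 : 0 <= `|g 0| + G by rewrite addr_ge0// ltW.
apply: (@le_trans _ _ (\int[P]_w ((`|g 0| + G)%:E + (G * M)%:E * (`|X T w| ^+ 2)%:E))%E).
  apply: ge0_le_integral_nonmeas => w _; first by rewrite lee_fin.
  rewrite -EFinM -EFinD lee_fin.
  have h1 : `|g (X T w)| <= `|g 0| + G * norm_m1 B (X T w - 0).
    rewrite -{1}[g (X T w)](subrKC (g 0)); apply: (le_trans (ler_normD _ _)).
    by rewrite lerD2l g_lip.
  rewrite subr0 in h1 *; apply: (le_trans h1); rewrite -addrA lerD2l -mulrA.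
  have -> : G + G * (M * `|X T w| ^+ 2) = G * (1 + M * `|X T w| ^+ 2) by ring.
  rewrite ler_wpM2l ?(ltW G0)//; have := BM (X T w); rewrite -(sqr_norm_m1 B_gt0).
  by have := sqr_ge0 (norm_m1 B (X T w) - 2^-1); move: (norm_m1 B _) (M * _) => u v; nra.
have mXT : measurable_fun setT (fun w => (`|X T w| ^+ 2)%:E).
  exact: (measurable_space_section mX2 tTT).
rewrite ge0_integralD//; last 2 first.
- by move=> w _; rewrite mule_ge0// lee_fin sqr_ge0.
- exact: measurable_funeM.
rewrite integral_prob_cst ge0_integralZl// [leRHS]EFinD; apply: leeD => //.
by rewrite [leRHS]EFinM; apply: lee_wpmul2l; [rewrite lee_fin|exact: mom].
Qed.

Let cost_integrable x a X al : control a -> solution x a X -> 0 <= al ->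
  (\int[P]_w \int[mu]_(r in `[t, T]) (`|a r w| ^+ 2)%:E <= al%:E)%E ->
  P.-integrable setT (F a X) /\ (`|cost P l g t T a X| <= (cost_bound x al)%:E)%E.
Proof.
move=> ca sX al0 aal; have bnd := cost_terms_bound ca sX al0 aal.
have mlE : measurable_fun (strip t T) (fun z : R * Omega => (l (X z.1 z.2) (a z.1 z.2))%:E).
  by apply/measurable_EFinP; exact: ml ca sX.
have bnd' : (\int[P]_w `|F a X w| <= (cost_bound x al)%:E)%E.
  apply: le_trans bnd; apply: ge0_le_integral_nonmeas => w _ //.
  apply: (le_trans (lee_abs_add _ _)); rewrite leeD2r//.
  apply: le_trans (le_abse_integral _ _ _) _ => //.
  exact: (measurable_time_section mlE).
split; first by apply/integrableP; split; [exact: mF ca sX|rewrite (le_lt_trans bnd')// ltry].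
by apply: le_trans bnd'; apply: le_abse_integral => //; exact: mF ca sX.
Qed.

(** Comparing signed running costs path by path requires monotonicity and additivity of the time
    integral, hence integrability along almost every path. *)
Let path_integrable x a X al : control a -> solution x a X -> 0 <= al ->
  (\int[P]_w \int[mu]_(r in `[t, T]) (`|a r w| ^+ 2)%:E <= al%:E)%E ->
  {ae P, forall w, mu.-integrable `[t, T] (fun r => (l (X r w) (a r w))%:E)}.
Proof.
move=> ca sX al0 aal; have bnd := cost_terms_bound ca sX al0 aal.
have mlE : measurable_fun (strip t T) (fun z : R * Omega => (l (X z.1 z.2) (a z.1 z.2))%:E).
  by apply/measurable_EFinP; exact: ml ca sX.
have mla : measurable_fun (strip t T) (fun z : R * Omega => (`|l (X z.1 z.2) (a z.1 z.2)|)%:E).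
  by apply/measurable_EFinP; apply: measurableT_comp => //; exact: ml ca sX.
have l0 w : (0 <= \int[mu]_(r in `[t, T]) (`|l (X r w) (a r w)|)%:E)%E.
  by apply: integral_ge0 => r _; rewrite lee_fin.
have lfin : {ae P, forall w, (\int[mu]_(r in `[t, T]) (`|l (X r w) (a r w)|)%:E < +oo)%E}.
  apply: ae_lt_pinfty => //.
    by apply: (measurable_time_integral mla) => z _; rewrite lee_fin.
  apply: (@le_lt_trans _ _ (cost_bound x al)%:E); last by rewrite ltry.
  apply: le_trans bnd; apply: ge0_le_integral_nonmeas => w _ //.
  by rewrite leeDl// lee_fin.
apply: filterS lfin => w lw; apply/integrableP; split=> //.
exact: (measurable_time_section mlE).
Qed.

Lemma cost_bounded x al : 0 <= al -> exists K : R, forall a X,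
  control a -> solution x a X ->
  (\int[P]_w \int[mu]_(r in `[t, T]) (`|a r w| ^+ 2)%:E <= al%:E)%E ->
  (`|cost P l g t T a X| <= K%:E)%E.
Proof.
by move=> al0; exists (cost_bound x al) => a X ca sX aal; have [] := cost_integrable ca sX al0 aal.
Qed.

Lemma cost_ge x a X m : control a -> solution x a X ->
  (forall x a, L0 a -> m <= l x a /\ m <= g x) ->
  ((m * (T - t) + m)%:E <= cost P l g t T a X)%E.
Proof.
move=> ca sX lg; have [aL0 _ _] := ca.
have [al al0 aal] := control_sqr_integrable ca.
have [iF _] := cost_integrable ca sX al0 aal.
rewrite -(integral_prob_cst P); apply: ae_le_integral => //.
  exact: integrable_cst_prob.
apply: filterS (path_integrable ca sX al0 aal) => w iw.
have [a1 La1] := L0_neq0.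
rewrite EFinD; apply: leeD; last by rewrite lee_fin; have [] := lg (X T w) a1 La1.
rewrite -integral_itv_cst//; apply: le_integral => //.
  apply/integrableP; split=> //.
  by rewrite /= integral_itv_cst// ltry.
by move=> r; rewrite inE /= in_itv /= => trT; rewrite lee_fin; have [] := lg (X r w) _ (aL0 r w trT).
Qed.

(** Under a common control the costs differ by at most [G] times the running plus the terminal weak
    distance; [1 + (T - t) <= expR (T - t)] merges the two and gives the last [+ 1] of the rate. *)
Lemma cost_lipschitz x x' a X X' : control a ->
  solution x a X -> solution x' a X' ->
  (cost P l g t T a X <= cost P l g t T a X' +
     (G * Num.sqrt difference_factor * expR (((difference_rate + 1) / 2 + 1) * (T - t)) * norm_m1 B (x - x'))%:E)%E.
Proof.
move=> ca sX sX'; have [aL0 _ _] := ca; have [pX _ _] := sX; have [pX' _ _] := sX'.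
have [al al0 aal] := control_sqr_integrable ca.
have [iF _] := cost_integrable ca sX al0 aal.
have [iF' _] := cost_integrable ca sX' al0 aal.
pose D (z : R * Omega) := norm_m1 B (X z.1 z.2 - X' z.1 z.2).
have mD : measurable_fun (strip t T) (fun z => (D z)%:E).
  apply/measurable_EFinP; apply: (measurable_fun_subr (F := norm_m1 B) sepH) => [U oU|U oU|].
  - exact: progressive_strip pX oU.
  - exact: progressive_strip pX' oU.
  - exact: continuous_norm_m1.
have D0 z : (0 <= (D z)%:E)%E by rewrite lee_fin norm_m1_ge0.
(* The square root of the bound in [solution_difference], hence half its rate. *)
set e := Num.sqrt difference_factor * expR ((difference_rate + 1) / 2 * (T - t)) * norm_m1 B (x - x').
have factor0 : 0 <= difference_factor.
  by rewrite addr_ge0// !mulr_ge0 ?sqr_ge0 ?addr_ge0 ?mulr_ge0// ltW.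
have e0 : 0 <= e.
  by rewrite mulr_ge0 ?norm_m1_ge0// mulr_ge0 ?sqrtr_ge0// expR_ge0.
have ED s : t <= s <= T -> (\int[P]_w (D (s, w))%:E <= e%:E)%E.
  move=> tsT; apply: integral_le_of_sqr => //.
  - by apply/measurable_EFinP; exact: (measurable_space_section mD tsT).
  - by move=> w; exact: norm_m1_ge0.
  have := solution_difference ca sX sX' tsT.
  have -> : e ^+ 2 = difference_factor * expR ((difference_rate + 1) * (T - t)) * N (x - x').
    rewrite /e !exprMn sqr_sqrtr// (sqr_norm_m1 B_gt0) -expRM_natl.
    by congr (_ * expR _ * _); field.
  apply: le_trans; apply: ge0_le_integral_nonmeas => w _; rewrite lee_fin ?sqr_ge0//.
  by rewrite /D (sqr_norm_m1 B_gt0).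
pose Dd w := (G%:E * (\int[mu]_(r in `[t, T]) (D (r, w))%:E + (D (T, w))%:E))%E.
have iD0 w : (0 <= \int[mu]_(r in `[t, T]) (D (r, w))%:E)%E by exact: integral_ge0.
have mID : measurable_fun setT (fun w => \int[mu]_(r in `[t, T]) (D (r, w))%:E)%E.
  by apply: (measurable_time_integral mD) => z _.
have mDT : measurable_fun setT (fun w => (D (T, w))%:E) by exact: (measurable_space_section mD tTT).
have Dd0 w : (0 <= Dd w)%E by apply: mule_ge0; [rewrite lee_fin ltW|exact: adde_ge0].
have mDd : measurable_fun setT Dd.
  by apply: measurable_funeM; exact: emeasurable_funD.
have EID : (\int[P]_w \int[mu]_(r in `[t, T]) (D (r, w))%:E <= (e * (T - t))%:E)%E.
  rewrite (tonelli_time P mD (fun z _ => D0 z)) -integral_itv_cst//.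
  apply: ge0_le_integral_nonmeas => r; rewrite /= in_itv /= => trT; last exact: ED.
  exact: integral_ge0.
have EDd : (\int[P]_w Dd w <= (G * (e * (T - t) + e))%:E)%E.
  have GE : (0 <= G%:E)%E by rewrite lee_fin ltW.
  rewrite ge0_integralZl//; last 2 first.
  - exact: emeasurable_funD.
  - by move=> w _; exact: adde_ge0.
  rewrite EFinM lee_wpmul2l ?lee_fin ?(ltW G0)// ge0_integralD// EFinD.
  by apply: leeD => //; exact: ED.
have iDd : P.-integrable setT Dd.
  apply/integrableP; split=> //; apply: le_lt_trans (ltry (G * (e * (T - t) + e))).
  by apply: le_trans EDd; apply: ge0_le_integral_nonmeas => w _ //; rewrite gee0_abs.
have IDfin : {ae P, forall w, (\int[mu]_(r in `[t, T]) (D (r, w))%:E < +oo)%E}.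
  by apply: ae_lt_pinfty => //; rewrite (le_lt_trans EID)// ltry.
apply: (@le_trans _ _ (\int[P]_w (F a X' w + Dd w))%E).
  apply: ae_le_integral => //; first exact: integrableD.
  apply: filterS3 IDfin (path_integrable ca sX al0 aal) (path_integrable ca sX' al0 aal).
  move=> w Dfin iw iw'.
  rewrite /F /Dd ge0_muleDr// addeACA; apply: leeD; last first.
    by rewrite -EFinM -EFinD lee_fin addrC -lerBlDr (le_trans (ler_norm _)).
  have msec := measurable_time_section mD w.
  have iD : mu.-integrable `[t, T] (fun r => (G%:E * (D (r, w))%:E)%E).
    apply/integrableP; split; first exact: measurable_funeM.
    apply: (@le_lt_trans _ _ (G%:E * \int[mu]_(r in `[t, T]) (D (r, w))%:E)%E).
      rewrite -ge0_integralZl//; last by rewrite lee_fin ltW.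
      apply: ge0_le_integral_nonmeas => r _ //.
      by rewrite gee0_abs// mule_ge0// lee_fin ltW.
    by rewrite lte_mul_pinfty// lee_fin ltW.
  rewrite -ge0_integralZl//; last by rewrite lee_fin ltW.
  rewrite -integralD//; apply: le_integral => //; first exact: integrableD.
  move=> r; rewrite inE /= in_itv /= => trT; rewrite -EFinM -EFinD lee_fin.
  have [h _ _] := cost_coef (X r w) (X' r w) (aL0 r w trT).
  by rewrite addrC -lerBlDr (le_trans (ler_norm _)).
rewrite integralD// leeD2l//; apply: (le_trans EDd); rewrite lee_fin.
have -> : G * Num.sqrt difference_factor * expR (((difference_rate + 1) / 2 + 1) * (T - t)) * norm_m1 B (x - x') =
  G * (expR (T - t) * e).
  have -> : ((difference_rate + 1) / 2 + 1) * (T - t) = (T - t) + (difference_rate + 1) / 2 * (T - t) by ring.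
  by rewrite expRD /e; ring.
rewrite ler_wpM2l ?(ltW G0)//.
have -> : e * (T - t) + e = (1 + (T - t)) * e by ring.
by rewrite ler_wpM2r// expR_ge1Dx.
Qed.

End solutions.

(** * From costs to the value function *)

Theorem theorem5p5 (R : realType) (H Xi : hilbertType R)
    (Lam : completeNormedModType R)
    (sepH : separable_space H) (sepXi : separable_space Xi)
    (sepLam : separable_space Lam)
    (L0 : set Lam) (L0_neq0 : L0 !=set0) (L0_convex : convex_set L0)
    (p : R) (p_gt2 : 2 < p)
    (E : set Xi) (E_basis : orthonormal_basis E)
    (D : set H) (A : H -> H) (A_linear : linear_on D A) (A_dense : dense D)
    (A_diss : maximal_dissipative D A)
    (S : R -> {linear H -> H}) (S_semigroup : contraction_semigroup S)
    (A_generates : is_generator D A S)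
    (b : H -> Lam -> H) (sigma : H -> Lam -> {linear Xi -> H})
    (sigma_hs : forall x a, hilbert_schmidt E (sigma x a))
    (l : H -> Lam -> R) (g : H -> R)
    (B : {linear H -> H})
    (hyp_a : weak_B_condition D A B)
    (hyp_b : state_coefficients_condition E B L0 b sigma)
    (hyp_c : cost_coefficients_condition B L0 l g) :
  exists C1 C2 : R, forall (T t : R), 0 < T -> 0 <= t <= T ->
  forall (d : measure_display) (Omega : measurableType d)
    (P : probability Omega R) (W : R -> Xi -> Omega -> R),
    measure_is_complete P -> cylindrical_wiener P W t T ->
  forall X : H -> (R -> Omega -> Lam) -> R -> Omega -> H,
    (forall x a, admissible_controls P W L0 p t T a ->
       is_mild_solution P W E S b sigma t T x a (X x a)) ->
  let V := value_function P W l g L0 p t T X in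
  forall x y : H,
    (`|V x - V y| <= (C1 * expR (C2 * (T - t)) * norm_m1 B (x - y))%:E)%E.
Proof.
have [B_cont B_sym B_gt0 [K [c0 [_ HK c00 Kge]]]] := hyp_a.
have [M M0 BM] := weak_sqnorm_le B_cont.
have SB := weak_sqnorm_semigroup A_dense S_semigroup A_generates B_cont B_sym B_gt0 HK c00 Kge.
have [_ _ [C C0 coef]] := hyp_b; have [l_cont [G G0 cc] l_low] := hyp_c.
exists (G * Num.sqrt (difference_factor M C)), ((difference_rate M c0 C + 1) / 2 + 1).
move=> T t T0 /andP[t0 tT] d Omega P W Pc hW X HX V.
pose L x y := G * Num.sqrt (difference_factor M C) *
  expR (((difference_rate M c0 C + 1) / 2 + 1) * (T - t)) * norm_m1 B (x - y).
have inf_ge x (m : \bar R) : (forall a, admissible_controls P W L0 p t T a ->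
    m <= cost P l g t T a (X x a))%E -> (m <= V x)%E.
  by move=> h; apply: le_ereal_inf_tmp => _ [a ca <-]; exact: h.
have inf_le x a : admissible_controls P W L0 p t T a -> (V x <= cost P l g t T a (X x a))%E.
  by move=> ca; apply: ereal_inf_lbound; exists a.
(* A control does not depend on the initial point, so the inequality between costs passes to the
   infimum; exchanging [x] and [y] gives the other side. *)
have lip x y : (V x <= V y + (L x y)%:E)%E.
  rewrite -leeBlDr//; apply: inf_ge => a ca; rewrite leeBlDr//.
  apply: (le_trans (inf_le x a ca)).
  exact: (cost_lipschitz Pc hW sepH sepXi sepLam E_basis S_semigroup tT B_cont B_sym B_gt0
    M0 BM c00 SB p_gt2 C0 sigma_hs coef L0_neq0 G0 l_cont cc ca (HX x a ca) (HX y a ca)).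
have bounded := cost_bounded Pc hW sepH sepXi sepLam E_basis S_semigroup tT B_gt0
    M0 BM p C0 sigma_hs coef L0_neq0 G0 l_cont cc.
have [a0 La0] := L0_neq0.
have ca0 : admissible_controls P W L0 p t T (fun=> fun=> a0).
  split=> //; first exact: progressive_cst.
  under eq_integral do rewrite integral_itv_cst//.
  by rewrite integral_prob_cst ltry.
(* [lip] also holds for infinite values, but the absolute difference needs finite ones. From above,
   the cost of the constant control [a0] suffices. *)
have Vfin x : V x \is a fin_num.
  rewrite fin_numElt; apply/andP; split; last first.
    have [al al0 aal] := control_sqr_integrable Pc hW tT p_gt2 ca0.
    have [k hk] := bounded x al al0.
    apply: (le_lt_trans (inf_le x _ ca0)); apply: (le_lt_trans (lee_abs _)).
    by apply: (le_lt_trans (hk _ _ ca0 (HX x _ ca0) aal)); rewrite ltry.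
  (* From below: for unbounded [L0], the common lower bound of [l] and [g] is used; for bounded
     [L0], all controls share one energy bound and hence all costs one bound. *)
  have [Lb|Lu] := pselect (bounded_set L0); last first.
    have [m hm] := l_low Lu; apply: (@lt_le_trans _ _ (m * (T - t) + m)%:E); first exact: ltNyr.
    apply: inf_ge => a ca.
    exact: (cost_ge Pc hW sepH sepXi sepLam E_basis S_semigroup tT B_gt0
      M0 BM p_gt2 C0 sigma_hs coef L0_neq0 G0 l_cont cc ca (HX x a ca) hm).
  have [rho rho0 hrho] : exists2 rho : R, 0 <= rho & forall a, L0 a -> `|a| <= rho.
    have [r [_ hr]] := Lb; exists (`|r| + 1); first by rewrite addr_ge0.
    by move=> a La; apply: hr => //; rewrite (le_lt_trans (ler_norm _))// ltrDl.
  have al0 : 0 <= rho ^+ 2 * (T - t) by rewrite mulr_ge0 ?sqr_ge0// subr_ge0.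
  have [k hk] := bounded x _ al0.
  apply: (@lt_le_trans _ _ (- k)%:E); first exact: ltNyr.
  apply: inf_ge => a ca; rewrite EFinN leeNl; apply: (le_trans (lee_abs _)); rewrite abseN.
  apply: (hk _ _ ca (HX x a ca)); rewrite -(integral_prob_cst P).
  have [aL0 _ _] := ca.
  apply: ge0_le_integral_nonmeas => w _.
    by apply: integral_ge0 => r _; rewrite lee_fin sqr_ge0.
  rewrite -integral_itv_cst//; apply: ge0_le_integral_nonmeas => r; rewrite /= in_itv /= => trT.
    by rewrite lee_fin sqr_ge0.
  by rewrite lee_fin lerXn2r ?nnegrE//; exact: hrho (aL0 r w trT).
move=> x y; rewrite -/(L x y).
have Lsym : L y x = L x y.
  by rewrite /L -[y - x]opprB /norm_m1 linearN innerNl innerNr opprK.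
have := lip x y; have := lip y x; rewrite Lsym.
rewrite -(fineK (Vfin x)) -(fineK (Vfin y)) -EFinB -!EFinD !lee_fin ler_norml.
by move: (fine _) (fine _) => u v h1 h2; lra.
Qed.
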